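(* Let $(M,N)$ be a weighted manifold pair, with a weighting of order $r$, and let $\nu_{\mathcal W}(M,N)=\mathrm{Hom}_{\mathrm{alg}}(\mathrm{gr}(C^\infty(M)),\mathbb{R})$ be its weighted normal bundle. (a) The weighted normal bundle $\nu_{\mathcal W}(M,N)$ has a unique structure as a graded bundle over $N$, of dimension equal to that of $M$, in such a way that $$C^\infty_{\mathrm{pol}}(\nu_{\mathcal W}(M,N))=\mathrm{gr}(C^\infty(M))$$ as graded algebras. (b) Given weighted coordinates $x_1,\dots,x_n$ on $U\subseteq M$, the homogeneous approximations $(x_a)^{[w_a]}$ for $a=1,\dots,n$ serve as graded bundle coordinates on $\nu_{\mathcal W}(M,N)|_{U\cap N}$.
   Context: Weightings. A weight sequence of order $r$ is a sequence of integers $0\le w_1\le\dots\le w_n\le r$; put $k_i=\#\{a:w_a\le i\}$. For a chart $U$ with coordinates $x_1,\dots,x_n$, let $C^\infty(U)_{(i)}$ be the ideal generated by monomials $x^s=x_1^{s_1}\cdots x_n^{s_n}$ with $\sum_a s_aw_a\ge i$. An order $r$ weighting on an $n$-dimensional manifold $M$ is a filtration $C^\infty_M=C^\infty_{M,(0)}\supseteq C^\infty_{M,(1)}\supseteq\cdots$ of the structure sheaf by ideal sheaves such that every point has an open neighborhood $U$ with coordinates $x_a$ (weighted coordinates) in which the filtration of $C^\infty(U)$ is given by this local model for a weight sequence of order $r$ (which may depend on the connected component of $N$). $C^\infty_{M,(1)}$ is the vanishing ideal of a closed submanifold $N$; $(M,N)$ is then called a weighted manifold pair. Global sections are denoted $C^\infty(M)_{(i)}$.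 Weighted normal bundle. $\mathrm{gr}(C^\infty(M))=\bigoplus_{i\ge0}C^\infty(M)_{(i)}/C^\infty(M)_{(i+1)}$, with degree $0$ part $C^\infty(N)$. For $f\in C^\infty(M)_{(i)}$ its class in degree $i$ is denoted $f^{[i]}$ (the $i$-th homogeneous approximation) and is viewed as the function on $\nu_{\mathcal W}(M,N)=\mathrm{Hom}_{\mathrm{alg}}(\mathrm{gr}(C^\infty(M)),\mathbb{R})$ given by evaluation. The projection $\nu_{\mathcal W}(M,N)\to N$ is induced by the inclusion of the degree $0$ part $C^\infty(N)$, and the $(\mathbb{R},\cdot)$-action is dual to multiplication by $t^i$ in degree $i$. For open $U\subseteq M$, the restriction $\nu_{\mathcal W}(M,N)|_{U\cap N}$ is identified with $\nu_{\mathcal W}(U,U\cap N)$. Graded bundles. A graded bundle is a manifold $E$ with a smooth action $t\mapsto\kappa_t$ of the multiplicative monoid $(\mathbb{R},\cdot)$; it is a fiber bundle $\pi=\kappa_0:E\to N$ over its base $N=\kappa_0(E)$. A smooth function $f$ on $E$ is homogeneous of degree $k$ if $\kappa_t^*f=t^kf$; $C^\infty_{\mathrm{pol}}(E)$ is the graded algebra given by the direct sum over $k\ge0$ of the spaces of homogeneous functions of degree $k$. Graded bundle coordinates are coordinates $y_1,\dots,y_n$ defined on $\pi^{-1}(O)$, $O\subseteq N$ open, with $y_a$ homogeneous of degree $w_a$, the weight sequence of $E$. *)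

(* Defs.v *)
From HB Require Import structures.
From mathcomp Require Import all_boot all_order all_algebra.
From mathcomp Require Import generic_quotient ring_quotient.
From mathcomp Require Import zify.
From mathcomp Require Import all_classical all_reals all_analysis.

Set Implicit Arguments.
Unset Strict Implicit.
Unset Printing Implicit Defensive.

Import Order.TTheory GRing.Theory Num.Theory.
Import numFieldNormedType.Exports.

Local Open Scope classical_set_scope.
Local Open Scope ring_scope.

(* -------------------------------------------------------------------------- *)
(** * Smooth manifolds *)

(* C^k functions on an open set V of R^n; only the values of g on V matter. *)
Fixpoint Ck (R : realType) (n k : nat) (V : set 'rV[R]_n)
    (g : 'rV[R]_n -> R) : Prop :=
  (forall v, V v -> {for v, continuous g}) /\
  (if k is k'.+1 then
     forall i : 'I_n, (forall v, V v -> derivable g v (delta_mx 0 i)) /\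
       Ck k' V ('D_(delta_mx 0 i) g)
   else True).

Definition Csmooth (R : realType) (n : nat) (V : set 'rV[R]_n)
  (g : 'rV[R]_n -> R) : Prop := forall k, Ck k V g.

Lemma Csmooth_cst (R : realType) (n : nat) (V : set 'rV[R]_n) (a : R) :
  Csmooth V (cst a).
Proof.
move=> k; elim: k a => [|k IHk] a; split=> //.
- by move=> v _; exact: cst_continuous.
- by move=> v _; exact: cst_continuous.
move=> i; split=> [v _|]; first exact: derivable_cst.
rewrite (_ : 'D_(delta_mx 0 i) (cst a) = cst 0); first exact: IHk.
by apply/funext => v; rewrite derive_cst.
Qed.

(* A partial map X -> R^n with domain dom; the values outside dom are junk.   *)
Record pchart (R : realType) (X : Type) (n : nat) :=
  PChart { dom : set X ; coord :> X -> 'rV[R]_n }.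

Definition is_chart (R : realType) (X : Type) (n : nat) (c : pchart R X n) :=
  (forall x y, dom c x -> dom c y -> c x = c y -> x = y) /\
  open (c @` dom c).

(* f \o c^-1 is smooth on c(U `&` dom c), stated without the inverse of c.    *)
Definition smooth_in (R : realType) (X : Type) (n : nat) (c : pchart R X n)
    (U : set X) (f : X -> R) : Prop :=
  exists2 g, Csmooth (c @` (U `&` dom c)) g &
    forall x, U x -> dom c x -> f x = g (c x).

Definition compatible (R : realType) (X : Type) (n : nat)
    (c d : pchart R X n) : Prop :=
  open (c @` (dom d `&` dom c)) /\
  (forall a, smooth_in c (dom d) (fun x => d x 0 a)).

(* A maximal smooth atlas.  As it is maximal, two smooth structures on X are  *)
(* equal as records iff they are the same smooth structure (and topology).    *)
Record smooth_structure (R : realType) (X : Type) (n : nat) :=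
  SmoothStructure {
    charts :> set (pchart R X n) ;
    charts_chart : forall c, charts c -> is_chart c ;
    charts_cover : forall x, exists2 c, charts c & dom c x ;
    charts_compat : forall c d, charts c -> charts d -> compatible c d ;
    charts_max : forall c, is_chart c ->
      (forall d, charts d -> compatible c d /\ compatible d c) -> charts c }.

(* X with the topology defined by the atlas. *)
Definition mtop (R : realType) (X : Type) (n : nat)
  (S : smooth_structure R X n) : Type := X.

Section Mtop.
Context (R : realType) (X : Type) (n : nat) (S : smooth_structure R X n).

HB.instance Definition _ := gen_eqMixin (mtop S).
HB.instance Definition _ := gen_choiceMixin (mtop S).

Definition chart_open (U : set (mtop S)) : Prop :=
  forall c, charts S c -> open (c @` (U `&` dom c)).

Lemma chart_openT : chart_open setT.
Proof. by move=> c /charts_chart[_]; rewrite setTI. Qed.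

Lemma chart_openI : setI_closed chart_open.
Proof.
move=> U V oU oV c Sc.
rewrite (_ : _ @` _ = c @` (U `&` dom c) `&` c @` (V `&` dom c)).
  by apply: openI; [exact: oU|exact: oV].
have [cI _] := charts_chart Sc.
apply/seteqP; split=> [_ [x [[Ux Vx] cx] <-]|_ [[x [Ux cx] <-] [y [Vy cy] e]]].
  by split; exists x.
by rewrite (cI _ _ cy cx e) in Vy; exists x.
Qed.

Lemma chart_open_bigU (I : Type) (f : I -> set (mtop S)) :
  (forall i, chart_open (f i)) -> chart_open (\bigcup_i f i).
Proof.
move=> of_ c Sc; rewrite setI_bigcupl image_bigcup.
by apply: bigcup_open => i _; exact: of_.
Qed.

HB.instance Definition _ := @isOpenTopological.Build (mtop S) chart_open
  chart_openT chart_openI chart_open_bigU.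

End Mtop.

Record manifold (R : realType) (X : Type) (n : nat) := Manifold {
  mfd :> smooth_structure R X n ;
  mfd_hausdorff : hausdorff_space (mtop mfd) ;
  mfd_second_countable : @second_countable (mtop mfd) }.

Definition mopen (R : realType) (X : Type) (n : nat)
  (S : smooth_structure R X n) (U : set X) : Prop := open (U : set (mtop S)).

Lemma mopenE (R : realType) (X : Type) (n : nat)
    (S : smooth_structure R X n) (U : set X) :
  mopen S U <-> forall c, charts S c -> open (c @` (U `&` dom c)).
Proof. by []. Qed.

Lemma mopen_dom (R : realType) (X : Type) (n : nat)
  (S : smooth_structure R X n) (c : pchart R X n) :
  charts S c -> mopen S (dom c).
Proof. by move=> Sc; apply/mopenE => d Sd; have [] := charts_compat Sd Sc. Qed.

(* C^oo(U), for U open: total functions whose restriction to U is smooth.     *)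
Definition smooth (R : realType) (X : Type) (n : nat)
    (S : smooth_structure R X n) (U : set X) : set (X -> R) :=
  [set f | forall c, charts S c -> smooth_in c U f].

Lemma smooth_cst (R : realType) (X : Type) (n : nat)
  (S : smooth_structure R X n) (U : set X) (a : R) : smooth S U (cst a).
Proof. by move=> c _; exists (cst a) => //; exact: Csmooth_cst. Qed.

(* "q is a smooth function of p", for p : T -> X and q : T -> Y: near each    *)
(* point of p(T) there is a smooth map G, in charts from the atlases A and B, *)
(* with q = G \o p.  For T = X and p = id this is smoothness of q : X -> Y;   *)
(* for T a subset of X and p the inclusion, it is the smoothness of a map     *)
(* defined on a subset (local extendability to a smooth map).                 *)
Definition smooth_map (R : realType) (T X Y : Type) (m l : nat)
    (A : set (pchart R X m)) (B : set (pchart R Y l))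
    (p : T -> X) (q : T -> Y) : Prop :=
  forall t0, exists c d (V : set X) (G : 'I_l -> 'rV[R]_m -> R),
    [/\ A c, B d, V `<=` dom c, open (c @` V) & V (p t0)] /\
    (forall a, Csmooth (c @` V) (G a)) /\
    (forall t, V (p t) ->
       dom d (q t) /\ forall a, d (q t) 0 a = G a (c (p t))).

Definition line_atlas (R : realType) : set (pchart R R 1) :=
  [set PChart setT (fun t => const_mx t)].

Definition prod_atlas (R : realType) (X Y : Type) (m l : nat)
    (A : set (pchart R X m)) (B : set (pchart R Y l)) :
    set (pchart R (X * Y) (m + l)) :=
  [set e | exists c d, [/\ A c, B d & e =
     PChart (dom c `*` dom d) (fun z => row_mx (c z.1) (d z.2))]].

Definition closed_submanifold (R : realType) (X : Type) (n : nat)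
    (S : smooth_structure R X n) (N : set X) : Prop :=
  closed (N : set (mtop S)) /\
  forall x, N x -> exists c (J : {set 'I_n}), [/\ charts S c, dom c x &
    forall y, dom c y -> (N y <-> forall a, a \in J -> c y 0 a = 0)].

(* -------------------------------------------------------------------------- *)
(** * Graded bundles *)

Record graded_bundle (R : realType) (X : Type) (n : nat) (E : manifold R X n)
    (kappa : R -> X -> X) : Prop := GradedBundle {
  gb_one : forall x, kappa 1 x = x ;
  gb_mul : forall s t x, kappa (s * t) x = kappa s (kappa t x) ;
  gb_smooth : smooth_map (prod_atlas (@line_atlas R) (charts E)) (charts E)
    id (fun z => kappa z.1 z.2) }.

(* The map p : X -> N identifies the base kappa_0(X) with the submanifold N   *)
(* of M (via a diffeomorphism N -> kappa_0(X), written as a section s of p),  *)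
(* in such a way that kappa_0 becomes p.                                      *)
Definition graded_bundle_over (R : realType) (X : Type) (n : nat)
    (E : manifold R X n) (kappa : R -> X -> X)
    (M : Type) (m : nat) (S : smooth_structure R M m) (N : set M) (p : X -> N) : Prop :=
  graded_bundle E kappa /\
  exists s : N -> X,
    [/\ smooth_map (charts E) (charts S) id (fun x => val (p x)),
        smooth_map (charts S) (charts E) val s,
        cancel s p & forall x, s (p x) = kappa 0 x].

Definition homog (R : realType) (X : Type) (n : nat) (E : manifold R X n)
    (kappa : R -> X -> X) (k : nat) : set (X -> R) :=
  [set f | smooth E setT f /\ forall t x, f (kappa t x) = t ^+ k * f x].

(* Homogeneous functions of distinct degrees are linearly independent, so the *)
(* direct sum is realised as a sum inside the algebra of functions on X.      *)
Definition Cpol (R : realType) (X : Type) (n : nat) (E : manifold R X n)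
    (kappa : R -> X -> X) : set (X -> R) :=
  [set f | exists m (h : nat -> X -> R),
     (forall k, homog E kappa k (h k)) /\ f = \sum_(k < m) h k].

Definition graded_coordinates (R : realType) (X : Type) (n : nat)
    (E : manifold R X n) (kappa : R -> X -> X) (w : 'I_n -> nat)
    (y : pchart R X n) : Prop :=
  [/\ charts E y,
      exists2 O, mopen E O & dom y = kappa 0 @^-1` O &
      forall a t x, dom y x -> y (kappa t x) 0 a = t ^+ w a * y x 0 a].

(* -------------------------------------------------------------------------- *)
(** * The associated graded algebra of a filtered algebra of functions *)

(* A filtration, by subspaces, of a subalgebra fil 0 of the algebra T -> R.   *)
Record filtration (R : realType) (T : Type) := Filtration {
  fil :> nat -> set (T -> R) ;
  fil_0 : forall i, fil i 0 ;
  fil_D : forall i f g, fil i f -> fil i g -> fil i (f + g) ;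
  fil_Z : forall i (a : R) f, fil i f -> fil i (a *: f) ;
  fil_1 : fil 0%N 1 ;
  fil_M : forall i j f g, fil i f -> fil j g -> fil (i + j)%N (f * g) ;
  fil_S : forall i, fil i.+1 `<=` fil i }.

Section Gr.
Context (R : realType) (T : Type).
Implicit Types F G : filtration R T.

Lemma fil_sum F i (I : Type) (s : seq I) (P : pred I) (f : I -> T -> R) :
  (forall j, P j -> fil F i (f j)) -> fil F i (\sum_(j <- s | P j) f j).
Proof.
by move=> Ff; elim/big_ind: _ => //; [exact: fil_0 | move=> *; exact: fil_D].
Qed.

(* \bigoplus_i F_i : finitely supported sequences p with p_i in F_i. *)
Definition reesP F : pred (nat -> T -> R) := fun p =>
  `[< (forall i, fil F i (p i)) /\
      exists m, forall i, (m <= i)%N -> p i = 0 >].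

Record rees F := Rees { rval :> nat -> T -> R ; _ : rval \in reesP F }.
HB.instance Definition _ F := [isSub for (@rval F)].
HB.instance Definition _ F := [Choice of rees F by <:].

Lemma reesP_submod F : subsemimod_closed (reesP F).
Proof.
split; [split|].
- by apply/asboolP; split=> [i|]; [exact: fil_0 | exists 0%N].
- move=> p q /asboolP[Fp [m pm]] /asboolP[Fq [l ql]]; apply/asboolP.
  split=> [i|]; first by apply: fil_D.
  exists (maxn m l) => i; rewrite geq_max => /andP[mi li].
  by change (p i + q i = 0); rewrite pm// ql// addr0.
- move=> a p /asboolP[Fp [m pm]]; apply/asboolP.
  split=> [i|]; first exact: fil_Z.
  by exists m => i mi; change (a *: p i = 0); rewrite pm// scaler0.
Qed.
HB.instance Definition _ F :=
  GRing.SubChoice_isSubLmodule.Build R (nat -> T -> R) (reesP F) (rees F)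
    (reesP_submod F).

Lemma reesF F (p : rees F) i : fil F i (p i).
Proof. by case: p => p /= /asboolP[]. Qed.

Lemma rees_ext F (p q : rees F) : (forall i, p i = q i) -> p = q.
Proof. by move=> pq; apply/val_inj/funext. Qed.

Lemma reesD F (p q : rees F) i : (p + q) i = p i + q i.
Proof. by []. Qed.

Definition conv (p q : nat -> T -> R) : nat -> T -> R :=
  fun i => \sum_(j < i.+1) p j * q (i - j)%N.

Lemma conv_rees F (p q : rees F) : conv p q \in reesP F.
Proof.
apply/asboolP; split=> [i|].
  apply: fil_sum => j _.
  have := fil_M (reesF p j) (reesF q (i - j)).
  by rewrite subnKC// -ltnS.
case: p => p /= /asboolP[_ [m pm]]; case: q => q /= /asboolP[_ [l ql]].
exists (m + l)%N => i mli; rewrite /conv big1// => j _.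
have [mj|jm] := leqP m j; first by rewrite pm// mul0r.
rewrite ql ?mulr0//; lia.
Qed.
Definition rees_mul F (p q : rees F) : rees F := Rees (conv_rees p q).

Definition unit_seq (k : nat) (f : T -> R) : nat -> T -> R :=
  fun i => if i == k then f else 0.

Lemma unit_seqP F k f : fil F k f -> unit_seq k f \in reesP F.
Proof.
move=> Ff; apply/asboolP; split=> [i|].
  by rewrite /unit_seq; case: eqP => [->//|_]; exact: fil_0.
by exists k.+1 => i ki; rewrite /unit_seq gtn_eqF.
Qed.
Definition rees_one F : rees F := Rees (unit_seqP (fil_1 F)).

Lemma convC (p q : nat -> T -> R) : conv p q = conv q p.
Proof.
apply/funext => i; rewrite /conv (reindex_inj rev_ord_inj) /=.
by apply: eq_bigr => j _; rewrite (sub_ordK j) mulrC.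
Qed.

Lemma rees_mulC F : commutative (@rees_mul F).
Proof. by move=> p q; apply: val_inj; exact: convC. Qed.

Lemma rees_mulA F : associative (@rees_mul F).
Proof.
move=> p q r; apply: rees_ext => i.
change (conv p (conv q r) i = conv (conv p q) r i).
rewrite (convC q) (convC _ r) /conv.
pose f j k := p j * (r k * q (i - j - k)%N).
transitivity (\sum_(j < i.+1) \sum_(k < i.+1 | (k <= i - j)%N) f j k).
  apply: eq_bigr => /= j _; rewrite big_distrr /=.
  by rewrite (big_ord_narrow_leq (leq_subr _ _)).
rewrite (exchange_big_dep predT) //=; apply: eq_bigr => k _.
transitivity (\sum_(j < i.+1 | (j <= i - k)%N) f j k).
  by apply: eq_bigl => j; have := ltn_ord j; have := ltn_ord k; lia.
rewrite (big_ord_narrow_leq (leq_subr _ _)) big_distrr /=.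
by apply: eq_bigr => j _; rewrite /f mulrCA -!subnDA addnC.
Qed.

Lemma rees_mul1 F : left_id (rees_one F) (@rees_mul F).
Proof.
move=> p; apply: rees_ext => i.
change (conv (unit_seq 0 1) p i = p i).
rewrite /conv big_ord_recl subn0 /unit_seq eqxx mul1r big1 ?addr0// => j _.
by rewrite mul0r.
Qed.

Lemma rees_mulDl F : left_distributive (@rees_mul F) +%R.
Proof.
move=> p q r; apply: rees_ext => i.
change (conv (p + q) r i = conv p r i + conv q r i).
by rewrite /conv -big_split /=; apply: eq_bigr => j _; rewrite -mulrDl.
Qed.

HB.instance Definition _ F := GRing.Zmodule_isComPzRing.Build (rees F)
  (@rees_mulA F) (@rees_mulC F) (@rees_mul1 F) (@rees_mulDl F).

Lemma rees_scaleAl F (a : R) (p q : rees F) : a *: (p * q) = (a *: p) * q.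
Proof.
apply: rees_ext => i.
change (a *: conv p q i = conv (a *: (p : nat -> T -> R)) q i).
rewrite /conv scaler_sumr; apply: eq_bigr => j _.
by apply/funext => x; exact: mulrA.
Qed.

(* The ideal \bigoplus_i F_(i+1) of \bigoplus_i F_i.                          *)
Definition gr_ideal F : pred (rees F) := fun p =>
  `[< forall i, fil F i.+1 (p i) >].

Lemma gr_ideal_zmod F : zmod_closed (@gr_ideal F).
Proof.
split=> [|p q /asboolP Fp /asboolP Fq]; apply/asboolP => i; first exact: fil_0.
change (fil F i.+1 (p i - q i)); rewrite -scaleN1r.
by apply: fil_D => //; exact: fil_Z.
Qed.
HB.instance Definition _ F :=
  GRing.isZmodClosed.Build (rees F) (@gr_ideal F) (@gr_ideal_zmod F).

Lemma gr_idealM F (p q : rees F) : p \in @gr_ideal F -> p * q \in @gr_ideal F.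
Proof.
move=> /asboolP Fp; apply/asboolP => i; apply: fil_sum => j _.
have := fil_M (Fp j) (reesF q (i - j)).
by rewrite addSn subnKC// -ltnS.
Qed.

Lemma gr_idealZ F a (p : rees F) : p \in @gr_ideal F -> a *: p \in @gr_ideal F.
Proof.
move=> /asboolP Fp; apply/asboolP => i.
change (fil F i.+1 (a *: p i)); apply: fil_Z; exact: Fp.
Qed.

(* gr(F) = \bigoplus_i F_i / F_(i+1). *)
Definition gr F := Quotient.quot (GRing.ZmodClosed.clone (rees F) (@gr_ideal F) _).

HB.instance Definition _ F := GRing.Zmodule.on (gr F).
HB.instance Definition _ F := ZmodQuotient.on (gr F).

Definition gr_pi F : rees F -> gr F := \pi_(gr F)%qT.

Lemma gr_piP F (p q : rees F) :
  gr_pi p = gr_pi q <-> p - q \in @gr_ideal F.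
Proof.
rewrite /gr_pi; split=> [pq|pq]; last by apply/eqP; rewrite piE.
by have /eqP := pq; rewrite piE.
Qed.

Lemma gr_reprK F (u : gr F) : gr_pi (repr u) = u.
Proof. exact: reprK. Qed.

Lemma gr_piD F (p q : rees F) : gr_pi (p + q) = gr_pi p + gr_pi q.
Proof. by rewrite /gr_pi raddfD. Qed.

Lemma gr_piB F (p q : rees F) : gr_pi (p - q) = gr_pi p - gr_pi q.
Proof. by rewrite /gr_pi raddfB. Qed.

Definition gr_mul F (u v : gr F) : gr F := gr_pi (repr u * repr v).
Definition gr_scale F (a : R) (u : gr F) : gr F := gr_pi (a *: repr u).
Definition gr_one F : gr F := gr_pi 1.

Lemma gr_mulE F (p q : rees F) : gr_mul (gr_pi p) (gr_pi q) = gr_pi (p * q).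
Proof.
apply/gr_piP; set p' := repr _; set q' := repr _.
have pp' : p' - p \in @gr_ideal F by apply/gr_piP; rewrite gr_reprK.
have qq' : q' - q \in @gr_ideal F by apply/gr_piP; rewrite gr_reprK.
rewrite (_ : _ - _ = (p' - p) * q' + (q' - q) * p).
  by rewrite rpredD// gr_idealM.
by rewrite !mulrBl addrA [q' * p]mulrC subrK [q * p]mulrC.
Qed.

Lemma gr_scaleE F a (p : rees F) : gr_scale a (gr_pi p) = gr_pi (a *: p).
Proof.
by apply/gr_piP; rewrite -scalerBr gr_idealZ//; apply/gr_piP; rewrite gr_reprK.
Qed.

Lemma gr_mulA F : associative (@gr_mul F).
Proof.
move=> u v w; rewrite -[u]gr_reprK -[v]gr_reprK -[w]gr_reprK.
by rewrite !gr_mulE mulrA.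
Qed.

Lemma gr_mulC F : commutative (@gr_mul F).
Proof. by move=> u v; rewrite /gr_mul mulrC. Qed.

Lemma gr_mul1 F : left_id (@gr_one F) (@gr_mul F).
Proof. by move=> u; rewrite -[u]gr_reprK gr_mulE mul1r. Qed.

Lemma gr_mulDl F : left_distributive (@gr_mul F) +%R.
Proof.
move=> u v w; rewrite -[u]gr_reprK -[v]gr_reprK -[w]gr_reprK.
by rewrite -gr_piD !gr_mulE mulrDl gr_piD.
Qed.

HB.instance Definition _ F := GRing.Zmodule_isComPzRing.Build (gr F)
  (@gr_mulA F) (@gr_mulC F) (@gr_mul1 F) (@gr_mulDl F).

Lemma gr_scaleA F a b (u : gr F) :
  gr_scale a (gr_scale b u) = gr_scale (a * b) u.
Proof. by rewrite -[u]gr_reprK !gr_scaleE scalerA. Qed.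

Lemma gr_scale1 F : left_id 1 (@gr_scale F).
Proof. by move=> u; rewrite -[u]gr_reprK gr_scaleE scale1r. Qed.

Lemma gr_scaleDr F : right_distributive (@gr_scale F) +%R.
Proof.
move=> a u v; rewrite -[u]gr_reprK -[v]gr_reprK.
by rewrite -gr_piD !gr_scaleE scalerDr gr_piD.
Qed.

Lemma gr_scaleDl F (u : gr F) : {morph (@gr_scale F)^~ u : a b / a + b}.
Proof. by move=> a b; rewrite -[u]gr_reprK !gr_scaleE scalerDl gr_piD. Qed.

HB.instance Definition _ F := GRing.Zmodule_isLmodule.Build R (gr F)
  (@gr_scaleA F) (@gr_scale1 F) (@gr_scaleDr F) (@gr_scaleDl F).

Lemma gr_scaleAl F (a : R) (u v : gr F) : a *: (u * v) = (a *: u) * v.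
Proof.
rewrite -[u]gr_reprK -[v]gr_reprK.
change (gr_scale a (gr_mul (gr_pi (repr u)) (gr_pi (repr v))) =
  gr_mul (gr_scale a (gr_pi (repr u))) (gr_pi (repr v))).
by rewrite gr_mulE !gr_scaleE gr_mulE rees_scaleAl.
Qed.

Lemma gr_piM F (p q : rees F) : gr_pi (p * q) = gr_pi p * gr_pi q.
Proof. by rewrite -gr_mulE. Qed.

Lemma gr_piZ F a (p : rees F) : gr_pi (a *: p) = a *: gr_pi p.
Proof. by rewrite -gr_scaleE. Qed.

(* f^[k], the class in degree k of f \in F_k (and 0 if f \notin F_k).         *)
Definition gr_class F (k : nat) (f : T -> R) : gr F :=
  gr_pi (insubd 0 (unit_seq k f)).

Lemma gr_class_eq F k f g : fil F k f -> fil F k g ->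
  gr_class F k f = gr_class F k g <-> fil F k.+1 (f - g).
Proof.
move=> Ff Fg; have [uf ug] := (unit_seqP Ff, unit_seqP Fg).
rewrite /gr_class gr_piP (_ : _ - _ = Rees uf - Rees ug); last first.
  by congr (_ - _); apply: val_inj; rewrite val_insubd ?uf ?ug.
split=> [/asboolP/(_ k)|Ffg].
  by rewrite -[X in fil F _ X]/(unit_seq k f k - unit_seq k g k) /unit_seq eqxx.
apply/asboolP => i.
change (fil F i.+1 (unit_seq k f i - unit_seq k g i)); rewrite /unit_seq.
by case: eqP => [->//|_]; rewrite subr0; exact: fil_0.
Qed.

Definition gr_deg {F} (k : nat) : set (gr F) := gr_class F k @` fil F k.

(* The morphism gr(F) -> gr(G), for F_i contained in G_i, induced by          *)
(* f |-> t^i f in degree i: for t = 1 it is induced by the inclusions, for    *)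
(* F = G it is multiplication by t^i in degree i.                             *)
Section GrMap.
Variables (F G : filtration R T) (FG : forall i, fil F i `<=` fil G i) (t : R).

Lemma rees_dil_subproof (p : rees F) : (fun i => t ^+ i *: p i) \in reesP G.
Proof.
case: p => p /= /asboolP[Fp [m pm]]; apply/asboolP; split=> [i|].
  by apply: fil_Z; apply: FG.
by exists m => i mi; rewrite pm// scaler0.
Qed.
Definition rees_dil (p : rees F) : rees G := Rees (rees_dil_subproof p).

Definition gr_dil (u : gr F) : gr G := gr_pi (rees_dil (repr u)).

Lemma gr_dilE (p : rees F) : gr_dil (gr_pi p) = gr_pi (rees_dil p).
Proof.
apply/gr_piP; apply/asboolP => i.
have : repr (gr_pi p) - p \in @gr_ideal F by apply/gr_piP; rewrite gr_reprK.
move=> /asboolP/(_ i)/FG/(fil_Z (t ^+ i)).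
by rewrite -[X in fil G _ X]/(t ^+ i *: (repr (gr_pi p) i - p i)) scalerBr.
Qed.

Lemma gr_dil_is_zmod_morphism : zmod_morphism gr_dil.
Proof.
move=> u v; rewrite -[u]gr_reprK -[v]gr_reprK -gr_piB !gr_dilE -gr_piB.
congr gr_pi; by apply: rees_ext => i; exact: scalerBr.
Qed.

Lemma gr_dil_is_monoid_morphism : monoid_morphism gr_dil.
Proof.
split=> [|u v].
  rewrite -[1]/(gr_pi 1) gr_dilE; congr gr_pi; apply: rees_ext => i /=.
  by rewrite /unit_seq; case: eqP => [->|_]; rewrite ?scaler0// expr0 scale1r.
rewrite -[u]gr_reprK -[v]gr_reprK -gr_piM !gr_dilE -gr_piM; congr gr_pi.
apply: rees_ext => i.
change (t ^+ i *: conv (repr u) (repr v) i =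
  conv (rees_dil (repr u)) (rees_dil (repr v)) i).
rewrite /conv scaler_sumr; apply: eq_bigr => j _ /=.
have -> : t ^+ i = t ^+ j * t ^+ (i - j) by rewrite -exprD subnKC// -ltnS.
by apply/funext => x; exact: mulrACA.
Qed.

HB.instance Definition _ :=
  GRing.isZmodMorphism.Build (gr F) (gr G) gr_dil gr_dil_is_zmod_morphism.
HB.instance Definition _ :=
  GRing.isMonoidMorphism.Build (gr F) (gr G) gr_dil gr_dil_is_monoid_morphism.

Lemma gr_dilZ a (u : gr F) : gr_dil (a *: u) = a *: gr_dil u.
Proof.
rewrite -[u]gr_reprK -gr_piZ !gr_dilE -gr_piZ; congr gr_pi.
by apply: rees_ext => i; rewrite /= scalerA mulrC -scalerA.
Qed.

End GrMap.

(* Hom_alg(gr(F), R).  Library algebras are required to be non-trivial, which *)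
(* gr(F) need not be, so linearity is added to the ring morphisms by hand.    *)
Record hom_alg F := HomAlg {
  hom_fun :> {rmorphism gr F -> R} ;
  hom_scale : forall a u, hom_fun (a *: u) = a * hom_fun u }.

Program Definition hom_comp F G (FG : forall i, fil F i `<=` fil G i) (t : R)
  (v : hom_alg G) : hom_alg F := @HomAlg F (v \o gr_dil FG t) _.
Next Obligation. by move=> F G FG t v a u; rewrite /= gr_dilZ hom_scale. Qed.

(* The action dual to multiplication by t^i in degree i. *)
Definition hom_act F (t : R) : hom_alg F -> hom_alg F :=
  hom_comp (fun i => @subset_refl _ (fil F i)) t.

(* The map dual to the morphism gr(F) -> gr(G) given by F_i `<=` G_i. *)
Definition hom_res F G (FG : forall i, fil F i `<=` fil G i) :
  hom_alg G -> hom_alg F := hom_comp FG 1.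

Definition gr_eval F (u : gr F) : hom_alg F -> R := fun v => v u.

Lemma gr_eval_is_zmod_morphism F : zmod_morphism (@gr_eval F).
Proof. by move=> u v; apply/funext => x; exact: rmorphB. Qed.
Lemma gr_eval_is_monoid_morphism F : monoid_morphism (@gr_eval F).
Proof.
split=> [|u v]; apply/funext => x; [exact: rmorph1|exact: rmorphM].
Qed.
Lemma gr_eval_is_scalable F : scalable (@gr_eval F).
Proof. by move=> a u; apply/funext => x; exact: hom_scale. Qed.
HB.instance Definition _ F := GRing.isZmodMorphism.Build (gr F)
  (hom_alg F -> R) (@gr_eval F) (@gr_eval_is_zmod_morphism F).
HB.instance Definition _ F := GRing.isMonoidMorphism.Build (gr F)
  (hom_alg F -> R) (@gr_eval F) (@gr_eval_is_monoid_morphism F).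
HB.instance Definition _ F := GRing.isScalable.Build R (gr F)
  (hom_alg F -> R) *:%R (@gr_eval F) (@gr_eval_is_scalable F).

End Gr.

(* -------------------------------------------------------------------------- *)
(** * Weightings *)

Section Weightings.
Context (R : realType) (M : Type) (n : nat) (S : smooth_structure R M n).

Definition weight_sequence (r : nat) (w : 'I_n -> nat) : Prop :=
  (forall a, (w a <= r)%N) /\
  (forall a b : 'I_n, (a <= b)%N -> (w a <= w b)%N).

(* The ideal of C^oo(dom c) generated by the monomials, in the coordinates c, *)
(* of weighted degree at least i.                                             *)
Definition local_model (c : pchart R M n) (w : 'I_n -> nat) (i : nat) :
    set (M -> R) :=
  [set f | exists m (s : 'I_m -> 'I_n -> nat) (g : 'I_m -> M -> R),
    [/\ forall j, (i <= \sum_(a < n) s j a * w a)%N,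
        forall j, smooth S (dom c) (g j) &
        forall x, dom c x ->
          f x = \sum_(j < m) g j x * \prod_(a < n) c x 0 a ^+ s j a]].

(* wt i U is C^oo(U)_(i), for U open; as for C^oo(U), its elements are total  *)
(* functions of which only the restriction to U matters (wt_congr).  wt_M     *)
(* follows from the other fields; it is included since a filtration of a      *)
(* (sheaf of) algebras is multiplicative, which gives gr its product.  In     *)
(* wt_model the weight sequence depends on the point x.                       *)
Record weighting (r : nat) := Weighting {
  wt :> nat -> set M -> set (M -> R) ;
  wt_congr : forall i U f g, mopen S U -> (forall x, U x -> f x = g x) ->
    wt i U f -> wt i U g ;
  wt_restr : forall i U V, mopen S U -> mopen S V -> V `<=` U ->
    wt i U `<=` wt i V ;
  wt_glue : forall i U f, mopen S U ->
    (forall x, U x -> exists V, [/\ mopen S V, V x, V `<=` U & wt i V f]) ->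
    wt i U f ;
  wt_smooth : forall U, mopen S U -> wt 0 U = smooth S U ;
  wt_S : forall i U, mopen S U -> wt i.+1 U `<=` wt i U ;
  wt_0 : forall i U, mopen S U -> wt i U 0 ;
  wt_D : forall i U f g, mopen S U -> wt i U f -> wt i U g -> wt i U (f + g) ;
  wt_ideal : forall i U h f, mopen S U -> smooth S U h -> wt i U f ->
    wt i U (h * f) ;
  wt_M : forall i j U f g, mopen S U -> wt i U f -> wt j U g ->
    wt (i + j) U (f * g) ;
  wt_model : forall x, exists c w, [/\ charts S c, dom c x,
    weight_sequence r w & forall i, wt i (dom c) = local_model c w i] }.

Context (r : nat) (W : weighting r).

Definition weighted_coordinates (c : pchart R M n) (w : 'I_n -> nat) : Prop :=
  [/\ charts S c, weight_sequence r w &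
      forall i, W i (dom c) = local_model c w i].

Lemma weighted_dom_open c w : weighted_coordinates c w -> mopen S (dom c).
Proof. by case=> Sc _ _; exact: mopen_dom. Qed.

Definition weighted_pair (N : set M) : Prop :=
  closed_submanifold S N /\
  forall U, mopen S U ->
    W 1 U = [set f | smooth S U f /\ forall x, U x -> N x -> f x = 0].

Lemma wt_Z i U (a : R) f : mopen S U -> W i U f -> W i U (a *: f).
Proof. by move=> oU; apply: (wt_ideal (h := cst a)) => //; exact: smooth_cst. Qed.

Lemma wt_1 U : mopen S U -> W 0 U 1.
Proof. by move=> oU; rewrite wt_smooth//; exact: smooth_cst. Qed.

Definition wt_filtration (U : set M) (oU : mopen S U) : filtration R M :=
  @Filtration R M (fun i => W i U) (fun i => wt_0 W i oU)
    (fun i f g => @wt_D _ W i U f g oU) (fun i a f => @wt_Z i U a f oU)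
    (wt_1 oU) (fun i j f g => @wt_M _ W i j U f g oU)
    (fun i => @wt_S _ W i U oU).

(* nu_W(U, U `&` N), for U open in M. *)
Definition nu_on (U : set M) (oU : mopen S U) : Type :=
  hom_alg (wt_filtration oU).

Definition nu_act (U : set M) (oU : mopen S U) : R -> nu_on oU -> nu_on oU :=
  @hom_act R M (wt_filtration oU).

Definition mopenT : mopen S setT := @openT (mtop S).

(* The weighted normal bundle nu_W(M, N). *)
Definition nu : Type := nu_on mopenT.
Definition kappa : R -> nu -> nu := @nu_act setT mopenT.
(* u lies over x: the restriction of u to the degree 0 part, which is         *)
(* C^oo(M) / C^oo(M)_(1) = C^oo(N), is the evaluation at x.                   *)
Definition nu_over (u : nu) (x : M) : Prop :=
  forall f, smooth S setT f -> u (gr_class _ 0 f) = f x.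

Definition nu_restr (N U : set M) : set nu :=
  [set u | exists x, [/\ U x, N x & nu_over u x]].

(* nu_W(U, U `&` N) -> nu_W(M, N), dual to the restriction of functions. *)
Definition nu_incl (U : set M) (oU : mopen S U) : nu_on oU -> nu :=
  @hom_res R M (wt_filtration mopenT) (wt_filtration oU)
    (fun i => @wt_restr _ W i setT U mopenT oU (@subsetT _ U)).

(* E is a graded bundle over N, for the given action and projection, with     *)
(* C_pol^oo(E) = gr(C^oo(M)) as graded algebras.  The identification is the   *)
(* evaluation gr_eval, which is an algebra morphism to the functions on nu.   *)
Definition is_weighted_normal_bundle (N : set M) (E : manifold R nu n) : Prop :=
  [/\ exists p : nu -> N, (forall u, nu_over u (val (p u))) /\
        graded_bundle_over E kappa S p,
      set_bij [set: gr (wt_filtration mopenT)] (Cpol E kappa) (@gr_eval R M _) &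
      forall k, (@gr_eval R M (wt_filtration mopenT)) @` gr_deg k =
        homog E kappa k].

End Weightings.

Arguments kappa {R M n S r} W t u.
Arguments nu_incl {R M n S r} W {U} oU v.

(* Main.v *)
(** A point of the weighted normal bundle over x in N is the same as a
multiplicative functional on germs at x, f |-> lim_{t -> 0} t^-i f(t . z) in
weighted coordinates, where t . z = (t^(w_a) z_a); that every algebra morphism
gr(C^oo(M)) -> R lies over a point of N is a form of Milnor's exercise.  Hence
the homogeneous approximations of weighted coordinates are charts, in which the
scalar multiplication is z |-> t . z.  A homogeneous function of degree k is
there a polynomial of weighted degree k with coefficients on N: differentiate
h(t . z) = t^k h(z) k times at t = 0.  Partitions of unity then identify the
homogeneous functions of degree k with gr_k, and gr_eval is injective since a
polynomial that vanishes everywhere has zero coefficients.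

For the uniqueness, let E' be another graded bundle structure with the same
homogeneous functions and let y be the weighted coordinates near a point m of
the zero section.  They are smooth on E'.  If xi is a tangent vector of E' at m
killed by dy, then xi kills all homogeneous functions, in particular the
t-derivatives at t = 0 of all coordinates of kappa_t; so t |-> d kappa_t(xi)
is flat at 0.  But d kappa_(2^-k)(xi) = B^k xi with B = d kappa_(1/2)
invertible, which decays at most geometrically: hence xi = 0.  By the inverse
function theorem y is a chart of E' near m, and the dilations kappa_t, t != 0,
carry such charts to neighborhoods of all points. *)

Require Import Defs.
From HB Require Import structures.
From mathcomp Require Import all_boot all_order all_algebra.
From mathcomp Require Import all_classical all_reals all_analysis.
From mathcomp Require Import perm zify ring lra.

Set Implicit Arguments.
Unset Strict Implicit.
Unset Printing Implicit Defensive.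

Import Order.TTheory GRing.Theory Num.Theory.
Import numFieldNormedType.Exports.
Local Open Scope classical_set_scope.
Local Open Scope ring_scope.

(** Equality of the homogeneous functions makes the identity from a second structure E' to E smooth,
    but a smooth bijection may fail to have a smooth inverse, as x^3 on the line. What helps is that
    the action is smooth on E' as well. The t-derivatives at 0 of the coordinates of kappa_t, in a
    chart of E', exist only over an open part of N; multiplied with a bump function pulled back from
    M, which is constant along orbits, they become global homogeneous functions on E'. By hypothesis
    these are homogeneous on E, hence smooth functions of y: this is why the kernel of dy kills
    them. The point m is taken on the zero section because the action fixes it, so that the
    differentials of all kappa_t act on one tangent space and multiply.

    In the construction of E the obstacle is that a point is a morphism on classes of global
    sections, while coordinates live on open sets. Bump functions have weight 0, so a point
    evaluates them at its base point; multiplying by one that is 1 there changes no value, and so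
    every point acts on germs. *)

Section RowVectors.
Context (R : realType) (n : nat).
Implicit Types (v x : 'rV[R]_n) (e : R).

Lemma row_coord_le v i : `|v 0 i| <= `|v|.
Proof.
rewrite [leRHS]/Num.Def.normr /= mx_normrE.
exact: (le_bigmax _ (fun ij : 'I_1 * 'I_n => `|v ij.1 ij.2|) (0, i)).
Qed.

Lemma row_norm_le v e : 0 <= e -> (forall i, `|v 0 i| <= e) -> `|v| <= e.
Proof.
move=> e0 ve; rewrite [leLHS]/Num.Def.normr /= mx_normrE.
by apply/bigmax_leP; split=> // -[j i] _ /=; rewrite ord1.
Qed.

Lemma row_norm_lt v e : 0 < e -> (forall i, `|v 0 i| < e) -> `|v| < e.
Proof.
move=> e0 ve; rewrite [ltLHS]/Num.Def.normr /= mx_normrE.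
by apply/bigmax_ltP; split=> // -[j i] _ /=; rewrite ord1.
Qed.

Lemma continuous_row (T : topologicalType) (F : T -> 'rV[R]_n) (x : T) :
  (forall i, {for x, continuous (fun y => F y 0 i)}) -> {for x, continuous F}.
Proof.
move=> Fx; apply/cvgrPdist_lt => /= e e0; near=> y.
apply: row_norm_lt => // i; rewrite !mxE.
move: i; near: y; apply: filter_forall => i; exact: (cvgrPdist_lt _ _).1 (Fx i) _ e0.
Unshelve. all: by end_near. Qed.

Lemma coord_row_continuous i : continuous (fun v : 'rV[R]_n => v 0 i).
Proof. exact: coord_continuous. Qed.

Lemma derivable_row (T : normedModType R) (F : T -> 'rV[R]_n) (x v : T) :
  derivable F x v <-> forall i, derivable (fun y => F y 0 i) x v.
Proof.
rewrite derivable_mxP; split=> [H i|H j i]; first exact: H.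
by rewrite ord1.
Qed.

Lemma derive_row (T : normedModType R) (F : T -> 'rV[R]_n) (x v : T) i :
  derivable F x v -> ('D_v F x) 0 i = 'D_v (fun y => F y 0 i) x.
Proof. by move=> /derive_mx ->; rewrite mxE. Qed.

Lemma is_derive_line (V : normedModType R) (g : V -> R) (p e : V) (t D : R) :
  is_derive (p + t *: e) e g D -> is_derive t (1 : R) (fun s : R => g (p + s *: e)) D.
Proof.
move=> [gd gD].
have E : (fun h => h^-1 *: (g (p + (h *: (1:R) + t) *: e) - g (p + t *: e))) =
   (fun h => h^-1 *: (g (h *: e + (p + t *: e)) - g (p + t *: e))).
  apply/funext => h; congr (_ *: (g _ - _)).
  by rewrite scalerDl [_ *: 1]mulr1 addrCA.
split; first by move: gd; rewrite /derivable E.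
by rewrite -gD /derive E.
Qed.

(** The sign of [d] is free, so increments along coordinate axes need no case distinction; the bound
    [|s| <= |d|] is the form in which neighborhoods are checked. *)
Lemma MVT_line (V : normedModType R) (g : V -> R) (p e : V) (d : R) :
  (forall s : R, `|s| <= `|d| -> derivable g (p + s *: e) e) ->
  exists2 s, `|s| <= `|d| & g (p + d *: e) - g p = d * 'D_e g (p + s *: e).
Proof.
move=> gd; pose f s := g (p + s *: e); pose df s := 'D_e g (p + s *: e).
have fd (s : R) : `|s| <= `|d| -> is_derive s (1 : R) f (df s).
  by move=> sd; apply: is_derive_line; apply: derivableP; exact: gd.
have -> : g p = f 0 by rewrite /f scale0r addr0.
rewrite -/(f d).
have [d0|d0] := leP 0 d.
- have [||s] := @MVT_segment R f df 0 d d0.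
  + move=> s; rewrite in_itv/= => /andP[s0 sd].
    by apply: fd; rewrite !ger0_norm// ltW.
  + apply: derivable_within_continuous => s.
    by rewrite in_itv/= => /andP[s0 sd]; apply: (@ex_derive _ _ _ _ _ _ _ (fd _ _)); rewrite !ger0_norm.
  + rewrite in_itv/= subr0 => /andP[s0 sd] E; exists s.
      by rewrite !ger0_norm.
    by rewrite E mulrC.
- have [||s] := @MVT_segment R f df d 0 (ltW d0).
  + move=> s; rewrite in_itv/= => /andP[s0 sd].
    by apply: fd; rewrite !ler0_norm ?lerN2 // ltW.
  + apply: derivable_within_continuous => s.
    by rewrite in_itv/= => /andP[s0 sd]; apply: (@ex_derive _ _ _ _ _ _ _ (fd _ _)); rewrite !ler0_norm ?lerN2// ltW.
  + rewrite in_itv/= sub0r => /andP[s0 sd] E; exists s.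
      by rewrite !ler0_norm ?lerN2// ltW.
    by rewrite -opprB E mulrN opprK mulrC.
Qed.

End RowVectors.

(** * C^k functions: closure properties and the chain rule *)

Section Ck_basics.
Context (R : realType) (n : nat).
Implicit Types (V U : set 'rV[R]_n) (f g : 'rV[R]_n -> R).
Local Notation D i g := ('D_(delta_mx 0 i) g).

Lemma Ck_continuous k V g v : Ck k V g -> V v -> {for v, continuous g}.
Proof. by case: k => [|k] [H _]; exact: H. Qed.

Lemma Ck_pred k V g : Ck k.+1 V g -> Ck k V g.
Proof.
elim: k g => [|k IHk] g [gc gd]; split=> // i.
by split; [exact: (gd i).1|apply: IHk; exact: (gd i).2].
Qed.

Lemma Ck_local k V g :
  (forall v, V v -> exists2 U, U v & Ck k U g) -> Ck k V g.
Proof.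
elim: k g => [|k IHk] g H.
  by split=> // v /H[U Uv [+ _]]; exact.
split=> [v /H[U Uv [+ _]]|i]; first exact.
split=> [v /H[U Uv [_ /(_ i)[+ _]]]|]; first exact.
by apply: IHk => v /H[U Uv [_ /(_ i)[_]]]; exists U.
Qed.

Lemma Ck_sub k V U g : U `<=` V -> Ck k V g -> Ck k U g.
Proof. by move=> UV gV; apply: Ck_local => v /UV Vv; exists V. Qed.

Lemma eq_on_near V f g v : open V -> V v -> (forall u, V u -> f u = g u) ->
  \near v, f v = g v.
Proof. by move=> oV Vv fg; near=> u; apply: fg; near: u; exact: open_nbhs_nbhs. 
Unshelve. all: by end_near. Qed.

Lemma eq_on_derivable V f g v e : open V -> V v ->
  (forall u, V u -> f u = g u) -> derivable f v e -> derivable g v e.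
Proof. by move=> oV Vv fg; apply: near_eq_derivable; exact: (@eq_on_near V). Qed.

Lemma eq_on_derive V f g v e : open V -> V v ->
  (forall u, V u -> f u = g u) -> 'D_e f v = 'D_e g v.
Proof. by move=> oV Vv fg; apply: near_eq_derive; exact: (@eq_on_near V). Qed.

Lemma eq_on_continuous V f g v : open V -> V v ->
  (forall u, V u -> f u = g u) -> {for v, continuous f} -> {for v, continuous g}.
Proof.
move=> oV Vv fg; rewrite /prop_for /continuous_at (fg _ Vv).
by apply: cvg_trans; apply: (near_eq_cvg (F := nbhs v)); exact: (eq_on_near oV Vv fg).
Qed.

Lemma Ck_ext k V f g : open V -> (forall v, V v -> f v = g v) ->
  Ck k V f -> Ck k V g.
Proof.
move=> oV; elim: k f g => [|k IHk] f g fg [fc fd].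
  by split=> // v Vv; apply: (eq_on_continuous oV Vv fg); exact: fc.
split=> [v Vv|i]; first by apply: (eq_on_continuous oV Vv fg); exact: fc.
split=> [v Vv|]; first by apply: (eq_on_derivable oV Vv fg); exact: (fd i).1.
apply: IHk (fd i).2 => v Vv; exact: (eq_on_derive _ oV Vv fg).
Qed.

Lemma Ck_cst k V (a : R) : Ck k V (cst a).
Proof. exact: Csmooth_cst. Qed.

Lemma Ck_coord k V i : Ck k V (fun v => v 0 i).
Proof.
have dc (v e : 'rV[R]_n) : is_derive v e (fun v : 'rV[R]_n => v 0 i) (e 0 i).
  have E : \forall h \near 0^',
      h^-1 *: ((h *: e + v) 0 i - v 0 i) = e 0 i.
    near=> h; have h0 : h != 0 by near: h; exact: nbhs_dnbhs_neq.
    by rewrite !mxE addrK [_ *: _]mulrA mulVf ?mul1r.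
  split.
    by apply/cvg_ex; exists (e 0 i); apply: cvg_near_cst; exact: E.
  by apply/cvg_lim => //; apply: cvg_near_cst; exact: E.
case: k => [|k]; split=> //; try (by move=> v _; exact: coord_row_continuous).
move=> j; split=> [v _|]; first exact: ex_derive.
rewrite (_ : D j _ = cst ((delta_mx 0 j : 'rV[R]_n) 0 i)); first exact: Ck_cst.
by apply/funext => v; rewrite derive_val.
Unshelve. all: by end_near. Qed.

Lemma CkD k V f g : open V -> Ck k V f -> Ck k V g -> Ck k V (f + g).
Proof.
move=> oV; elim: k f g => [|k IHk] f g [fc fd] [gc gd].
  by split=> // v Vv; exact: (cvgD (fc _ Vv) (gc _ Vv)).
split=> [v Vv|i]; first exact: (cvgD (fc _ Vv) (gc _ Vv)).
split=> [v Vv|].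
  by apply: derivableD; [exact: (fd i).1|exact: (gd i).1].
apply: (@Ck_ext _ _ (D i f + D i g)) => // [v Vv|].
  by rewrite deriveD//; [exact: (fd i).1|exact: (gd i).1].
by apply: IHk; [exact: (fd i).2|exact: (gd i).2].
Qed.

Lemma CkM k V f g : open V -> Ck k V f -> Ck k V g -> Ck k V (f * g).
Proof.
move=> oV; elim: k f g => [|k IHk] f g fk gk; have [fc fd] := fk; have [gc gd] := gk.
  by split=> // v Vv; exact: (cvgM (fc _ Vv) (gc _ Vv)).
split=> [v Vv|i]; first exact: (cvgM (fc _ Vv) (gc _ Vv)).
split=> [v Vv|].
  by apply: derivableM; [exact: (fd i).1|exact: (gd i).1].
apply: (@Ck_ext _ _ (f * D i g + g * D i f)) => // [v Vv|].
  by rewrite deriveM//; [exact: (fd i).1|exact: (gd i).1].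
apply: CkD => //; apply: IHk.
- exact: Ck_pred.
- exact: (gd i).2.
- exact: Ck_pred.
- exact: (fd i).2.
Qed.

Lemma Ck_sum k V (I : Type) (r : seq I) (P : pred I) (F : I -> 'rV[R]_n -> R) :
  open V -> (forall i, P i -> Ck k V (F i)) -> Ck k V (\sum_(i <- r | P i) F i).
Proof.
move=> oV FP; elim/big_ind: _ => //; first exact: Ck_cst.
by move=> *; exact: CkD.
Qed.

Lemma Ck_prod k V (I : Type) (r : seq I) (P : pred I) (F : I -> 'rV[R]_n -> R) :
  open V -> (forall i, P i -> Ck k V (F i)) -> Ck k V (\prod_(i <- r | P i) F i).
Proof.
move=> oV FP; elim/big_ind: _ => //; first exact: Ck_cst.
by move=> *; exact: CkM.
Qed.

End Ck_basics.

Lemma row_ball (R : realType) (n : nat) (x v : 'rV[R]_n) (e : R) :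
  ball x e v <-> `|x - v| < e.
Proof. by rewrite -ball_normE. Qed.

(* Telescoping over the coordinates and the mean value theorem. *)
Lemma C1_strict (R : realType) (n : nat) (V : set 'rV[R]_n) g x (e : R) :
  open V -> V x -> Ck 1 V g -> 0 < e -> exists2 d : R, 0 < d &
    forall h k, `|x - h| < d -> `|x - k| < d ->
    `|g h - g k - \sum_(a < n) 'D_(delta_mx 0 a) g x * (h 0 a - k 0 a)|
      <= e * `|h - k|.
Proof.
move=> oV Vx [_ gd] e0.
pose e' : R := e / n.+1%:R.
have e'0 : 0 < e' by rewrite divr_gt0.
have : \forall y \near x, V y /\
    forall a, `|'D_(delta_mx 0 a) g x - 'D_(delta_mx 0 a) g y| < e'.
  near=> y; split; first by near: y; exact: open_nbhs_nbhs.
  move=> a; move: a; near: y; apply: filter_forall => a.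
  have /(_ _ Vx) := (gd a).2.1.
  by move=> /cvgrPdist_lt/(_ _ e'0).
(* Each coordinate of [p j] is within [d / 3] of that of [x], and the segment to [p j.+1] has length
   below [2 d / 3]; so all intermediate points stay in the ball of radius [d]. *)
move=> /nbhs_ballP[d /= d0 dV]; exists (d / 3); first by rewrite divr_gt0.
move=> h k hd kd.
pose p j : 'rV[R]_n := \row_a (if (a < j)%N then h 0 a else k 0 a).
have pS (j : 'I_n) : p j.+1 = p j + (h 0 j - k 0 j) *: delta_mx 0 j.
  apply/rowP => a; rewrite !mxE eqxx ltnS leq_eqVlt.
  have [->|ne] := eqVneq a j; first by rewrite eqxx ltnn mulr1 addrC subrK.
  by rewrite val_eqE (negbTE ne) /= mulr0 addr0.
have p0 : p 0%N = k by apply/rowP => a; rewrite !mxE ltn0.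
have pn : p n = h by apply/rowP => a; rewrite !mxE ltn_ord.
have pd (j : 'I_n) (s : R) : `|s| <= `|h 0 j - k 0 j| ->
    ball x d (p j + s *: delta_mx 0 j).
  move=> sd; apply/row_ball; apply: row_norm_lt => // a.
  have xh (b : 'I_n) : `|x 0 b - h 0 b| < d / 3.
    by have := row_coord_le (x - h) b; rewrite !mxE; lra.
  have xk (b : 'I_n) : `|x 0 b - k 0 b| < d / 3.
    by have := row_coord_le (x - k) b; rewrite !mxE; lra.
  have pa : `|x 0 a - p j 0 a| < d / 3 by rewrite mxE; case: ifP.
  have sd' : `|s| < d / 3 * 2.
    have := ler_normB (x 0 j - k 0 j) (x 0 j - h 0 j).
    have -> : x 0 j - k 0 j - (x 0 j - h 0 j) = h 0 j - k 0 j by ring.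
    by move: sd (xh j) (xk j); lra.
  have : `|x 0 a - (p j + s *: delta_mx 0 j) 0 a| <=
      `|x 0 a - p j 0 a| + `|s|.
    rewrite [in X in X <= _]mxE opprD addrA; apply: le_trans (ler_normB _ _) _.
    rewrite lerD2l !mxE normrM ler_piMr// normr_nat lern1.
    by case: (_ && _).
  by rewrite !mxE; move: pa; rewrite mxE; lra.
have pe (j : 'I_n) : `|g (p j.+1) - g (p j) -
    'D_(delta_mx 0 j) g x * (h 0 j - k 0 j)| <= e' * `|h - k|.
  have [s /pd/dV[Vs]|s] := @MVT_line R _ g (p j) (delta_mx 0 j) (h 0 j - k 0 j).
    by move=> _; exact: (gd j).1.
  rewrite -pS => /pd/dV[_ sD] ->; rewrite mulrC -mulrBl normrM.
  have hkj : `|h 0 j - k 0 j| <= `|h - k|.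
    by have := row_coord_le (h - k) j; rewrite !mxE.
  by apply: ler_pM => //; rewrite distrC; exact/ltW/sD.
rewrite -pn -p0 -(telescope_sumr (fun j => g (p j)) (leq0n n)) pn p0.
rewrite big_mkord -sumrB; apply: le_trans (ler_norm_sum _ _ _) _.
apply: le_trans (ler_sum _ (fun j _ => pe j)) _.
rewrite sumr_const card_ord -[leLHS]mulr_natr mulrAC ler_wpM2r//.
by rewrite /e' -mulrA (ler_piMr (ltW e0))// mulrC ler_pdivrMr// mul1r ler_nat.
Unshelve. all: by end_near. Qed.

(** By strict differentiability of [g] at [F x], the difference quotient [A] of [g \o F] differs
    from its linearization [B] by at most a small multiple of the quotient of [F], and that quotient
    is eventually below [|D_v F x| + 1]. *)
Lemma C1_chain (R : realType) (m : nat) (T : normedModType R)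
    (V : set 'rV[R]_m) (g : 'rV[R]_m -> R) (F : T -> 'rV[R]_m) (x v : T) :
  open V -> V (F x) -> Ck 1 V g -> derivable F x v ->
  is_derive x v (g \o F)
    (\sum_(a < m) 'D_(delta_mx 0 a) g (F x) * 'D_v (fun y => F y 0 a) x).
Proof.
move=> oV VF gV dF; pose S : R := \sum_(a < m) 'D_(delta_mx 0 a) g (F x) * 'D_v (fun y => F y 0 a) x.
rewrite -/S.
pose B (h : R) : R := \sum_(a < m) 'D_(delta_mx 0 a) g (F x) *
    (h^-1 *: (F (h *: v + x) 0 a - F x 0 a)).
pose A (h : R) : R := h^-1 *: (g (F (h *: v + x)) - g (F x)).
have Fh : (fun h : R => F (h *: v + x)) @ 0^' --> F x.
  have /derivable1P/derivable1_diffP/differentiable_continuous := dF.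
  by rewrite /prop_for /continuous_at /= scale0r add0r => H; apply: cvg_within_filter.
have /derivable_row dFa := dF.
have Sh : B @ 0^' --> S.
  by apply: cvg_big => [|a _]; [exact: add_continuous|exact: cvgMl_tmp (dFa a)].
have Eh : (A \- B) @ 0^' --> (0 : R).
  apply/cvgrPdist_le => /= e e0.
  pose l := 'D_v F x.
  have l0 : 0 < `|l| + 1 by rewrite ltr_wpDl.
  have [d d0 gd] := C1_strict oV VF gV (divr_gt0 e0 l0).
  near=> h.
  have hn0 : h != 0 by near: h; exact: nbhs_dnbhs_neq.
  have Fd : `|F x - F (h *: v + x)| < d.
    by near: h; move/cvgrPdist_lt : Fh; exact.
  have := gd _ (F x) Fd; rewrite subrr normr0 => /(_ d0) H.
  have {}H := ler_wpM2l (normr_ge0 h^-1) H.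
  have Fl : `|h^-1 *: (F (h *: v + x) - F x)| <= `|l| + 1.
    have : `|l - h^-1 *: (F (h *: v + x) - F x)| < 1.
      by near: h; move/cvgrPdist_lt : dF; apply.
    have := ler_normB l (l - h^-1 *: (F (h *: v + x) - F x)).
    by rewrite opprB addrC subrK; lra.
  rewrite sub0r normrN /A /B.
  have sE (a b : R) : a *: b = a * b by [].
  under eq_bigr do rewrite sE mulrCA.
  rewrite -mulr_sumr sE -mulrBr normrM; apply: le_trans H _.
  rewrite mulrCA -normrZ; apply: le_trans (ler_wpM2l _ Fl) _.
    by rewrite ltW// divr_gt0.
  by rewrite divfK// gt_eqF.
have H : A @ 0^' --> S.
  have : ((A \- B) \+ B) @ 0^' --> (0 + S : R) by exact: cvgD.
  by rewrite add0r (_ : _ \+ _ = A)//; apply/funext => h /=; exact: subrK.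
split; first by apply/cvg_ex; exists S.
exact/cvg_lim.
Unshelve. all: by end_near. Qed.

(** * Smooth functions on open subsets of R^n *)

Lemma derive_comp_row (R : realType) (m : nat) (T : normedModType R)
    (U : set 'rV[R]_m) (g : 'rV[R]_m -> R) (F : T -> 'rV[R]_m) (x v : T) :
  open U -> U (F x) -> Ck 1 U g ->
  (forall a, derivable (fun y => F y 0 a) x v) ->
  derivable (g \o F) x v /\ 'D_v (g \o F) x =
    \sum_(a < m) 'D_(delta_mx 0 a) g (F x) * 'D_v (fun y => F y 0 a) x.
Proof.
move=> oU UF gU /derivable_row dF; have gF := C1_chain oU UF gU dF.
by split; [exact: ex_derive|rewrite derive_val].
Qed.

Lemma Ck_comp (R : realType) (n m k : nat) (V : set 'rV[R]_n)
    (U : set 'rV[R]_m) (F : 'rV[R]_n -> 'rV[R]_m) (g : 'rV[R]_m -> R) :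
  open V -> open U -> (forall v, V v -> U (F v)) ->
  (forall a, Ck k V (fun v => F v 0 a)) -> Csmooth U g -> Ck k V (g \o F).
Proof.
move=> oV oU VU; elim: k g => [|k IHk] g FV gU.
  split=> // v Vv; apply: continuous_comp; last first.
    exact: (Ck_continuous (gU 0%N)) (VU _ Vv).
  by apply: continuous_row => i; exact: (Ck_continuous (FV i)).
have dgF v i (Vv : V v) := derive_comp_row oU (VU _ Vv) (gU 1%N)
  (fun a => ((FV a).2 i).1 v Vv).
split.
  move=> v Vv; apply: continuous_comp; last first.
    exact: (Ck_continuous (gU 0%N)) (VU _ Vv).
  by apply: continuous_row => i; exact: (Ck_continuous (FV i)).
move=> i; split=> [v Vv|]; first exact: (dgF v i Vv).1.
apply: (@Ck_ext _ _ _ _ (\sum_(a < m) (('D_(delta_mx 0 a) g) \o F) *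
    ('D_(delta_mx 0 i) (fun y => F y 0 a)))) => // [v Vv|].
  by rewrite (dgF v i Vv).2 fct_sumE.
apply: Ck_sum => // a _; apply: CkM => //; last exact: ((FV a).2 i).2.
apply: IHk => [b|l]; first exact: Ck_pred.
by have := gU l.+1 => -[_ /(_ a)[]].
Qed.

Section Csmooth_closure.
Context (R : realType) (n : nat).
Implicit Types (V U : set 'rV[R]_n) (f g : 'rV[R]_n -> R).

Lemma Csmooth_sub V U g : U `<=` V -> Csmooth V g -> Csmooth U g.
Proof. by move=> UV gV k; exact: Ck_sub UV (gV k). Qed.

Lemma Csmooth_local V g :
  (forall v, V v -> exists2 U, U v & Csmooth U g) -> Csmooth V g.
Proof.
by move=> H k; apply: Ck_local => v /H[U Uv gU]; exists U => //; exact: gU.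
Qed.

Lemma Csmooth_ext V f g : open V -> (forall v, V v -> f v = g v) ->
  Csmooth V f -> Csmooth V g.
Proof. by move=> oV fg fV k; exact: Ck_ext oV fg (fV k). Qed.

Lemma Csmooth_coord V i : Csmooth V (fun v => v 0 i).
Proof. by move=> k; exact: Ck_coord. Qed.

Lemma CsmoothD V f g : open V -> Csmooth V f -> Csmooth V g -> Csmooth V (f + g).
Proof. by move=> oV fV gV k; apply: CkD. Qed.

Lemma CsmoothM V f g : open V -> Csmooth V f -> Csmooth V g -> Csmooth V (f * g).
Proof. by move=> oV fV gV k; apply: CkM. Qed.

Lemma Csmooth_sum V (I : Type) (r : seq I) (P : pred I) (F : I -> 'rV[R]_n -> R) :
  open V -> (forall i, P i -> Csmooth V (F i)) ->
  Csmooth V (\sum_(i <- r | P i) F i).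
Proof. by move=> oV FP k; apply: Ck_sum => // i /FP. Qed.

Lemma Csmooth_prod V (I : Type) (r : seq I) (P : pred I) (F : I -> 'rV[R]_n -> R) :
  open V -> (forall i, P i -> Csmooth V (F i)) ->
  Csmooth V (\prod_(i <- r | P i) F i).
Proof. by move=> oV FP k; apply: Ck_prod => // i /FP. Qed.

Lemma CsmoothX V f m : open V -> Csmooth V f -> Csmooth V (f ^+ m).
Proof.
move=> oV fV; elim: m => [|m IHm]; first exact: Csmooth_cst.
by rewrite exprS; exact: CsmoothM.
Qed.

Lemma Csmooth_derive V f i : Csmooth V f -> Csmooth V ('D_(delta_mx 0 i) f).
Proof. by move=> fV k; exact: ((fV k.+1).2 i).2. Qed.

Lemma Csmooth_derivable V f i v : Csmooth V f -> V v ->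
  derivable f v (delta_mx 0 i).
Proof. by move=> fV Vv; exact: ((fV 1%N).2 i).1. Qed.

Lemma Csmooth_continuous V f v : Csmooth V f -> V v -> {for v, continuous f}.
Proof. by move=> fV; exact: Ck_continuous (fV 0%N). Qed.

Lemma CkV k V f : open V -> (forall v, V v -> f v != 0) -> Ck k V f ->
  Ck k V (fun v => (f v)^-1).
Proof.
move=> oV f0; elim: k => [|k IHk] fk; have [fc fd] := fk.
  by split=> // v Vv; exact: (cvgV (f0 _ Vv) (fc _ Vv)).
split=> [v Vv|i]; first exact: (cvgV (f0 _ Vv) (fc _ Vv)).
split=> [v Vv|].
  by apply: derivableV; [exact: f0|exact: (fd i).1].
apply: (@Ck_ext _ _ _ _ (cst (-1) * ((fun v => (f v)^-1) * (fun v => (f v)^-1)) *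
   'D_(delta_mx 0 i) f)) => // [v Vv|].
  rewrite deriveV; [|exact: f0|exact: (fd i).1].
  by rewrite /= !fctE mulN1r mulNr scaleNr -exprVn.
have fV := IHk (Ck_pred fk).
by apply: CkM => //; [apply: CkM => //; [exact: Ck_cst|exact: CkM]|exact: (fd i).2].
Qed.

Lemma CsmoothV V f : open V -> (forall v, V v -> f v != 0) -> Csmooth V f ->
  Csmooth V (fun v => (f v)^-1).
Proof. by move=> oV f0 fV k; exact: CkV. Qed.

End Csmooth_closure.

Lemma Csmooth_comp (R : realType) (n m : nat) (V : set 'rV[R]_n)
    (U : set 'rV[R]_m) (F : 'rV[R]_n -> 'rV[R]_m) (g : 'rV[R]_m -> R) :
  open V -> open U -> (forall v, V v -> U (F v)) ->
  (forall a, Csmooth V (fun v => F v 0 a)) -> Csmooth U g -> Csmooth V (g \o F).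
Proof. by move=> oV oU VU FV gU k; apply: Ck_comp gU => // a; exact: FV. Qed.

Lemma Csmooth_row_continuous (R : realType) (n m : nat) (V : set 'rV[R]_n)
    (F : 'rV[R]_n -> 'rV[R]_m) v :
  (forall a, Csmooth V (fun v => F v 0 a)) -> V v -> {for v, continuous F}.
Proof.
by move=> FV Vv; apply: continuous_row => i; exact: Csmooth_continuous (FV i) Vv.
Qed.

Lemma open_preimage_on (S T : topologicalType) (V : set S) (U : set T) (f : S -> T) :
  open V -> open U -> (forall v, V v -> {for v, continuous f}) ->
  open (V `&` f @^-1` U).
Proof.
move=> oV oU fc; rewrite openE => v [Vv Uv]; rewrite /interior; near=> w.
split; near: w; first exact: open_nbhs_nbhs.
by apply: (fc v Vv); exact: open_nbhs_nbhs.
Unshelve. all: by end_near. Qed.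

Lemma dist_half_split (R : realType) (e x y z : R) :
  `|x - z| < e / 2 -> `|y - z| < e / 2 -> `|x - y| <= e.
Proof.
move=> xz yz; have -> : x - y = (x - z) - (y - z) by ring.
by apply: le_trans (ler_normB _ _) _; lra.
Qed.

(** * Symmetry of second derivatives *)

Section Schwarz.
Context (R : realType) (n : nat).
Implicit Types (V : set 'rV[R]_n) (g : 'rV[R]_n -> R).

Lemma is_derive_translate (g : 'rV[R]_n -> R) c p (e : 'rV[R]_n) :
  derivable g (p + c) e ->
  is_derive p e (fun y => g (y + c)) ('D_e g (p + c)).
Proof.
move=> gd.
have E : (fun h : R => h^-1 *: (g (h *: e + (p + c)) - g (p + c))) =
    (fun h : R => h^-1 *: (g (h *: e + p + c) - g (p + c))).
  by apply/funext => h; rewrite addrA.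
by split; [move: gd; rewrite /derivable E|rewrite /derive E].
Qed.

(** The mean value theorem twice: along the j-th axis for the increment [phi] of [g] in direction i,
    then along the i-th axis for the j-th derivative. *)
Lemma second_difference V g v (i j : 'I_n) (t : R) : Ck 2 V g ->
  (forall s s' : R, `|s| <= `|t| -> `|s'| <= `|t| ->
    V (v + s *: delta_mx 0 j + s' *: delta_mx 0 i)) ->
  exists s s' : R, [/\ `|s| <= `|t|, `|s'| <= `|t| &
    g (v + t *: delta_mx 0 j + t *: delta_mx 0 i) - g (v + t *: delta_mx 0 j)
      - (g (v + t *: delta_mx 0 i) - g v) =
    t * (t * 'D_(delta_mx 0 i) ('D_(delta_mx 0 j) g)
      (v + s *: delta_mx 0 j + s' *: delta_mx 0 i))].
Proof.
move=> gV HV.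
pose phi y := g (y + t *: delta_mx 0 i) - g y.
have gd w : V w -> derivable g w (delta_mx 0 j) by exact: (gV.2 j).1.
have V0 s : `|s| <= `|t| -> V (v + s *: delta_mx 0 j).
  move=> st; have := HV s 0 st; rewrite scale0r addr0; apply.
  by rewrite normr0.
have dphi s : `|s| <= `|t| -> is_derive (v + s *: delta_mx 0 j) (delta_mx 0 j : 'rV[R]_n)
    phi ('D_(delta_mx 0 j) g (v + s *: delta_mx 0 j + t *: delta_mx 0 i) -
      'D_(delta_mx 0 j) g (v + s *: delta_mx 0 j)).
  move=> st; apply: is_deriveB.
    by apply: is_derive_translate; apply: gd; exact: HV.
  by apply: derivableP; apply: gd; exact: V0.
have [|s st E] := @MVT_line R _ phi v (delta_mx 0 j) t.
  by move=> s /dphi H; exact: ex_derive.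
have [|s' st'] := @MVT_line R _ ('D_(delta_mx 0 j) g) (v + s *: delta_mx 0 j)
    (delta_mx 0 i) t.
  by move=> s' st'; have := (gV.2 j).2 => -[_ /(_ i)[+ _]]; apply; exact: HV.
have /@derive_val Es := dphi s st.
move=> E'; exists s, s'; split=> //; rewrite -E' -Es.
by rewrite -E /phi.
Qed.

(** The second difference is symmetric in i and j, so the two mixed derivatives take a common value,
    at two points near [v]; continuity carries this to [v]. *)
Lemma derive_swap V g v (i j : 'I_n) : open V -> V v -> Ck 2 V g ->
  'D_(delta_mx 0 i) ('D_(delta_mx 0 j) g) v =
  'D_(delta_mx 0 j) ('D_(delta_mx 0 i) g) v.
Proof.
move=> oV Vv gV; apply/eqP; rewrite -subr_eq0 -normr_le0; apply/ler_addgt0Pr => e e0.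
have gc k l : {for v, continuous ('D_(delta_mx 0 k) ('D_(delta_mx 0 l) g))}.
  by apply: ((gV.2 l).2.2 k).2.1.
pose D k l := 'D_(delta_mx 0 k) ('D_(delta_mx 0 l) g).
have e2 : 0 < e / 2 by rewrite divr_gt0.
have near_D k l : \forall w \near v, `|D k l v - D k l w| < e / 2.
  exact: (cvgrPdist_lt _ _).1 (gc k l) _ e2.
have : nbhs v (V `&` [set w | `|D i j v - D i j w| < e / 2] `&`
    [set w | `|D j i v - D j i w| < e / 2]).
  apply: filterI (near_D j i); apply: filterI (near_D i j).
  exact: open_nbhs_nbhs.
move=> /nbhs_ballP[d /= d0 dV].
pose t : R := d / 3; have t0 : 0 < t by rewrite divr_gt0.
have bd (k l : 'I_n) (s s' : R) : `|s| <= `|t| -> `|s'| <= `|t| ->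
    ball v d (v + s *: delta_mx 0 l + s' *: delta_mx 0 k).
  rewrite (gtr0_norm t0) => st st'; apply/row_ball; rewrite -addrA opprD addNKr.
  rewrite normrN; apply: row_norm_lt => // a; rewrite !mxE.
  have H (z : R) (b : bool) : `|z| <= t -> `|z * b%:R| <= t.
    by move=> zt; case: b; rewrite ?mulr1// mulr0 normr0 ltW.
  apply: le_lt_trans (ler_normD _ _) _.
  apply: le_lt_trans (lerD (H _ _ st) (H _ _ st')) _. by rewrite /t; lra.
have [|s [s' [st st' E1]]] := @second_difference V g v i j t gV.
  by move=> s s' st st'; have [[]] := dV _ (bd i j s s' st st').
have [|r [r' [rt rt' E2]]] := @second_difference V g v j i t gV.
  by move=> r r' rt rt'; have [[]] := dV _ (bd j i r r' rt rt').
have tn0 : t != 0 by rewrite gt_eqF.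
have H : g (v + t *: delta_mx 0 j + t *: delta_mx 0 i) - g (v + t *: delta_mx 0 j)
      - (g (v + t *: delta_mx 0 i) - g v) =
    g (v + t *: delta_mx 0 i + t *: delta_mx 0 j) - g (v + t *: delta_mx 0 i)
      - (g (v + t *: delta_mx 0 j) - g v).
  by rewrite (addrAC v); ring.
have /(mulfI tn0)/(mulfI tn0) E := etrans (esym E1) (etrans H E2).
have [[_ H1] _] := dV _ (bd i j s s' st st').
have [_ H2] := dV _ (bd j i r r' rt rt').
move: H1 => /=; rewrite /D E => H1; rewrite add0r; exact: dist_half_split H1 H2.
Qed.

End Schwarz.

(* Every function t |-> p(1/t) exp(-1/t) (extended by 0 for t <= 0) has a       *)
(* derivative of the same form.                                                *)
Section FlatFunction.
Context (R : realType).
Implicit Types (p q : {poly R}) (t : R).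

Definition flat p t : R := if 0 < t then p.[t^-1] * expR (- t^-1) else 0.

Lemma polyM_expRN_bounded p : exists2 C : R, 0 <= C &
  forall s, 0 <= s -> `|p.[s]| * expR (- s) <= C.
Proof.
(* For [s > 1] the exponential series gives s^i <= s^(i+1) <= (i+1)! e^s; the summand 1 covers
   [s <= 1], where s^i <= 1 <= e^s. *)
exists (\sum_(i < size p) `|p`_i| * (i.+1`!%:R + 1)).
  by apply: sumr_ge0 => i _; rewrite mulr_ge0// addr_ge0.
move=> s s0; rewrite horner_coef.
apply: (@le_trans _ _ (\sum_(i < size p) `|p`_i * s ^+ i| * expR (- s))).
  by rewrite -mulr_suml ler_wpM2r ?expR_ge0// ler_norm_sum.
apply: ler_sum => i _; rewrite normrM -mulrA ler_wpM2l//.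
rewrite (ger0_norm (exprn_ge0 _ s0)) expRN ler_pdivrMr ?expR_gt0//.
have [s1|s1] := leP s 1.
  apply: (@le_trans _ _ 1); first exact: exprn_ile1.
  have e1 : 1 <= expR s by apply: le_trans (expR_ge1Dx s); rewrite lerDl.
  have f1 : 0 <= i.+1`!%:R :> R by [].
  by nra.
apply: (@le_trans _ _ (s ^+ i.+1)); first by rewrite ler_weXn2l// ltW.
have := expR_ge1Dxn i s0; have fi : 0 < i.+1`!%:R :> R by rewrite ltr0n fact_gt0.
have se := expR_gt0 s.
move=> H; have {}H : s ^+ i.+1 / i.+1`!%:R <= expR s by lra.
by move: H; rewrite ler_pdivrMr// => H; nra.
Qed.

Lemma flat_le0 p t : t <= 0 -> flat p t = 0.
Proof. by move=> t0; rewrite /flat ltNge t0. Qed.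

Lemma flat1_gt0 t : (0 < flat 1 t) = (0 < t).
Proof.
by rewrite /flat; case: (ltP 0 t) => _; rewrite ?ltxx// hornerE mul1r expR_gt0.
Qed.

Lemma flat1_ge0 t : 0 <= flat 1 t.
Proof. by rewrite /flat; case: ifP => // _; rewrite hornerE mul1r expR_ge0. Qed.

Lemma flat1_le1 t : flat 1 t <= 1.
Proof.
rewrite /flat; case: (ltP 0 t) => // t0; rewrite hornerE mul1r -expR0 ler_expR oppr_le0.
by rewrite invr_ge0 ltW.
Qed.

(** A bounded function times [t]: this gives continuity at 0, and the first factor is the
    Caratheodory quotient for the derivative at 0. *)
Lemma flatX p t : flat p t = flat ('X * p) t * t.
Proof.
rewrite /flat; case: (ltP 0 t) => [t0|]; last by rewrite mul0r.
by rewrite hornerM hornerX [RHS]mulrC !mulrA divff ?mul1r// gt_eqF.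
Qed.

Lemma flat_bounded p : exists2 C : R, 0 <= C & forall t, `|flat p t| <= C.
Proof.
have [C C0 CH] := polyM_expRN_bounded p; exists C => // t.
rewrite /flat; case: (ltP 0 t) => t0; last by rewrite normr0.
by rewrite normrM (ger0_norm (expR_ge0 _)); apply: CH; rewrite invr_ge0 ltW.
Qed.

Lemma flat_continuous0 p : {for 0, continuous (flat p)}.
Proof.
have [C C0 CH] := flat_bounded ('X * p).
rewrite /prop_for /continuous_at flat_le0//; apply/cvgrPdist_le => /= e e0.
have C1 : 0 < C + 1 by rewrite ltr_wpDl.
near=> t; rewrite sub0r normrN flatX normrM.
have : `|t| <= e / (C + 1).
  rewrite -[t]opprK normrN -sub0r; near: t.
  have : 0 < e / (C + 1) by rewrite divr_gt0.
  by move: (@cvg_id _ (nbhs (0 : R))) => /cvgrPdist_le; apply.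
rewrite ler_pdivlMr// mulrC; apply: le_trans; rewrite ler_wpM2r//.
by apply: le_trans (CH t) _; rewrite lerDl.
Unshelve. all: by end_near. Qed.

(** With x = 1/t one has d/dt = - x^2 d/dx, and the x-derivative of p e^(-x) is (p' - p) e^(-x). *)
Lemma is_derive_flat p t :
  is_derive t (1 : R) (flat p) (flat ('X ^+ 2 * (p - p^`())) t).
Proof.
have [t0|t0|->] := ltgtP t 0.
- rewrite flat_le0 ?ltW//; apply: (@near_eq_is_derive _ _ _ (cst 0)).
  near=> s; rewrite flat_le0//; apply: ltW; near: s; exact: lt_nbhsl.
- apply: (@near_eq_is_derive R R R (fun s : R => p.[s^-1] * expR (- s^-1))).
    by near=> s; rewrite /flat ifT//; near: s; exact: lt_nbhsr.
  have tn0 : t != 0 by rewrite gt_eqF.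
  have dV : is_derive t (1 : R) (fun s : R => s^-1) (- t ^- 2).
    split; first exact: derivableV.
    by rewrite deriveV// derive_id [_ *: 1]mulr1.
  have dp : is_derive t (1 : R) (horner p \o (fun s : R => s^-1)) (p^`().[t^-1] * - t ^- 2).
    exact: is_derive1_comp.
  have de : is_derive t (1 : R) (expR \o (fun s : R => - s^-1)) (expR (- t^-1) * - - t ^- 2).
    exact: is_derive1_comp.
  apply: (is_derive_eq (is_deriveM dp de)).
  rewrite /flat t0 hornerM hornerXn hornerD hornerN /= -exprVn.
  set a := p.[_]; set b := (p^`()).[_]; set c := expR _.
  change (a * (c * - - t^-1 ^+ 2) + c * (b * - t^-1 ^+ 2) = t^-1 ^+ 2 * (a - b) * c).
  ring.
- rewrite flat_le0//; apply/is_derive1_caratheodory; exists (flat ('X * p)); split.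
  + by move=> z; rewrite (flat_le0 p (lexx 0)) !subr0 flatX.
  + exact: flat_continuous0.
  + exact: flat_le0.
Unshelve. all: by end_near. Qed.

(** The Caratheodory factor [q] replaces a division by the increment of [f], which may vanish for
    nonzero [h]. *)
Lemma is_derive_comp1 (V : normedModType R) (g : R -> R) (f : V -> R) (v e : V) (a b : R) :
  is_derive (f v) (1 : R) g a -> is_derive v e f b -> is_derive v e (g \o f) (a * b).
Proof.
move=> /is_derive1_caratheodory[q [gq qc qa]] [df fb].
have Fh : (fun h : R => f (h *: e + v)) @ 0^' --> f v.
  have /derivable1P/derivable1_diffP/differentiable_continuous := df.
  by rewrite /prop_for /continuous_at /= scale0r add0r => H; apply: cvg_within_filter.
have qh : (fun h : R => q (f (h *: e + v))) @ 0^' --> a.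
  by rewrite -qa; exact: (cvg_comp _ _ Fh qc).
pose A (h : R) : R := h^-1 *: (f (h *: e + v) - f v).
have Ab : A @ 0^' --> b by rewrite -fb; exact: df.
have H : (fun h : R => h^-1 *: (g (f (h *: e + v)) - g (f v))) @ 0^' --> a * b.
  rewrite (_ : (fun h => _) = (fun h : R => q (f (h *: e + v))) \* A).
    exact: cvgM.
  by apply/funext => h /=; rewrite gq /A [LHS]mulrCA.
by split; [apply/cvg_ex; exists (a * b)|exact/cvg_lim].
Qed.

Lemma Ck_flat n k (V : set 'rV[R]_n) f p : open V -> Ck k V f ->
  Ck k V (fun v => flat p (f v)).
Proof.
move=> oV; elim: k p => [|k IHk] p fk; have [fc fd] := fk.
  split=> // v Vv; apply: continuous_comp; first exact: fc.
  by apply: differentiable_continuous; apply/derivable1_diffP; have [] := is_derive_flat p (f v).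
have dH v i (Vv : V v) : is_derive v (delta_mx 0 i : 'rV[R]_n) (flat p \o f)
    (flat ('X ^+ 2 * (p - p^`())) (f v) * 'D_(delta_mx 0 i) f v).
  apply: is_derive_comp1; first exact: is_derive_flat.
  by apply: derivableP; exact: (fd i).1.
split.
  move=> v Vv; apply: continuous_comp; first exact: fc.
  by apply: differentiable_continuous; apply/derivable1_diffP; have [] := is_derive_flat p (f v).
move=> i; split=> [v Vv|]; first by have [] := dH v i Vv.
apply: (@Ck_ext _ _ _ _ ((fun v => flat ('X ^+ 2 * (p - p^`())) (f v)) *
    'D_(delta_mx 0 i) f)) => // [v Vv|].
  by have /@derive_val -> := dH v i Vv.
by apply: CkM => //; [apply: IHk; exact: Ck_pred|exact: (fd i).2].
Qed.

Lemma Csmooth_flat n (V : set 'rV[R]_n) f p : open V -> Csmooth V f ->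
  Csmooth V (fun v => flat p (f v)).
Proof. by move=> oV fV k; exact: Ck_flat. Qed.

End FlatFunction.

Lemma continuous_at_dist (R : realType) (T : topologicalType) (W : normedModType R)
    (f : T -> W) (x : T) :
  (forall e : R, 0 < e -> \forall y \near x, `|f x - f y| <= e) ->
  {for x, continuous f}.
Proof. by move=> H; apply/cvgrPdist_le. Qed.

Section SmoothDeterminant.
Context (R : realType) (n : nat) (V : set 'rV[R]_n) (oV : open V).

Lemma Csmooth_det m (M : 'rV[R]_n -> 'M[R]_m) :
  (forall i j, Csmooth V (fun v => M v i j)) -> Csmooth V (fun v => \det (M v)).
Proof.
move=> MV; rewrite (_ : (fun v => _) =
    \sum_(s : 'S_m) cst ((-1) ^+ s) * \prod_(i < m) (fun v => M v i (s i))).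
  apply: Csmooth_sum => // s _; apply: CsmoothM => //; first exact: Csmooth_cst.
  by apply: Csmooth_prod => // i _; exact: MV.
by apply/funext => v; rewrite /determinant fct_sumE; apply: eq_bigr => s _;
  rewrite fctE fct_prodE.
Qed.

Lemma Csmooth_invmx m (M : 'rV[R]_n -> 'M[R]_m) :
  (forall i j, Csmooth V (fun v => M v i j)) ->
  (forall v, V v -> M v \in unitmx) ->
  forall i j, Csmooth V (fun v => invmx (M v) i j).
Proof.
move=> MV MU i j.
apply: (@Csmooth_ext _ _ _ ((fun v => (\det (M v))^-1) *
    (cst ((-1) ^+ (j + i)) * (fun v => \det (row' j (col' i (M v))))))) => //.
  by move=> v Vv; rewrite /invmx MU// !mxE.
apply: CsmoothM => //.
  apply: CsmoothV => //; last exact: Csmooth_det.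
  by move=> v /MU; rewrite unitmxE unitfE.
apply: CsmoothM => //; first exact: Csmooth_cst.
apply: Csmooth_det => a b.
by rewrite (_ : (fun v => _) = (fun v => M v (lift j a) (lift i b)))//;
  apply/funext => v; rewrite !mxE.
Qed.

End SmoothDeterminant.

(** * Inverse function theorem *)

Section InverseFunction.
Context (R : realType) (n : nat).
Implicit Types (V : set 'rV[R]_n) (F : 'rV[R]_n -> 'rV[R]_n).

(** Transposed with respect to column conventions: the differential is [v |-> v *m jacobian_mx F x],
    and the Jacobian of [G \o F] has that of [F] on the left. *)
Definition jacobian_mx m (F : 'rV[R]_n -> 'rV[R]_m) (x : 'rV[R]_n) : 'M[R]_(n, m) :=
  \matrix_(i, a) 'D_(delta_mx 0 i) (fun v => F v 0 a) x.

Lemma mulmx_bounded m p (A : 'M[R]_(m, p)) :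
  exists2 K : R, 0 < K & forall v : 'rV[R]_m, `|v *m A| <= K * `|v|.
Proof.
exists (1 + \sum_(j < p) \sum_(i < m) `|A i j|).
  by rewrite ltr_pwDl// sumr_ge0// => j _; exact: sumr_ge0.
move=> v; apply: row_norm_le.
  by rewrite mulr_ge0// addr_ge0// sumr_ge0// => j _; exact: sumr_ge0.
move=> j; rewrite mxE; apply: le_trans (ler_norm_sum _ _ _) _.
apply: (@le_trans _ _ (\sum_(i < m) `|A i j| * `|v|)).
  by apply: ler_sum => i _; rewrite normrM mulrC ler_wpM2l// row_coord_le.
rewrite -mulr_suml ler_wpM2r// ler_wpDl// (bigD1 j)//= lerDl.
by rewrite sumr_ge0// => k _; exact: sumr_ge0.
Qed.

Lemma C1_strict_mx m (V : set 'rV[R]_n) (F : 'rV[R]_n -> 'rV[R]_m) x (e : R) :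
  open V -> V x -> (forall a, Csmooth V (fun v => F v 0 a)) -> 0 < e ->
  exists2 d : R, 0 < d & forall h k, `|x - h| < d -> `|x - k| < d ->
    `|F h - F k - (h - k) *m jacobian_mx F x| <= e * `|h - k|.
Proof.
move=> oV Vx FV e0.
have /choice[d dP] : forall a, exists d : R, 0 < d /\ forall h k, `|x - h| < d -> `|x - k| < d ->
    `|F h 0 a - F k 0 a - \sum_(i < n) 'D_(delta_mx 0 i) (fun v => F v 0 a) x *
        (h 0 i - k 0 i)| <= e * `|h - k|.
  by move=> a; have [d d0 dP] := C1_strict oV Vx (FV a 1%N) e0; exists d.
exists (\big[Num.min/1]_a d a).
  by elim/big_ind: _ => // [u v u0 v0|a _]; [rewrite lt_min u0|exact: (dP a).1].
move=> h k hd kd; apply: row_norm_le; first by rewrite mulr_ge0// ltW.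
move=> a; have [_ /(_ h k)] := dP a.
have da : \big[Num.min/1]_a d a <= d a by exact: bigmin_le_cond.
move=> /(_ (lt_le_trans hd da) (lt_le_trans kd da)); rewrite !mxE.
by under [in X in _ -> X]eq_bigr do rewrite !mxE mulrC.
Qed.

Lemma closed_box_compact (z : 'rV[R]_n) (r : R) : 0 <= r ->
  compact [set v : 'rV[R]_n | `|z - v| <= r].
Proof.
move=> r0; rewrite (_ : mkset _ =
    [set v : 'rV[R]_n | forall i, `[z 0 i - r, z 0 i + r]%classic (v ord0 i)]).
  by apply: (@rV_compact R n (fun i => `[z 0 i - r, z 0 i + r]%classic)) => i;
    exact: segment_compact.
apply/seteqP; split=> v /= H.
  move=> i; have := le_trans (row_coord_le (z - v) i) H.
  by rewrite !mxE ler_norml in_itv/= => /andP[? ?]; apply/andP; split; lra.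
apply: row_norm_le => // i; have := H i.
by rewrite !mxE in_itv/= => /andP[? ?]; rewrite ler_norml; apply/andP; split; lra.
Qed.

(* The fixed point is a minimum of |v - T v| on the compact box. *)
Lemma contraction_fixpoint (T : 'rV[R]_n -> 'rV[R]_n) (z : 'rV[R]_n) (r : R) :
  0 < r -> (forall v, `|z - v| <= r -> {for v, continuous T}) ->
  (forall v, `|z - v| <= r -> `|z - T v| <= r) ->
  (forall v w, `|z - v| <= r -> `|z - w| <= r -> `|T v - T w| <= 2^-1 * `|v - w|) ->
  exists2 v, `|z - v| <= r & T v = v.
Proof.
move=> r0 Tcont TU Tc; pose U := [set v : 'rV[R]_n | `|z - v| <= r].
have U0 : U !=set0 by exists z; rewrite /U /= subrr normr0 ltW.
have fc : {within U, continuous (fun v => `|v - T v|)}.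
  apply: continuous_in_subspaceT => v; rewrite inE => Uv.
  apply: continuous_comp; last exact: norm_continuous.
  by apply: continuousB; [exact: cvg_id|exact: Tcont].
have [v + vmin] := EVT_min_rV U0 (@closed_box_compact z r (ltW r0)) fc.
rewrite inE => Uv; exists v => //; apply/eqP; rewrite eq_sym -subr_eq0 -normr_le0.
have := vmin (T v); rewrite inE => /(_ (TU _ Uv)).
by have := Tc _ _ Uv (TU _ Uv); set a := `|_|; set b := `|_|; lra.
Qed.

Variables (V : set 'rV[R]_n) (F : 'rV[R]_n -> 'rV[R]_n) (x : 'rV[R]_n).
Hypotheses (oV : open V) (Vx : V x).
Hypothesis FV : forall a, Csmooth V (fun v => F v 0 a).
Hypothesis Jx : jacobian_mx F x \in unitmx.

Lemma jacobian_Csmooth i j : Csmooth V (fun v => jacobian_mx F v i j).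
Proof.
rewrite (_ : (fun v => _) = 'D_(delta_mx 0 i) (fun v => F v 0 j)).
  exact: Csmooth_derive.
by apply/funext => v; rewrite mxE.
Qed.

Lemma jacobian_unit_near : \forall v \near x, jacobian_mx F v \in unitmx.
Proof.
have dc : {for x, continuous (fun v => \det (jacobian_mx F v))}.
  apply: (Csmooth_continuous _ Vx); apply: Csmooth_det => // i j.
  exact: jacobian_Csmooth.
have d0 : \det (jacobian_mx F x) != 0 by rewrite -unitfE -unitmxE.
near=> v; rewrite unitmxE unitfE; near: v; exact: (cvgr_neq0 _ dc d0).
Unshelve. all: by end_near. Qed.

(** With [L] the inverse of the Jacobian at [x], the map z |-> z - F(z) L contracts by 1/2 on a
    small ball ([phi]). This one estimate yields injectivity, a Lipschitz bound for the inverse, and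
    openness of the image by a fixed point argument. *)
Lemma inverse_function : exists (Z : set 'rV[R]_n) (H : 'rV[R]_n -> 'rV[R]_n),
  [/\ open Z, Z x, Z `<=` V, open (F @` Z) & forall z, Z z -> H (F z) = z] /\
  forall a, Csmooth (F @` Z) (fun y => H y 0 a).
Proof.
pose L := invmx (jacobian_mx F x).
have [K K0 KL] := mulmx_bounded L.
(* Multiplication by [L] costs a factor [K], which turns this tolerance into the contraction
   constant 1/2. *)
have e0 : 0 < (2 * K)^-1 by rewrite invr_gt0 mulr_gt0.
have [d1 d10 dF] := C1_strict_mx oV Vx FV e0.
have : nbhs x (V `&` [set v | jacobian_mx F v \in unitmx]).
  by apply: filterI; [exact: open_nbhs_nbhs|exact: jacobian_unit_near].
move=> /nbhs_ballP[d2 /= d20 dV].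
pose d := Num.min d1 d2; have d0 : 0 < d by rewrite lt_min d10.
pose Z := ball x d.
have Zd1 v : Z v -> `|x - v| < d1.
  by move=> /row_ball; rewrite lt_min => /andP[].
have ZV v : Z v -> V v /\ jacobian_mx F v \in unitmx.
  move=> /row_ball; rewrite lt_min => /andP[_ H]; apply: dV; exact/row_ball.
have phi h k : Z h -> Z k -> `|(h - k) - (F h - F k) *m L| <= 2^-1 * `|h - k|.
  move=> /Zd1 hd /Zd1 kd; have := dF h k hd kd.
  have -> : h - k - (F h - F k) *m L =
      - ((F h - F k - (h - k) *m jacobian_mx F x) *m L).
    by rewrite [in RHS]mulmxBl /L mulmxK// opprB.
  move=> H; rewrite normrN; apply: le_trans (KL _) _.
  apply: le_trans (ler_wpM2l (ltW K0) H) _.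
  by rewrite mulrA invfM mulrCA divff ?mulr1 ?gt_eqF.
have lipF h k : Z h -> Z k -> `|h - k| <= 2 * K * `|F h - F k|.
  move=> Zh Zk; have H1 := phi _ _ Zh Zk; have H2 := KL (F h - F k).
  have := ler_normD (h - k - (F h - F k) *m L) ((F h - F k) *m L).
  by rewrite subrK; move: H1 H2; set a := `|_|; set b := `|_|;
    set c := `|_|; set e := `|F h - F k|; lra.
have FI h k : Z h -> Z k -> F h = F k -> h = k.
  move=> Zh Zk E; have := lipF _ _ Zh Zk; rewrite E subrr normr0 mulr0.
  by rewrite normr_le0 subr_eq0 => /eqP.
have oZ : open Z by exact: ball_open.
have Zx : Z x by exact: ballxx.
have FC v : V v -> {for v, continuous F} by exact: Csmooth_row_continuous FV.
have oFZ : open (F @` Z).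
  rewrite openE => _ [z Zz <-]; rewrite /interior.
  have /nbhs_ballP[r' /= r'0 rZ] : nbhs z Z by exact: open_nbhs_nbhs.
  pose r := r' / 2; have r0 : 0 < r by rewrite divr_gt0.
  have UZ v : `|z - v| <= r -> Z v.
    by move=> zv; apply: rZ; apply/row_ball; apply: le_lt_trans zv _; rewrite /r; lra.
  apply/nbhs_ballP; exists (r / (2 * K)) => /=; first by rewrite divr_gt0// mulr_gt0.
  move=> y /row_ball yr.
  (* Newton's method with the derivative frozen at [x]: a fixed point solves F v = y because [L] is
     invertible. The radius [r / (2 * K)] makes K |y - F z| < r/2, and [T] halves distances, so [T]
     maps the box of radius [r] around [z] to itself. *)
  pose T v := v + (y - F v) *m L.
  have TE v w : T v - T w = (v - w) - (F v - F w) *m L.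
    rewrite /T !mulmxBl; move: (y *m L) (F v *m L) (F w *m L) => a b c.
    by apply/rowP => i; rewrite !mxE; ring.
  have zU : `|z - z| <= r by rewrite subrr normr0 ltW.
  have [|||v vr Tv] := @contraction_fixpoint T z r r0.
  - move=> v /UZ/ZV[Vv _]; apply: continuousD; first exact: cvg_id.
    have mc : continuous (fun u : 'rV[R]_n => u *m L).
      move=> u; apply: continuous_row => j; apply: (@Csmooth_continuous _ _ setT) => //.
      rewrite (_ : (fun u : 'rV[R]_n => _) = \sum_i (fun u : 'rV[R]_n => u 0 i) * cst (L i j)).
        by apply: Csmooth_sum openT _ => i _; apply: CsmoothM openT _ _;
          [exact: Csmooth_coord|exact: Csmooth_cst].
      by apply/funext => w; rewrite mxE fct_sumE.
    apply: (@continuous_comp _ _ _ (fun w => y - F w) (fun u : 'rV[R]_n => u *m L)); last exact: mc.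
    by apply: continuousB; [exact: cst_continuous|exact: FC].
  - move=> v vr; have H1 := phi _ _ (UZ _ vr) (UZ _ zU).
    have H2 := KL (y - F z).
    have -> : z - T v = - ((T v - T z) + (T z - z)) by rewrite addrA subrK opprB.
    rewrite normrN; apply: le_trans (ler_normD _ _) _.
    have -> : T z - z = (y - F z) *m L by rewrite /T addrC addKr.
    rewrite TE; move: H1 H2 vr yr; rewrite -(distrC z v) -(distrC (F z) y).
    set a := `|_|; set b := `|_|; set c := `|_|; set e := `|F z - y| => H1 H2 br er.
    have : K * e <= r / 2.
      by move: er; rewrite ltr_pdivlMr ?mulr_gt0// => /ltW; nra.
    by move: H1 H2 br; lra.
  - by move=> v w vr wr; rewrite TE; apply: phi; exact: UZ.
  exists v; first exact: UZ.
  have : (y - F v) *m L = 0 by move: Tv; rewrite /T -[RHS]addr0 => /addrI.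
  move=> /(congr1 (mulmxr (jacobian_mx F x))); rewrite /= /L mulmxKV// mul0mx.
  by move/eqP; rewrite subr_eq0 => /eqP.
pose H y := xget 0 [set z | Z z /\ F z = y].
have HF z : Z z -> H (F z) = z.
  move=> Zz; rewrite /H; case: xgetP => [w _ [Zw /FI]|/(_ z) []//]; exact.
have HZ y : (F @` Z) y -> Z (H y) by move=> [z Zz <-]; rewrite HF.
have FH y : (F @` Z) y -> F (H y) = y by move=> [z Zz <-]; rewrite HF.
exists Z, H; split; first by split=> // v /ZV[].
have lipH y y' : (F @` Z) y -> (F @` Z) y' -> `|H y - H y'| <= 2 * K * `|y - y'|.
  by move=> Fy Fy'; have := lipF _ _ (HZ _ Fy) (HZ _ Fy'); rewrite !FH.
have HC y : (F @` Z) y -> {for y, continuous H}.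
  move=> Fy; apply: continuous_at_dist => e e1.
  have K2 : 0 < 2 * K by rewrite mulr_gt0.
  have : nbhs y ((F @` Z) `&` ball y (e / (2 * K))).
    have e3 : 0 < e / (2 * K) by rewrite divr_gt0.
    exact: (@filterI _ (nbhs y) _ _ _ (open_nbhs_nbhs (conj oFZ Fy)) (nbhsx_ballx _ _ e3)).
  apply: filterS => y' [Fy' /row_ball yy'].
  by apply: le_trans (lipH _ _ Fy Fy') _; rewrite mulrC -ler_pdivlMr// ltW.
(* The increment [w] of [H] satisfies |t e_i - w J| <= (e / C) |w|, where J is the Jacobian of [F]
   at [H y], and |w| is at most a multiple of |t|. The constant [C] absorbs this multiple and the
   norm of the inverse of J. *)
have dH y i : (F @` Z) y -> derivable H y (delta_mx 0 i) /\
    'D_(delta_mx 0 i) H y = (delta_mx 0 i : 'rV[R]_n) *m invmx (jacobian_mx F (H y)).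
  move=> Fy; set ei : 'rV[R]_n := delta_mx 0 i; set z := H y.
  have [Vz Jz] := ZV _ (HZ _ Fy); rewrite -/z in Vz Jz.
  have [Kz Kz0 KzL] := mulmx_bounded (invmx (jacobian_mx F z)).
  have Hlim : (fun t : R => t^-1 *: (H (t *: ei + y) - H y)) @ 0^' -->
      ei *m invmx (jacobian_mx F z).
    apply/cvgrPdist_le => /= e e1.
    pose C := Kz * (2 * K * `|ei|) + 1.
    have C0 : 0 < C by rewrite ltr_wpDl// !mulr_ge0// ltW.
    have [dz dz0 dFz] := C1_strict_mx oV Vz FV (divr_gt0 e1 C0).
    have yt : (fun t : R => t *: ei + y) @ 0^' --> y.
      rewrite -[X in _ --> X]add0r -(scale0r ei); apply: cvg_within_filter.
      exact: (cvgD (cvgZr_tmp (@cvg_id _ _)) (cvg_cst y)).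
    have Ndz : \forall y' \near y, `|z - H y'| < dz.
      exact: (cvgrPdist_lt _ _).1 (HC _ Fy) _ dz0.
    have /yt N : nbhs y ((F @` Z) `&` [set y' | `|z - H y'| < dz]).
      exact: (@filterI _ (nbhs y) _ _ _ (open_nbhs_nbhs (conj oFZ Fy)) Ndz).
    near=> t.
    have tn0 : t != 0 by near: t; exact: nbhs_dnbhs_neq.
    have [Fyt zt] : ((F @` Z) `&` [set y' | `|z - H y'| < dz]) (t *: ei + y).
      by near: t; exact: N.
    have := dFz (H (t *: ei + y)) z zt; rewrite subrr normr0 => /(_ dz0).
    rewrite !FH// addrK -/z => H1.
    have H2 := lipH _ _ Fyt Fy; rewrite addrK -/z normrZ in H2.
    set w := H (t *: ei + y) - z in H1 H2 *.
    have -> : ei *m invmx (jacobian_mx F z) - t^-1 *: w =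
        t^-1 *: ((t *: ei - w *m jacobian_mx F z) *m invmx (jacobian_mx F z)).
      by rewrite mulmxBl mulmxK// -scalemxAl [in RHS]scalerBr scalerA mulVf// scale1r.
    rewrite normrZ normfV ler_pdivrMl ?normr_gt0//.
    apply: le_trans (KzL _) _; apply: le_trans (ler_wpM2l (ltW Kz0) H1) _.
    have t0 : 0 < `|t| by rewrite normr_gt0.
    have e2 : 0 <= e / C by rewrite ltW// divr_gt0.
    apply: le_trans (ler_wpM2l (ltW Kz0) (ler_wpM2l e2 H2)) _.
    have -> : Kz * (e / C * (2 * K * (`|t| * `|ei|))) =
      `|t| * (e * (Kz * (2 * K * `|ei|) / C)) by ring.
    apply: (ler_wpM2l (ltW t0)); apply: (ler_piMr (ltW e1)).
    by rewrite ler_pdivrMr// mul1r /C lerDl.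
  by split; [apply/cvg_ex; exists (ei *m invmx (jacobian_mx F z))|exact/cvg_lim].
(* Bootstrap: the derivative of [H] is the smooth inverse Jacobian composed with [H], so if [H] is
   C^k then it is C^(k+1). *)
move=> a k; elim: k a => [|k IHk] a.
  by split=> // y Fy; exact: (continuous_comp (HC y Fy) (@coord_row_continuous _ _ a _)).
split=> [y Fy|i].
  exact: (continuous_comp (HC y Fy) (@coord_row_continuous _ _ a _)).
have dHa y : (F @` Z) y -> derivable (fun v => H v 0 a) y (delta_mx 0 i).
  by move=> Fy; apply: (derivable_row _ _ _).1; exact: (dH y i Fy).1.
split=> //.
apply: (@Ck_ext _ _ _ _ ((fun z => invmx (jacobian_mx F z) i a) \o H)) => // [y Fy|].
  rewrite -derive_row ?(dH y i Fy).2; last exact: (dH y i Fy).1.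
  by rewrite -rowE mxE.
apply: (@Ck_comp _ _ _ _ _ Z) => //.
apply: Csmooth_invmx => // [b c|v /ZV[]//].
by apply: Csmooth_sub (jacobian_Csmooth b c) => v /ZV[].
Unshelve. all: by end_near. Qed.

End InverseFunction.

(** A Taylor estimate by iterating the mean value theorem, the derivatives being supplied as the
    sequence [phi]. It converts vanishing jets of the action into decay of order N. *)
Lemma flat_derivatives_bound (R : realType) (d C : R) (N : nat) (phi : nat -> R -> R) :
  0 <= C ->
  (forall i t, `|t| < d -> is_derive t (1 : R) (phi i) (phi i.+1 t)) ->
  (forall i, (i < N)%N -> phi i 0 = 0) ->
  (forall t, `|t| < d -> `|phi N t| <= C) ->
  forall t, `|t| < d -> `|phi 0%N t| <= C * `|t| ^+ N.
Proof.
move=> C0; elim: N phi => [|N IHN] phi dphi phi0 phiN t td.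
  by rewrite mulr1; exact: phiN.
have {}IHN := IHN (fun i => phi i.+1) (fun i => dphi i.+1) (fun i iN => phi0 i.+1 iN) phiN.
have sd (s : R) : `|s| <= `|t| -> `|s| < d by move=> st; exact: le_lt_trans st td.
have [|s st] := @MVT_line R R (phi 0%N) 0 1 t.
  by move=> s st; rewrite add0r [_ *: 1]mulr1; have [] := dphi 0%N s (sd s st).
rewrite !add0r ![_ *: 1]mulr1 phi0// subr0 => ->.
have /@derive_val -> := dphi 0%N s (sd s st).
rewrite normrM exprS mulrCA ler_wpM2l//; apply: le_trans (IHN _ (sd s st)) _.
by rewrite ler_wpM2l// lerXn2r.
Qed.

Lemma digits_inj (n B : nat) (s t : nat -> nat) :
  (forall a, s a < B)%N -> (forall a, t a < B)%N ->
  (\sum_(a < n) s a * B ^ a = \sum_(a < n) t a * B ^ a)%N ->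
  forall a, (a < n)%N -> s a = t a.
Proof.
elim: n s t => // n IHn s t sB tB.
rewrite !big_ord_recl expn0 !muln1.
have shift (u : nat -> nat) : (\sum_(i < n) u (bump 0 i) * B ^ (bump 0 i) =
    B * \sum_(i < n) u i.+1 * B ^ i)%N.
  rewrite big_distrr; apply: eq_bigr => i _.
  by rewrite /bump /= add1n expnS mulnCA.
rewrite !shift => E.
have B0 : (0 < B)%N by apply: leq_ltn_trans (sB 0%N).
have E0 : s 0%N = t 0%N.
  have := congr1 (fun k => (k %% B)%N) E.
  by rewrite /= -![(B * _)%N]mulnC !(addnC (_ 0%N)) !modnMDl !modn_small.
move: E; rewrite E0 => /addnI/eqP; rewrite eqn_pmul2l// => /eqP E.
by case=> [|a] // an; exact: (IHn (fun a => s a.+1) (fun a => t a.+1)).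
Qed.

(* Kronecker substitution z_a = T ^ (B ^ a), for a base B exceeding all the   *)
(* exponents, turns distinct monomials into distinct powers of T.             *)
Lemma monomials_free (R : numDomainType) (n m : nat) (c : 'I_m -> R)
    (s : 'I_m -> 'I_n -> nat) :
  (forall z : 'rV[R]_n, \sum_(j < m) c j * \prod_(a < n) z 0 a ^+ s j a = 0) ->
  forall sigma : 'I_n -> nat, \sum_(j < m | [forall a, s j a == sigma a]) c j = 0.
Proof.
move=> cs sigma.
pose B := (\sum_(j < m) \sum_(a < n) s j a + \sum_(a < n) sigma a).+1.
pose e (t : 'I_n -> nat) := (\sum_(a < n) t a * B ^ a)%N.
have e_inj (t u : 'I_n -> nat) : (forall a, t a < B)%N -> (forall a, u a < B)%N ->
    (e t == e u) = [forall a, t a == u a].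
  move=> tB uB; apply/eqP/forallP => [E a|tu]; last first.
    by apply: eq_bigr => a _; rewrite (eqP (tu a)).
  pose ext (t : 'I_n -> nat) (k : nat) := if insub k is Some a then t a else 0%N.
  have extE v (b : 'I_n) : ext v b = v b by rewrite /ext valK.
  have extB v : (forall a, v a < B)%N -> (forall k, ext v k < B)%N.
    by move=> vB k; rewrite /ext; case: insubP.
  have := @digits_inj n B (ext t) (ext u) (extB _ tB) (extB _ uB) _ a (ltn_ord a).
  rewrite !extE => -> //.
  under eq_bigr do rewrite extE; under [RHS]eq_bigr do rewrite extE.
  exact: E.
have sB j a : (s j a < B)%N.
  by rewrite /B ltnS (bigD1 j)//= (bigD1 a)//= -!addnA leq_addr.
have sigB a : (sigma a < B)%N.
  by rewrite /B ltnS (bigD1 a)//= addnCA leq_addr.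
pose p : {poly R} := \sum_(j < m) c j *: 'X^(e (s j)).
have pT T : p.[T] = 0.
  rewrite /p horner_sum -[RHS](cs (\row_a T ^+ (B ^ a))); apply: eq_bigr => j _.
  rewrite hornerZ hornerXn; congr (_ * _); rewrite /e expr_sum.
  by apply: eq_bigr => a _; rewrite mxE -exprM mulnC.
have p0 : p = 0.
  apply/eqP; apply: contraT => pn0.
  have := @max_poly_roots _ p [seq i%:R | i <- iota 0 (size p)] pn0.
  rewrite size_map size_iota ltnn; apply.
    by apply/allP => _ /mapP[i _ ->]; rewrite /root pT.
  by rewrite map_inj_uniq ?iota_uniq// => i j /eqP; rewrite eqr_nat => /eqP.
have := congr1 (fun q : {poly R} => q`_(e sigma)) p0.
rewrite coef0 /p coef_sum => E; rewrite -[RHS]E big_mkcond /=; apply: eq_bigr => j _.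
rewrite coefZ coefXn -e_inj// eq_sym.
by case: eqP; rewrite ?mulr1 ?mulr0.
Qed.

(** * Charts and smooth functions on manifolds *)

Section Charts.
Context (R : realType) (X : Type).

Lemma smooth_in_subP (n : nat) (c : pchart R X n) (V : set X) (f : X -> R) :
  V `<=` dom c ->
  smooth_in c V f <->
  exists2 g, Csmooth (c @` V) g & forall x, V x -> f x = g (c x).
Proof.
move=> Vc; rewrite /smooth_in setIidl//; split=> -[g gV fg]; exists g => // x Vx.
  by apply: fg => //; exact: Vc.
by move=> _; exact: fg.
Qed.

Lemma smooth_in_sub (n : nat) (c : pchart R X n) (U V : set X) (f : X -> R) :
  V `<=` U -> smooth_in c U f -> smooth_in c V f.
Proof.
move=> VU [g gU fg]; exists g; last by move=> x /VU; exact: fg.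
by apply: Csmooth_sub gU; apply: image_subset; exact: setSI.
Qed.

Lemma smooth_in_rowP (n m : nat) (c : pchart R X n) (V : set X) (F : X -> 'rV[R]_m) :
  V `<=` dom c -> (forall a, smooth_in c V (fun x => F x 0 a)) ->
  exists2 H : 'rV[R]_n -> 'rV[R]_m,
    (forall a, Csmooth (c @` V) (fun v => H v 0 a)) & forall x, V x -> F x = H (c x).
Proof.
move=> Vc FV; have /choice[H HP] : forall a, exists g : 'rV[R]_n -> R,
    Csmooth (c @` V) g /\ forall x, V x -> F x 0 a = g (c x).
  by move=> a; have /(smooth_in_subP _ Vc)[g gV Fg] := FV a; exists g.
exists (fun v => \row_a H a v).
  move=> a; rewrite (_ : (fun v => _) = H a); first exact: (HP a).1.
  by apply/funext => v; rewrite mxE.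
by move=> x Vx; apply/rowP => a; rewrite mxE; exact: (HP a).2.
Qed.

(** Inside [c @] V1[the intersection is the preimage of the open set]d @[V2] under the transition
    map [H]; injectivity of [d] identifies the points. *)
Lemma image_setI_open (n m : nat) (c : pchart R X n) (d : pchart R X m)
    (H : 'rV[R]_n -> 'rV[R]_m) (V1 V2 : set X) :
  is_chart d -> V1 `<=` dom d -> V2 `<=` dom d ->
  open (c @` V1) -> open (d @` V2) ->
  (forall a, Csmooth (c @` V1) (fun v => H v 0 a)) ->
  (forall x, V1 x -> d x = H (c x)) -> open (c @` (V1 `&` V2)).
Proof.
move=> [dI _] V1d V2d o1 o2 HV dH.
rewrite (_ : _ @` _ = c @` V1 `&` H @^-1` (d @` V2)).
  by apply: open_preimage_on => // v V1v; exact: Csmooth_row_continuous HV V1v.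
apply/seteqP; split=> [_ [x [V1x V2x] <-]|_ [[x V1x <-] /= [y V2y E]]].
  by split; exists x => //; exact: dH.
by exists x => //; split=> //; rewrite -(dI y x)//; [exact: V2d|exact: V1d|rewrite E dH].
Qed.

(** Unlike [compatible], this pointwise relation is transitive through a chart around the point, so
    membership in a maximal atlas can be tested at each point against a single chart of the
    atlas. *)
Definition compatible_at (n : nat) (c d : pchart R X n) (x : X) : Prop :=
  exists V : set X,
    [/\ V x, V `<=` dom c, V `<=` dom d, open (c @` V) & open (d @` V)] /\
    (forall a, smooth_in c V (fun y => d y 0 a)) /\
    (forall a, smooth_in d V (fun y => c y 0 a)).

Lemma compatible_at_sym (n : nat) (c d : pchart R X n) x :
  compatible_at c d x -> compatible_at d c x.
Proof. by move=> [V [[Vx Vc Vd oc od] [cd dc]]]; exists V. Qed.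

Lemma Csmooth_comp_in (n m : nat) (c : pchart R X n) (d : pchart R X m)
    (V U : set X) (f : X -> R) :
  V `<=` dom c -> V `<=` U -> U `<=` dom d ->
  open (c @` V) -> open (d @` U) ->
  (forall a, smooth_in c V (fun x => d x 0 a)) -> smooth_in d U f ->
  smooth_in c V f.
Proof.
move=> Vc VU Ud ocV odU /(smooth_in_rowP Vc)[H HV dH].
move=> /(smooth_in_subP _ Ud)[g gU fg]; apply/(smooth_in_subP _ Vc).
exists (g \o H); last by move=> x Vx; rewrite /= -dH// fg//; exact: VU.
apply: (@Csmooth_comp _ _ _ _ (d @` U)) => // _ [x Vx <-].
by exists x; [exact: VU|rewrite dH].
Qed.

Lemma compatible_at_trans (n : nat) (c d e : pchart R X n) x : is_chart d ->
  compatible_at c d x -> compatible_at d e x -> compatible_at c e x.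
Proof.
move=> dch [V [[Vx Vc Vd ocV odV] [cd dc]]] [U [[Ux Ud Ue odU oeU] [de ed]]].
have UV_V : U `&` V `<=` V by move=> ? [].
have UV_U : U `&` V `<=` U by move=> ? [].
have VU_V : V `&` U `<=` V by move=> ? [].
have VU_U : V `&` U `<=` U by move=> ? [].
have [H HV dH] := smooth_in_rowP Vc cd.
have ocVU : open (c @` (V `&` U)) by exact: image_setI_open dH.
have [K KU dK] := smooth_in_rowP Ue ed.
have oeUV : open (e @` (U `&` V)) by exact: image_setI_open dK.
exists (V `&` U); split; first split=> //.
- by move=> y [/Vc].
- by move=> y [_ /Ue].
- by rewrite setIC.
split=> a.
  apply: (Csmooth_comp_in (d := d) (U := U)) => //; first by move=> y [/Vc].
  by move=> b; exact: smooth_in_sub (cd b).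
rewrite setIC; apply: (Csmooth_comp_in (d := d) (U := V)) => //.
  by move=> y [/Ue].
by move=> b; exact: smooth_in_sub (ed b).
Qed.

(** [f] transported to R^n, with value 0 off the image of [c]. Being canonical, it is a common
    witness for smoothness on all small sets, so that local witnesses glue. *)
Definition along (n : nat) (c : pchart R X n) (f : X -> R) (v : 'rV[R]_n) : R :=
  xget 0 [set r | exists2 x, dom c x & c x = v /\ f x = r].

Lemma alongE (n : nat) (c : pchart R X n) f x :
  is_chart c -> dom c x -> along c f (c x) = f x.
Proof.
move=> [cI _] cx; rewrite /along; case: xgetP => [r _ [y cy [yx <-]]|/(_ (f x))[]].
  by rewrite (cI y x).
by exists x.
Qed.

Lemma smooth_in_local (n : nat) (c : pchart R X n) (U : set X) (f : X -> R) :
  is_chart c -> (forall x, U x -> dom c x -> exists V : set X,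
    [/\ V x, V `<=` dom c, open (c @` V) & smooth_in c V f]) ->
  smooth_in c U f.
Proof.
move=> cch H; exists (along c f); last by move=> x _ cx; rewrite alongE.
apply: Csmooth_local => _ [x [Ux cx] <-]; have [V [Vx Vc oV fV]] := H x Ux cx.
exists (c @` V); first by exists x.
have /(smooth_in_subP _ Vc)[g gV fg] := fV.
by apply: Csmooth_ext gV => // _ [y Vy <-]; rewrite alongE ?fg//; exact: Vc.
Qed.

Lemma open_local (n : nat) (O : set 'rV[R]_n) :
  (forall v, O v -> exists U : set 'rV[R]_n, [/\ open U, U v & U `<=` O]) -> open O.
Proof.
move=> H; rewrite openE => v /H[U [oU Uv UO]]; rewrite /interior.
by apply: filterS UO _; exact: open_nbhs_nbhs.
Qed.

Lemma compatible_at_compatible (n : nat) (c d : pchart R X n) : is_chart c ->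
  (forall x, dom c x -> dom d x -> compatible_at c d x) -> compatible c d.
Proof.
move=> cch H; split.
  apply: open_local => _ [x [dx cx] <-].
  have [V [[Vx Vc Vd ocV odV] _]] := H x cx dx.
  exists (c @` V); split; [exact: ocV|by exists x|].
  by apply: image_subset => y Vy; split; [exact: Vd|exact: Vc].
move=> a; apply: smooth_in_local => // x dx cx.
by have [V [[Vx Vc Vd ocV odV] [cd dc]]] := H x cx dx; exists V.
Qed.

Lemma compatible_compatible_at (n : nat) (c d : pchart R X n) x :
  compatible c d -> compatible d c -> dom c x -> dom d x -> compatible_at c d x.
Proof.
move=> [io1 s1] [io2 s2] cx dx; exists (dom c `&` dom d); split.
  by split; [|move=> y [? ?]|move=> y [? ?]|rewrite setIC|].
by split=> a; [apply: smooth_in_sub (s1 a)|apply: smooth_in_sub (s2 a)] => y [].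
Qed.

End Charts.

Section SmoothStructures.
Context (R : realType) (X : Type) (n : nat).
Implicit Types (S : smooth_structure R X n) (c d : pchart R X n).

Lemma charts_compatible_at S c d x :
  charts S c -> charts S d -> dom c x -> dom d x -> compatible_at c d x.
Proof.
move=> Sc Sd.
exact: compatible_compatible_at (charts_compat Sc Sd) (charts_compat Sd Sc).
Qed.

Lemma charts_mem S c : is_chart c ->
  (forall x, dom c x -> exists d, [/\ charts S d, dom d x & compatible_at c d x]) ->
  charts S c.
Proof.
move=> cch H; apply: charts_max => // e Se.
have ce x : dom c x -> dom e x -> compatible_at c e x.
  move=> cx ex; have [d [Sd dx cd]] := H x cx.
  exact: compatible_at_trans (charts_chart Sd) cd (charts_compatible_at Sd Se dx ex).
split; first exact: (compatible_at_compatible cch ce).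
apply: (compatible_at_compatible (charts_chart Se)) => x ex cx.
by apply: compatible_at_sym; exact: ce.
Qed.

Lemma smooth_structure_charts_inj S1 S2 : charts S1 = charts S2 -> S1 = S2.
Proof.
case: S1 S2 => [A a1 a2 a3 a4] [B b1 b2 b3 b4] /= E.
case: B / E b1 b2 b3 b4 => b1 b2 b3 b4.
by rewrite (Prop_irrelevance a1 b1) (Prop_irrelevance a2 b2)
  (Prop_irrelevance a3 b3) (Prop_irrelevance a4 b4).
Qed.

(** Maximality of both atlases. Uniqueness of the bundle structure is thereby reduced to one common
    chart around each point. *)
Lemma smooth_structure_eq S1 S2 :
  (forall x, exists c, [/\ charts S1 c, charts S2 c & dom c x]) -> S1 = S2.
Proof.
move=> H; apply: smooth_structure_charts_inj; apply/seteqP; split=> c Sc.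
- apply: charts_mem (charts_chart Sc) _ => x cx; have [a [a1 a2 ax]] := H x.
  by exists a; split=> //; exact: charts_compatible_at Sc a1 cx ax.
- apply: charts_mem (charts_chart Sc) _ => x cx; have [a [a1 a2 ax]] := H x.
  by exists a; split=> //; exact: charts_compatible_at Sc a2 cx ax.
Qed.

Lemma manifold_eq (E1 E2 : manifold R X n) : mfd E1 = mfd E2 -> E1 = E2.
Proof.
case: E1 E2 => [S h s] [S' h' s'] /= E; case: S' / E h' s' => h' s'.
by rewrite (Prop_irrelevance h h') (Prop_irrelevance s s').
Qed.

Lemma atlas_smooth_structure (A : set (pchart R X n)) :
  (forall c, A c -> is_chart c) -> (forall x, exists2 c, A c & dom c x) ->
  (forall c d x, A c -> A d -> dom c x -> dom d x -> compatible_at c d x) ->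
  exists S, A `<=` charts S.
Proof.
move=> Ach Acov Acomp.
pose C := [set c | is_chart c /\
  forall d x, A d -> dom c x -> dom d x -> compatible_at c d x].
have CA c : A c -> C c.
  by move=> Ac; split=> [|d x Ad]; [exact: Ach|exact: Acomp].
have C1 c : C c -> is_chart c by case.
have C2 x : exists2 c, C c & dom c x.
  by have [c /CA Cc cx] := Acov x; exists c.
have C3at c d x : C c -> C d -> dom c x -> dom d x -> compatible_at c d x.
  move=> [_ cA] [_ dA] cx dx; have [a Aa ax] := Acov x.
  apply: (compatible_at_trans (Ach _ Aa)); first exact: cA.
  by apply: compatible_at_sym; exact: dA.
have C3 c d : C c -> C d -> compatible c d.
  move=> Cc Cd; apply: compatible_at_compatible; first exact: C1.
  by move=> x; exact: C3at.
have C4 c : is_chart c -> (forall d, C d -> compatible c d /\ compatible d c) -> C c.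
  move=> cch H; split=> // d x /CA/H[cd dc]; exact: compatible_compatible_at.
by exists (SmoothStructure C1 C2 C3 C4).
Qed.

Lemma mopen_local S (U : set X) :
  (forall x, U x -> exists c (V : set X), [/\ charts S c, V x, V `<=` U, V `<=` dom c &
    open (c @` V)]) -> mopen S U.
Proof.
move=> H; apply/mopenE => d Sd; apply: open_local => _ [x [Ux dx] <-].
have [c [V [Sc Vx VU Vc oV]]] := H x Ux.
have [W [[Wx Wd Wc odW ocW] [dc cd]]] := charts_compatible_at Sd Sc dx (Vc _ Vx).
have [K KU dK] := smooth_in_rowP Wd dc.
exists (d @` (W `&` V)); split.
- exact: image_setI_open (charts_chart Sc) Wc Vc odW oV KU dK.
- by exists x.
- by apply: image_subset => y [/Wd yd /VU yU].
Qed.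

Lemma mopen_in_chart S c (V : set X) :
  charts S c -> V `<=` dom c -> open (c @` V) -> mopen S V.
Proof. by move=> Sc Vc oV; apply: mopen_local => x Vx; exists c, V; split. Qed.

Lemma mopen_image S c (V : set X) :
  charts S c -> mopen S V -> V `<=` dom c -> open (c @` V).
Proof. by move=> Sc oV Vc; have /mopenE/(_ _ Sc) := oV; rewrite setIidl. Qed.

Lemma mopenI S (U V : set X) : mopen S U -> mopen S V -> mopen S (U `&` V).
Proof. exact: openI. Qed.

Definition smooth_at S (f : X -> R) x : Prop := exists c (V : set X),
  [/\ charts S c, mopen S V, V x, V `<=` dom c & smooth_in c V f].

Lemma smooth_at_chart S c f x : smooth_at S f x -> charts S c -> dom c x ->
  exists V : set X, [/\ mopen S V, V x, V `<=` dom c & smooth_in c V f].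
Proof.
move=> [d [V [Sd oV Vx Vd fV]]] Sc cx.
have [W [[Wx Wc Wd ocW odW] [cd dc]]] := charts_compatible_at Sc Sd cx (Vd _ Vx).
have oWV : mopen S (W `&` V) by apply: mopenI => //; exact: mopen_in_chart Sc Wc ocW.
have WVc : W `&` V `<=` dom c by move=> y [/Wc].
exists (W `&` V); split=> //.
have WVV : W `&` V `<=` V by move=> y [].
apply: (Csmooth_comp_in WVc WVV Vd (mopen_image Sc oWV WVc) (mopen_image Sd oV Vd) _ fV).
by move=> a; apply: smooth_in_sub (cd a) => y [].
Qed.

Lemma smooth_local S (U : set X) f :
  (forall x, U x -> smooth_at S f x) -> smooth S U f.
Proof.
move=> H c Sc; apply: smooth_in_local; first exact: charts_chart Sc.
move=> x /H fx cx; have [V [oV Vx Vc fV]] := smooth_at_chart fx Sc cx.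
by exists V; split=> //; exact: mopen_image oV Vc.
Qed.

Lemma smooth_smooth_at S (U : set X) f x :
  mopen S U -> smooth S U f -> U x -> smooth_at S f x.
Proof.
move=> oU fU Ux; have [c Sc cx] := charts_cover S x; exists c, (U `&` dom c).
split=> //; first by apply: mopenI => //; exact: mopen_dom.
by apply: smooth_in_sub (fU c Sc).
Qed.

Lemma smooth_sub S (U V : set X) f : V `<=` U -> smooth S U f -> smooth S V f.
Proof. by move=> VU fU c /fU; exact: smooth_in_sub. Qed.

Lemma smooth_ext S (U : set X) f g :
  (forall x, U x -> f x = g x) -> smooth S U f -> smooth S U g.
Proof.
move=> fg fU c /fU[h hU fh]; exists h => // x Ux cx.
by rewrite -fg// fh.
Qed.

Lemma smooth_op1 S (U : set X) (op : R -> R) (P : set R) f :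
  (forall (V : set 'rV[R]_n) g, open V -> (forall v, V v -> P (g v)) -> Csmooth V g ->
    Csmooth V (fun v => op (g v))) ->
  mopen S U -> (forall x, U x -> P (f x)) -> smooth S U f ->
  smooth S U (fun x => op (f x)).
Proof.
move=> opP oU PU fU c Sc; have [g gU fg] := fU c Sc.
exists (fun v => op (g v)); last by move=> x Ux cx; rewrite fg.
apply: opP => //; first exact: (mopenE S U).1.
by move=> _ [x [Ux cx] <-]; rewrite -fg//; exact: PU.
Qed.

Lemma smoothV S (U : set X) f : mopen S U -> (forall x, U x -> f x != 0) ->
  smooth S U f -> smooth S U (fun x => (f x)^-1).
Proof.
by move=> oU f0; apply: (@smooth_op1 S U _ [set r | r != 0]) => // V g oV g0; exact: CsmoothV.
Qed.

Lemma smooth_flat S (U : set X) p f : mopen S U -> smooth S U f ->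
  smooth S U (fun x => flat p (f x)).
Proof.
by move=> oU; apply: (@smooth_op1 S U _ setT) => // V g oV _; exact: Csmooth_flat.
Qed.

Lemma smoothD S (U : set X) f g : mopen S U -> smooth S U f -> smooth S U g ->
  smooth S U (f + g).
Proof.
move=> oU fU gU c Sc; have [f' fU' ff] := fU c Sc; have [g' gU' gg] := gU c Sc.
exists (f' + g'); first by apply: CsmoothD => //; exact: (mopenE S U).1.
by move=> x Ux cx; rewrite !fctE ff// gg.
Qed.

Lemma smoothM S (U : set X) f g : mopen S U -> smooth S U f -> smooth S U g ->
  smooth S U (f * g).
Proof.
move=> oU fU gU c Sc; have [f' fU' ff] := fU c Sc; have [g' gU' gg] := gU c Sc.
exists (f' * g'); first by apply: CsmoothM => //; exact: (mopenE S U).1.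
by move=> x Ux cx; rewrite !fctE ff// gg.
Qed.

Lemma smooth_sum S (U : set X) (I : Type) (r : seq I) (P : pred I) (F : I -> X -> R) :
  mopen S U -> (forall i, P i -> smooth S U (F i)) ->
  smooth S U (\sum_(i <- r | P i) F i).
Proof.
move=> oU FP; elim/big_ind: _ => //; first exact: smooth_cst.
by move=> *; exact: smoothD.
Qed.

Lemma smooth_prod S (U : set X) (I : Type) (r : seq I) (P : pred I) (F : I -> X -> R) :
  mopen S U -> (forall i, P i -> smooth S U (F i)) ->
  smooth S U (\prod_(i <- r | P i) F i).
Proof.
move=> oU FP; elim/big_ind: _ => //; first exact: smooth_cst.
by move=> *; exact: smoothM.
Qed.

Lemma smooth_coord S c a : charts S c -> smooth S (dom c) (fun x => c x 0 a).
Proof.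
move=> Sc; apply: smooth_local => x cx; exists c, (dom c); split=> //.
  exact: mopen_dom.
by exists (fun v => v 0 a) => //; exact: Csmooth_coord.
Qed.

Lemma smooth_preimage_open S (U : set X) f (O : set R) :
  mopen S U -> smooth S U f -> open O -> mopen S (U `&` f @^-1` O).
Proof.
move=> oU fU oO; apply/mopenE => c Sc; have [g gU fg] := fU c Sc.
have oc : open (c @` (U `&` dom c)) by exact: (mopenE S U).1.
rewrite (_ : _ @` _ = c @` (U `&` dom c) `&` g @^-1` O).
  by apply: open_preimage_on => // v cv; exact: Csmooth_continuous gU cv.
apply/seteqP; split=> [_ [x [[Ux fx] cx] <-]|_ [[x [Ux cx] <-] gx]].
  by split; [exists x|rewrite /= -fg].
by exists x => //; split=> //; split=> //=; rewrite fg.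
Qed.

Lemma smooth_neq0_open S (U : set X) f :
  mopen S U -> smooth S U f -> mopen S (U `&` [set x | f x != 0]).
Proof.
by move=> oU fU; exact: (smooth_preimage_open oU fU (@open_neq R 0)).
Qed.

Lemma hausdorff_smooth_separation S :
  (forall x y, x <> y -> exists2 f, smooth S setT f & f x <> f y) ->
  hausdorff_space (mtop S).
Proof.
move=> H; rewrite open_hausdorff => x y /eqP/H[f fS /eqP fxy].
have := @Rhausdorff R; rewrite open_hausdorff => /(_ _ _ fxy).
move=> [[A B] [/= fA fB] [oA oB /eqP AB]].
exists (f @^-1` A, f @^-1` B) => /=; first by rewrite !inE in fA fB *.
have pre O : open O -> open (f @^-1` O : set (mtop S)).
  by move=> oO; have := smooth_preimage_open (@openT (mtop S)) fS oO; rewrite setTI.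
split; [exact: pre|exact: pre|]; apply/eqP.
by rewrite -preimage_setI AB preimage_set0.
Qed.

Definition rat_box (q : 'rV[rat]_n * 'rV[rat]_n) : set 'rV[R]_n :=
  [set v | forall a, ratr (q.1 0 a) < v 0 a < ratr (q.2 0 a)].

Lemma rat_box_open q : open (rat_box q).
Proof.
rewrite openE => v vq; rewrite /interior; near=> u => a; apply/andP; split.
  move: a; near: u; apply: filter_forall => a.
  have : nbhs (v 0 a) [set r : R | ratr (q.1 0 a) < r].
    by apply: open_nbhs_nbhs; split; [exact: open_gt|have /andP[] := vq a].
  exact: coord_row_continuous.
move: a; near: u; apply: filter_forall => a.
have : nbhs (v 0 a) [set r : R | r < ratr (q.2 0 a)].
  by apply: open_nbhs_nbhs; split; [exact: open_lt|have /andP[] := vq a].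
exact: coord_row_continuous.
Unshelve. all: by end_near. Qed.

Lemma rat_box_basis (O : set 'rV[R]_n) v : open O -> O v ->
  exists q, rat_box q v /\ rat_box q `<=` O.
Proof.
move=> oO Ov; have : nbhs v O by exact: open_nbhs_nbhs.
move=> /nbhs_ballP[e /= e0 eO].
have /choice[l lP] : forall a, exists l : rat, v 0 a - e < ratr l < v 0 a.
  move=> a; have [l] := @rat_in_itvoo R (v 0 a - e) (v 0 a) (ltac:(by rewrite ltrBlDr ltrDl)).
  by rewrite in_itv /=; exists l.
have /choice[k kP] : forall a, exists k : rat, v 0 a < ratr k < v 0 a + e.
  move=> a; have [b] := @rat_in_itvoo R (v 0 a) (v 0 a + e) (ltac:(by rewrite ltrDl)).
  by rewrite in_itv /=; exists b.
exists (\row_a l a, \row_a k a); split=> [a|u uq].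
  by rewrite !mxE /=; have /andP[_ ->] := lP a; have /andP[-> _] := kP a.
apply: eO; apply/row_ball; apply: row_norm_lt => // a; rewrite !mxE.
have := uq a; rewrite !mxE /= => /andP[la ka].
have /andP[l1 _] := lP a; have /andP[_ k1] := kP a.
by rewrite distrC ltr_norml; apply/andP; split; move: la ka l1 k1;
  move: (ratr (l a)) (ratr (k a)) => x y; lra.
Qed.

(** The rational boxes in the countably many charts [e k] form a base. *)
Lemma second_countable_charts S (e : nat -> option (pchart R X n)) :
  (forall k c, e k = Some c -> charts S c) ->
  (forall x, exists k c, e k = Some c /\ dom c x) -> @second_countable (mtop S).
Proof.
move=> eS ecov.
pose D (i : nat * ('rV[rat]_n * 'rV[rat]_n)) : set (mtop S) :=
  if e i.1 is Some c then dom c `&` c @^-1` rat_box i.2 else set0.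
have Do i : open (D i).
  rewrite /D; case E : (e i.1) => [c|]; last exact: open0.
  have Sc := eS _ _ E; have [cI co] := charts_chart Sc.
  apply: (mopen_in_chart Sc) => [x []//|].
  rewrite (_ : _ @` _ = c @` dom c `&` rat_box i.2).
    by apply: openI => //; exact: rat_box_open.
  apply/seteqP; split=> [_ [x [cx qx] <-]|_ [[x cx <-] qx]].
    by split=> //; exists x.
  by exists x.
exists (range D).
  by apply: (card_le_trans (card_image_le _ _)); exact: countableP.
split=> [_ [i _ <-]|x A]; first exact: Do.
rewrite nbhsE => -[B [oB Bx] BA].
have [k [c [ek cx]]] := ecov x; have Sc := eS _ _ ek; have [cI _] := charts_chart Sc.
have oBc : open (c @` (B `&` dom c)) by exact: (mopenE S B).1.
have [|q [qx qB]] := rat_box_basis oBc (v := c x); first by exists x.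
exists (D (k, q)) => /=.
  by split; [exists (k, q)|rewrite /D /= ek; split].
move=> y; rewrite /D /= ek => -[cy /qB[z [Bz cz] zy]].
by apply: BA; rewrite -(cI z y).
Qed.

End SmoothStructures.

Section SmoothMaps.
Context (R : realType) (X Y : Type) (n m : nat).
Context (S : smooth_structure R X n) (S' : smooth_structure R Y m).

Lemma smooth_map_open (q : X -> Y) (U : set Y) :
  smooth_map (charts S) (charts S') id q -> mopen S' U -> mopen S (q @^-1` U).
Proof.
move=> sq oU; apply: mopen_local => x /= Uqx.
have [c [d [V [G [[Sc Sd Vc oV Vx] [GV Gq]]]]]] := sq x.
pose G' v : 'rV[R]_m := \row_a G a v.
have G'q y : V y -> d (q y) = G' (c y).
  by move=> Vy; apply/rowP => a; rewrite mxE; exact: (Gq y Vy).2.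
have G'V a : Csmooth (c @` V) (fun v => G' v 0 a).
  by rewrite (_ : (fun v => _) = G a)//; apply/funext => v; rewrite mxE.
have odU : open (d @` (U `&` dom d)) by exact: (mopenE S' U).1.
exists c, (V `&` q @^-1` U); split; [exact: Sc|by split|by move=> y [_]|by move=> y [/Vc]|].
rewrite (_ : _ @` _ = c @` V `&` G' @^-1` (d @` (U `&` dom d))).
  by apply: open_preimage_on => // v Vv; exact: Csmooth_row_continuous G'V Vv.
have [dI _] := charts_chart Sd.
apply/seteqP; split=> [_ [y [Vy Uy] <-]|_ [[y Vy <-] [z [Uz dz] E]]].
  split; first by exists y.
  by exists (q y); [split=> //; exact: (Gq y Vy).1|rewrite G'q].
exists y => //; split=> //=; rewrite -(dI _ _ dz (Gq y Vy).1)//.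
by rewrite E G'q.
Qed.

Lemma smooth_map_smooth (q : X -> Y) (U : set Y) f :
  smooth_map (charts S) (charts S') id q -> mopen S' U -> smooth S' U f ->
  smooth S (q @^-1` U) (f \o q).
Proof.
move=> sq oU fU; apply: smooth_local => x /= Uqx.
have oqU := smooth_map_open sq oU.
have [c [d [V [G [[Sc Sd Vc oV Vx] [GV Gq]]]]]] := sq x.
exists c, (V `&` q @^-1` U); split=> //.
- by apply: mopenI => //; exact: mopen_in_chart Sc Vc oV.
- by move=> y [/Vc].
have [g gU fg] := fU d Sd.
have oVU : open (c @` (V `&` q @^-1` U)).
  apply: (mopen_image Sc); last by move=> y [/Vc].
  by apply: mopenI => //; exact: mopen_in_chart Sc Vc oV.
apply/smooth_in_subP; first by move=> y [/Vc].
have Gd y : V y -> (\row_a G a (c y) : 'rV[R]_m) = d (q y).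
  by move=> Vy; apply/rowP => a; rewrite mxE (Gq y Vy).2.
exists (g \o (fun v => \row_a G a v)).
  apply: (Csmooth_comp oVU ((mopenE S' U).1 oU d Sd)) => //.
    move=> _ [y [Vy Uy] <-]; exists (q y); last by rewrite Gd.
    by split=> //; exact: (Gq y Vy).1.
  move=> a; rewrite (_ : (fun v => _) = G a).
    by apply: Csmooth_sub (GV a); apply: image_subset => y [].
  by apply/funext => v; rewrite mxE.
by move=> y [Vy Uy]; rewrite /= Gd// fg//; exact: (Gq y Vy).1.
Qed.

End SmoothMaps.

Lemma charts_pullback (R : realType) (X : Type) (n : nat)
    (S : smooth_structure R X n) (F G : X -> X) (c : pchart R X n) :
  smooth_map (charts S) (charts S) id F -> smooth_map (charts S) (charts S) id G ->
  cancel F G -> cancel G F -> charts S c ->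
  charts S (PChart (F @^-1` dom c) (c \o F)).
Proof.
move=> sF sG FK GK Sc; have [cI co] := charts_chart Sc.
have oFc : mopen S (F @^-1` dom c) by apply: smooth_map_open sF _; exact: mopen_dom.
set cF := PChart _ _.
have cFch : is_chart cF.
  split=> /= [x y cx cy /(cI _ _ cx cy)/(can_inj FK)//|].
  rewrite (_ : _ @` _ = c @` dom c)//; apply/seteqP; split=> [_ [x cx <-]|_ [x cx <-]].
    by exists (F x).
  by exists (G x); rewrite /= GK.
apply: charts_mem => // x /= cFx; have [d Sd dx] := charts_cover S x.
exists d; split=> //; exists (F @^-1` dom c `&` dom d).
have oV : mopen S (F @^-1` dom c `&` dom d) by apply: mopenI => //; exact: mopen_dom.
have oW : mopen S (dom c `&` G @^-1` dom d).
  by apply: mopenI; [exact: mopen_dom|apply: smooth_map_open sG _; exact: mopen_dom].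
have VE : cF @` (F @^-1` dom c `&` dom d) = c @` (dom c `&` G @^-1` dom d).
  apply/seteqP; split=> [_ [y [cy dy] <-]|_ [y [cy dy] <-]].
    by exists (F y) => //; split=> //=; rewrite FK.
  by exists (G y); rewrite /= GK.
split; first split=> //.
- by rewrite VE; apply: (mopen_image Sc oW) => y [].
- by apply: (mopen_image Sd oV) => y [].
split=> a.
  have dG : smooth S (G @^-1` dom d) ((fun y => d y 0 a) \o G).
    by apply: smooth_map_smooth => //; [exact: mopen_dom|exact: smooth_coord].
  have [g gW Eg] := smooth_sub (V := dom c `&` G @^-1` dom d) (fun y => @proj2 _ _) dG Sc.
  apply/smooth_in_subP; first by move=> y [].
  exists g; first by apply: Csmooth_sub gW; rewrite VE; apply: image_subset => y [].
  by move=> y [cy dy]; have := Eg (F y); rewrite /= FK; apply.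
have cFs : smooth S (F @^-1` dom c) ((fun y => c y 0 a) \o F).
  by apply: smooth_map_smooth => //; [exact: mopen_dom|exact: smooth_coord].
by apply: smooth_in_sub (cFs d Sd) => y [].
Qed.

(** * Bump functions *)

Section Bump.
Context (R : realType) (X : Type) (n : nat) (S : manifold R X n).

(** The sup norm is not smooth, so a one-variable cutoff N / (N + M) is applied to the square of
    each coordinate and the results are multiplied; [N] and [M] are never both 0. *)
Lemma bump_row (v0 : 'rV[R]_n) (d : R) : 0 < d ->
  exists b : 'rV[R]_n -> R, [/\ Csmooth setT b,
    forall v, `|v0 - v| < d -> b v = 1 &
    forall v, ~ (`|v0 - v| <= 2 * d) -> b v = 0].
Proof.
move=> d0.
pose p (a : 'I_n) (v : 'rV[R]_n) : R := (v 0 a - v0 0 a) ^+ 2.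
pose N a v := flat 1 (4 * d ^+ 2 - p a v); pose M a v := flat 1 (p a v - d ^+ 2).
have ps a : Csmooth setT (p a).
  rewrite (_ : p a = ((fun v : 'rV[R]_n => v 0 a) + cst (- v0 0 a)) ^+ 2).
    apply: CsmoothX openT _; apply: CsmoothD openT _ _; first exact: Csmooth_coord.
    exact: Csmooth_cst.
  by apply/funext => v.
have Ns a : Csmooth setT (N a).
  apply: Csmooth_flat openT _; rewrite (_ : (fun v => _) = cst (4 * d ^+ 2) + cst (-1) * p a).
    apply: CsmoothD openT _ _; first exact: Csmooth_cst.
    by apply: CsmoothM openT _ _; first exact: Csmooth_cst.
  by apply/funext => v; rewrite !fctE mulN1r.
have Ms a : Csmooth setT (M a).
  apply: Csmooth_flat openT _; rewrite (_ : (fun v => _) = p a + cst (- d ^+ 2))//.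
  by apply: CsmoothD openT _ _ => //; exact: Csmooth_cst.
have NM a v : 0 < N a v + M a v.
  have [H|H] := ltP (p a v) (4 * d ^+ 2).
    by rewrite ltr_pwDl ?flat1_ge0// flat1_gt0 subr_gt0.
  rewrite ltr_pwDr ?flat1_ge0// flat1_gt0 subr_gt0; apply: lt_le_trans H.
  by have := exprn_gt0 2 d0; lra.
exists (\prod_a (N a * (fun v => (N a v + M a v)^-1))); split.
- apply: Csmooth_prod openT _ => a _; apply: CsmoothM openT _ _ => //.
  apply: CsmoothV openT _ _; first by move=> v _; rewrite gt_eqF.
  by apply: CsmoothD openT _ _.
- move=> v vd; rewrite fct_prodE big1// => a _; rewrite fctE.
  have M0 : M a v = 0.
    apply: flat_le0; rewrite subr_le0 /p -real_normK ?num_real//.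
    rewrite lerXn2r ?nnegrE// ?ltW//; apply: le_lt_trans vd.
    by have := row_coord_le (v0 - v) a; rewrite !mxE distrC.
  by rewrite M0 addr0 divff// gt_eqF//; have := NM a v; rewrite M0 addr0.
- move=> v vd; have [a va] : exists a, 2 * d < `|v0 0 a - v 0 a|.
    apply: contra_notP vd => H; apply: row_norm_le; first by rewrite mulr_ge0// ltW.
    by move=> a; rewrite leNgt; apply/negP => va; apply: H; exists a; move: va; rewrite !mxE.
  rewrite fct_prodE (bigD1 a)//= fctE.
  have -> : N a v = 0; last by rewrite !mul0r.
  apply: flat_le0; rewrite subr_le0 /p -[leRHS]real_normK ?num_real// distrC.
  have : (2 * d) ^+ 2 <= `|v0 0 a - v 0 a| ^+ 2.
    by rewrite lerXn2r ?nnegrE ?mulr_ge0 ?(ltW d0) ?(ltW va).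
  by rewrite exprMn; lra.
Qed.

(** The open set [Z] encodes that the support lies in [U], in the form in which extension by zero is
    checked locally. That [Z] is open uses the Hausdorff property: the support is contained in the
    image of a compact box, which is closed in all of [X]. *)
Lemma smooth_bump (U : set X) x : mopen S U -> U x -> exists psi : X -> R,
  smooth S setT psi /\
  (exists V : set X, [/\ mopen S V, V x, V `<=` U & forall y, V y -> psi y = 1]) /\
  (exists Z : set X, [/\ mopen S Z, forall y, U y \/ Z y & forall y, Z y -> psi y = 0]).
Proof.
move=> oU Ux; have [c Sc cx] := charts_cover S x; have cch := charts_chart Sc.
pose W := U `&` dom c.
have oW : mopen S W by apply: mopenI => //; exact: mopen_dom.
have Wc : W `<=` dom c by move=> y [].
have ocW := mopen_image Sc oW Wc.
have : nbhs (c x) (c @` W) by apply: open_nbhs_nbhs; split=> //; exists x.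
move=> /nbhs_ballP[e /= e0 eW]; pose d := e / 3; have d0 : 0 < d by rewrite divr_gt0.
have [b [bs b1 b0]] := bump_row (c x) d0.
pose K := [set v : 'rV[R]_n | `|c x - v| <= 2 * d].
have KW : K `<=` c @` W.
  by move=> v Kv; apply: eW; apply/row_ball; apply: le_lt_trans Kv _; rewrite /d; lra.
pose g (v : 'rV[R]_n) : mtop S := xget (x : mtop S) [set y : mtop S | W y /\ c y = v].
have gK y : W y -> g (c y) = y.
  move=> Wy; rewrite /g; case: xgetP => [z _ [Wz E]|/(_ y)[]//].
  by apply: cch.1 E; exact: Wc.
have gc : {within K, continuous g}.
  apply: continuous_in_subspaceT => v; rewrite inE => /KW[y Wy <-].
  move=> B; rewrite gK// nbhsE => -[B' [oB' B'y] B'B].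
  have oWB : mopen S (W `&` B') by apply: mopenI.
  have ocWB : open (c @` (W `&` B')) by apply: (mopen_image Sc) => // z [/Wc].
  have : nbhs (c y) (c @` (W `&` B')).
    by apply: open_nbhs_nbhs; split=> //; exists y.
  apply: filterS => _ [z [Wz B'z] <-]; rewrite /= gK//; exact: B'B.
have gKc : closed (g @` K).
  apply: compact_closed; first exact: mfd_hausdorff.
  apply: continuous_compact => //; apply: closed_box_compact.
  by rewrite mulr_ge0// ltW.
pose Z : set X := ~` (g @` K).
have oZ : mopen S Z by exact: closed_openC.
have gKW : g @` K `<=` W by move=> _ [v /KW[y Wy <-] <-]; rewrite gK.
pose psi y := if `[< W y >] then b (c y) else 0.
have psiW y : W y -> psi y = b (c y) by move=> Wy; rewrite /psi asboolT.
have psiZ y : Z y -> psi y = 0.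
  move=> Zy; rewrite /psi; case: asboolP => // Wy; apply: b0 => Ky; apply: Zy.
  by exists (c y) => //; exact: gK.
exists psi; split; [|split].
- apply: smooth_local => y _; have [Wy|Wy] := pselect (W y).
    exists c, W; split=> //; apply/smooth_in_subP => //; exists b => //.
    exact: Csmooth_sub bs.
  have [e' Se' ey] := charts_cover S y; exists e', (Z `&` dom e').
  have oZe : mopen S (Z `&` dom e') by apply: mopenI => //; exact: mopen_dom.
  split; [exact: Se'|exact: oZe|by split=> // /gKW|by move=> z []|].
  apply/smooth_in_subP; first by move=> z [].
  by exists (cst 0); [exact: Csmooth_cst|move=> z [/psiZ]].
- have oB : open (c @` W `&` ball (c x) d) by apply: openI => //; exact: ball_open.
  exists (W `&` [set y | `|c x - c y| < d]); split.
  + apply: (mopen_in_chart Sc); first by move=> y [/Wc].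
    rewrite (_ : _ @` _ = c @` W `&` ball (c x) d)//; apply/seteqP; split.
      by move=> _ [y [Wy yd] <-]; split; [exists y|exact/row_ball].
    by move=> _ [[y Wy <-] /row_ball yd]; exists y.
  + by split=> //=; rewrite subrr normr0.
  + by move=> y [[]].
  + by move=> y [Wy yd]; rewrite psiW// b1.
- exists Z; split=> // y; have [Uy|Uy] := pselect (U y); [by left|right].
  by move=> /gKW[].
Qed.

End Bump.

(** * Locally finite families and sums *)

Section LocallyFinite.
Context (R : realType) (X : Type) (n : nat) (S : smooth_structure R X n).

Lemma lindelof (U : set X) (P : X -> set X) :
  @second_countable (mtop S) ->
  (forall x, U x -> mopen S (P x) /\ P x x) ->
  exists e : nat -> option X, (forall k x, e k = Some x -> U x) /\
    forall x, U x -> exists k y, e k = Some y /\ P y x.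
Proof.
move=> [B /countable_injP[f fI] [Bo Bb]] HP.
pose Q k y := exists2 b : set X, B b & [/\ f b = k, U y & b `<=` P y].
exists (fun k => if pselect (exists y, Q k y) is left H then Some (proj1_sig (cid H)) else None).
split=> [k x|x Ux].
  case: pselect => // H [<-]; by case: (cid H) => y /= [b ? []].
have [oPx Pxx] := HP x Ux.
have [b [[Bb' bx] bP]] : exists b : set X, (B b /\ b x) /\ b `<=` P x.
  have : nbhs (x : mtop S) (P x : set (mtop S)) by apply: open_nbhs_nbhs.
  by move=> /Bb [b [Bb' bx] bP]; exists b.
exists (f b); case: pselect => [H|[]]; last by exists x, b.
exists (proj1_sig (cid H)); split=> //; case: (cid H) => y [b' Bb'' [fb Uy b'P]] /=.
by apply: b'P; rewrite (_ : b' = b)//; apply: (fI _ _ _ _ fb); rewrite inE.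
Qed.

Definition locally_finite (U : set X) (h : nat -> X -> R) : Prop :=
  forall x, U x -> exists V : set X, [/\ mopen S V, V x, V `<=` U &
    exists K, forall k y, (K <= k)%N -> V y -> h k y = 0].

(* {h_k > 0} is contained in {f_k > 0, f_j < 1/(k+1) for j < k}. *)
Lemma locally_finite_refinement (U : set X) (f : nat -> X -> R) :
  mopen S U -> (forall k, smooth S U (f k)) ->
  (forall k x, U x -> 0 <= f k x) -> (forall x, U x -> exists k, 0 < f k x) ->
  exists q : nat -> X -> R, [/\ forall k, smooth S U (q k),
    forall k x, 0 <= q k x <= 1,
    forall x, U x -> exists k, 0 < f k x * q k x &
    locally_finite U (fun k => f k * q k)].
Proof.
move=> oU fs f0 fpos.
pose q k := \prod_(j < k) (fun x => flat 1 (k.+1%:R^-1 - f j x)).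
exists q; split.
- move=> k; apply: smooth_prod => // j _; apply: smooth_flat => //.
  rewrite (_ : (fun x => _) = cst k.+1%:R^-1 + cst (-1) * f j).
    by apply: smoothD => //; [exact: smooth_cst|apply: smoothM => //; exact: smooth_cst].
  by apply/funext => x; rewrite !fctE mulN1r.
- move=> k x; rewrite /q fct_prodE; elim/big_ind: _ => [|a b /andP[a0 a1] /andP[b0 b1]|j _].
  + by rewrite ler01 lexx.
  + by rewrite mulr_ge0//= mulr_ile1.
  + by rewrite flat1_ge0 flat1_le1.
(* At the first index with [f k x > 0] all earlier functions vanish, so every factor of [q k] is
   positive. *)
- move=> x Ux; have /ex_minnP[k fk kmin] : exists k, 0 < f k x by exact: fpos.
  exists k; rewrite mulr_gt0// /q fct_prodE prodr_gt0// => j _.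
  rewrite flat1_gt0 subr_gt0 (_ : f j x = 0) ?invr_gt0//.
  apply/eqP; rewrite eq_le f0// andbT leNgt; apply/negP => /kmin.
  by rewrite leqNgt ltn_ord.
- move=> x Ux; have [j fj] := fpos x Ux.
  pose d := f j x / 2; have d0 : 0 < d by rewrite divr_gt0.
  pose V := U `&` [set y | flat 1 (f j y - d) != 0].
  exists V; split.
  + apply: smooth_neq0_open => //; apply: smooth_flat => //.
    by apply: (@smoothD _ _ _ _ _ (f j) (cst (- d))) => //; exact: smooth_cst.
  + split=> //=; rewrite gt_eqF// flat1_gt0 subr_gt0.
    by rewrite /d ltr_pdivrMr// ltr_pMr// ltr1n.
  + by move=> y [].
  (* On [V] one has [f j > d]; for [k > j] with 1/(k+1) <= d the j-th factor of [q k] is therefore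
     0. *)
  exists (maxn j.+1 (Num.truncn d^-1).+1) => k y; rewrite geq_max => /andP[jk dk] [Uy].
  move=> /eqP fy; rewrite fctE /q fct_prodE (bigD1 (Ordinal jk))//=.
  rewrite (@flat_le0 _ _ (_ - f j y)) ?mul0r ?mulr0//.
  have df : d < f j y.
    rewrite ltNge; apply/negP => fd; apply: fy; apply: flat_le0.
    by rewrite subr_le0.
  have : k.+1%:R^-1 <= d; last first.
    by move=> kd; rewrite subr_le0; exact: le_trans kd (ltW df).
  rewrite -[leRHS]invrK lef_pV2 ?posrE ?invr_gt0//.
  apply: (@le_trans _ _ (Num.truncn d^-1).+1%:R); last by rewrite ler_nat leqW.
  by apply: ltW; apply: truncnS_gt.
Qed.

(** Any two indices beyond which all terms vanish at [x] give the same partial sum, so the pointwise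
    choice of one is harmless. *)
Lemma locally_finite_sum (U : set X) (h : nat -> X -> R) : locally_finite U h ->
  exists H : X -> R, forall x K, U x -> (forall k, (K <= k)%N -> h k x = 0) ->
    H x = \sum_(k < K) h k x.
Proof.
move=> lf; pose P x := [set K | forall k, (K <= k)%N -> h k x = 0].
exists (fun x => \sum_(k < xget 0%N (P x)) h k x) => x K Ux hK.
have cut L M : (L <= M)%N -> P x L -> \sum_(k < M) h k x = \sum_(k < L) h k x.
  move=> LM hL; rewrite -(subnKC LM) big_split_ord /= [X in _ + X]big1 ?addr0//.
  by move=> i _; apply: hL; rewrite leq_addr.
case: xgetP => [L _ PL|/(_ K)//].
have [LK|KL] := leqP L K; first by rewrite (cut L K).
by rewrite (cut K L)// ltnW.
Qed.

End LocallyFinite.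

(** * The associated graded algebra and its characters *)

Section GradedAlgebra.
Context (R : realType) (T : Type).
Implicit Types (F : filtration R T) (f g : T -> R).

Lemma gr_classE F k f (Ff : fil F k f) : gr_class F k f = gr_pi (Rees (unit_seqP Ff)).
Proof.
rewrite /gr_class; congr gr_pi; apply: val_inj.
by rewrite val_insubd (unit_seqP Ff).
Qed.

Lemma gr_classD F k f g : fil F k f -> fil F k g ->
  gr_class F k (f + g) = gr_class F k f + gr_class F k g.
Proof.
move=> Ff Fg; rewrite (gr_classE (fil_D Ff Fg)) (gr_classE Ff) (gr_classE Fg) -gr_piD.
congr gr_pi; apply: rees_ext => i; rewrite reesD /= /unit_seq.
by case: eqP => //; rewrite addr0.
Qed.

Lemma gr_classZ F k (a : R) f : fil F k f ->
  gr_class F k (a *: f) = a *: gr_class F k f.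
Proof.
move=> Ff; rewrite (gr_classE (fil_Z a Ff)) (gr_classE Ff) -gr_piZ.
congr gr_pi; apply: rees_ext => i; rewrite /= /unit_seq.
change ((if i == k then a *: f else 0) = a *: (if i == k then f else 0)).
by case: eqP => //; rewrite scaler0.
Qed.

Lemma gr_classM F i j f g : fil F i f -> fil F j g ->
  gr_class F (i + j) (f * g) = gr_class F i f * gr_class F j g.
Proof.
move=> Ff Fg; rewrite (gr_classE (fil_M Ff Fg)) (gr_classE Ff) (gr_classE Fg) -gr_piM.
congr gr_pi; apply: rees_ext => k.
change (unit_seq (i + j) (f * g) k = Defs.conv (unit_seq i f) (unit_seq j g) k).
rewrite /Defs.conv /unit_seq; have [->|kij] := eqVneq k (i + j)%N.
  have ij : (i < (i + j).+1)%N by rewrite ltnS leq_addr.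
  rewrite (bigD1 (Ordinal ij))//= eqxx addKn eqxx big1 ?addr0// => l li.
  by rewrite ifF ?mul0r//; apply: contraNF li => /eqP li; apply/eqP/val_inj.
rewrite big1// => l _; case: eqP => [li|_]; last by rewrite mul0r.
case: eqP => [lj|_]; last by rewrite mulr0.
by move: kij; rewrite -li -lj subnKC ?eqxx// -ltnS.
Qed.

Lemma gr_class1 F : gr_class F 0 1 = 1.
Proof. by rewrite (gr_classE (fil_1 F)); congr gr_pi; exact: rees_ext. Qed.

Lemma gr_class_eq0 F k f : fil F k.+1 f -> gr_class F k f = 0.
Proof.
move=> Ff; have F0 := fil_0 F k; have Fk := fil_S Ff.
have E : gr_class F k f = gr_class F k 0 by apply/(gr_class_eq Fk F0); rewrite subr0.
by rewrite E -[X in gr_class F k X](scale0r (0 : T -> R)) gr_classZ// scale0r.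
Qed.

Lemma gr_pi0 F : gr_pi (0 : rees F) = 0.
Proof. by rewrite -(subrr (0 : rees F)) gr_piB subrr. Qed.

Lemma gr_decomp F (u : gr F) : exists m (f : nat -> T -> R),
  (forall i, fil F i (f i)) /\ u = \sum_(i < m) gr_class F i (f i).
Proof.
rewrite -[u]gr_reprK; set p := repr u.
have [m pm] : exists m, forall i, (m <= i)%N -> p i = 0.
  by case: (p) => q /= /asboolP[].
exists m, p; split=> [i|]; first exact: reesF.
have -> : \sum_(i < m) gr_class F i (p i) =
    gr_pi (\sum_(i < m) Rees (unit_seqP (reesF p i))).
  rewrite (big_morph (@gr_pi R T F) (@gr_piD R T F) (gr_pi0 F)).
  by apply: eq_bigr => i _; rewrite (gr_classE (reesF p i)).
congr gr_pi; apply: rees_ext => i.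
have -> : (\sum_(j < m) Rees (unit_seqP (reesF p j))) i = \sum_(j < m) unit_seq j (p j) i.
  exact: (big_morph (fun q : rees F => q i) (fun q q' => reesD q q' i) (erefl : (0 : rees F) i = 0)).
have [im|mi] := ltnP i m.
  rewrite (bigD1 (Ordinal im))//= /unit_seq eqxx big1 ?addr0// => j ji.
  by rewrite ifF//; apply: contraNF ji => /eqP ij; apply/eqP/val_inj.
rewrite pm// big1// => j _; rewrite /unit_seq ifF//.
by apply/eqP => ij; move: (ltn_ord j); rewrite -ij ltnNge mi.
Qed.

Lemma hom_alg_fun_inj F (u v : hom_alg F) : (forall a, u a = v a) -> u = v.
Proof.
case: u v => [[f cf] sf] [[g cg] sg] /= fg.
have E : f = g by apply/funext.
case: g / E cg sg fg => cg sg _.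
have E : cf = cg.
  case: cf cg {sf sg} => [[a] [b]] [[a'] [b']].
  by rewrite (Prop_irrelevance a a') (Prop_irrelevance b b').
by case: cg / E sg => sg; rewrite (Prop_irrelevance sf sg).
Qed.

Lemma hom_alg_ext F (u v : hom_alg F) :
  (forall i f, fil F i f -> u (gr_class F i f) = v (gr_class F i f)) -> u = v.
Proof.
move=> uv; apply: hom_alg_fun_inj => a; have [m [f [Ff ->]]] := gr_decomp a.
by rewrite !rmorph_sum; apply: eq_bigr => i _; exact: uv.
Qed.

Record gr_functional F (phi : nat -> (T -> R) -> R) : Prop := GrFunctional {
  gf_D : forall i f g, fil F i f -> fil F i g -> phi i (f + g) = phi i f + phi i g ;
  gf_Z : forall i (a : R) f, fil F i f -> phi i (a *: f) = a * phi i f ;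
  gf_M : forall i j f g, fil F i f -> fil F j g ->
    phi (i + j)%N (f * g) = phi i f * phi j g ;
  gf_1 : phi 0%N 1 = 1 ;
  gf_S : forall i f, fil F i.+1 f -> phi i f = 0 }.

Section OfFunctional.
Context F (phi : nat -> (T -> R) -> R) (phiF : gr_functional F phi).

Let phi0 i : phi i 0 = 0.
Proof. by rewrite (gf_S phiF)//; exact: fil_0. Qed.

Let gf_sum i m (f : 'I_m -> T -> R) : (forall j, fil F i (f j)) ->
  phi i (\sum_(j < m) f j) = \sum_(j < m) phi i (f j).
Proof.
elim: m f => [|m IHm] f Ff; first by rewrite !big_ord0 phi0.
rewrite !big_ord_recr /= (gf_D phiF) ?IHm//; exact: fil_sum.
Qed.

Lemma rees_poly_subproof (p : rees F) :
  exists q : {poly R}, forall i, q`_i = phi i (p i).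
Proof.
have [m pm] : exists m, forall i, (m <= i)%N -> p i = 0.
  by case: (p) => q /= /asboolP[].
exists (\poly_(i < m) phi i (p i)) => i; rewrite coef_poly; case: ltnP => // /pm ->.
by rewrite phi0.
Qed.

(* Multiplicativity is inherited from that of the polynomials sum phi_i(p_i) X^i. *)
Definition rees_poly (p : rees F) : {poly R} := proj1_sig (cid (rees_poly_subproof p)).

Lemma rees_polyE p i : (rees_poly p)`_i = phi i (p i).
Proof. exact: (proj2_sig (cid (rees_poly_subproof p))). Qed.

Lemma rees_poly_gr (p q : rees F) : gr_pi p = gr_pi q -> rees_poly p = rees_poly q.
Proof.
move=> /gr_piP/asboolP pq; apply/polyP => i; rewrite !rees_polyE.
have -> : p i = (p - q) i + q i by rewrite /= subrK.
rewrite (gf_D phiF) ?(gf_S phiF (pq i)) ?add0r//; first exact: fil_S.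
exact: reesF.
Qed.

Definition functional_hom (u : gr F) : R := (rees_poly (repr u)).[1].

Lemma functional_homE (p : rees F) : functional_hom (gr_pi p) = (rees_poly p).[1].
Proof. by congr (_.[1]); apply: rees_poly_gr; rewrite gr_reprK. Qed.

Lemma functional_hom_zmod : zmod_morphism functional_hom.
Proof.
move=> u v; rewrite -[u]gr_reprK -[v]gr_reprK -gr_piB !functional_homE -hornerN -hornerD.
congr (_.[1]); apply/polyP => i; rewrite coefB !rees_polyE.
have -> : (repr u - repr v) i = repr u i + (-1) *: repr v i by rewrite scaleN1r.
rewrite (gf_D phiF) ?(gf_Z phiF) ?mulN1r//; try exact: reesF.
by apply: fil_Z; exact: reesF.
Qed.

Lemma functional_hom_monoid : monoid_morphism functional_hom.
Proof.
split=> [|u v].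
  rewrite -[1]/(gr_pi 1) functional_homE (_ : rees_poly 1 = 1) ?hornerE//.
  apply/polyP => i; rewrite rees_polyE coef1 /= /unit_seq.
  by case: eqP => [->|_]; rewrite ?(gf_1 phiF)// phi0.
rewrite -[u]gr_reprK -[v]gr_reprK -gr_piM !functional_homE -hornerM.
congr (_.[1]); apply/polyP => i; rewrite coefM rees_polyE.
change (phi i (Defs.conv (repr u) (repr v) i) = \sum_(j < i.+1) (rees_poly (repr u))`_j * (rees_poly (repr v))`_(i - j)).
have Fj (j : 'I_i.+1) : fil F i (repr u j * repr v (i - j)%N).
  have := fil_M (reesF (repr u) j) (reesF (repr v) (i - j)).
  by rewrite subnKC// -ltnS.
rewrite /Defs.conv gf_sum//; apply: eq_bigr => j _; rewrite !rees_polyE.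
have := gf_M phiF (reesF (repr u) j) (reesF (repr v) (i - j)).
by rewrite subnKC// -ltnS.
Qed.

HB.instance Definition _ := GRing.isZmodMorphism.Build (gr F) R
  functional_hom functional_hom_zmod.
HB.instance Definition _ := GRing.isMonoidMorphism.Build (gr F) R
  functional_hom functional_hom_monoid.

Lemma functional_hom_scale a u : functional_hom (a *: u) = a * functional_hom u.
Proof.
rewrite -[u]gr_reprK -gr_piZ !functional_homE -hornerZ.
congr (_.[1]); apply/polyP => i; rewrite coefZ !rees_polyE.
by rewrite -(gf_Z phiF)//; exact: reesF.
Qed.

Lemma hom_of_functional : exists v : hom_alg F,
  forall i f, fil F i f -> v (gr_class F i f) = phi i f.
Proof.
exists (@HomAlg _ _ F functional_hom functional_hom_scale) => i f Ff.
rewrite /= (gr_classE Ff) functional_homE.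
rewrite (_ : rees_poly _ = (phi i f)%:P * 'X^i) ?hornerE ?hornerXn ?expr1n ?mulr1//.
apply/polyP => j; rewrite rees_polyE coefCM coefXn /= /unit_seq.
by case: eqP => [->|_]; rewrite ?mulr1 ?mulr0 ?phi0.
Qed.

End OfFunctional.
End GradedAlgebra.

(** * Germs of functions of given weight *)

Section WeightedGerms.
Context (R : realType) (M : Type) (n r : nat) (S : manifold R M n).
Context (W : weighting S r).
Implicit Types (U V : set M) (f g : M -> R) (c : pchart R M n) (w : 'I_n -> nat).

Lemma wt_le i j U : mopen S U -> (i <= j)%N -> W j U `<=` W i U.
Proof.
move=> oU ij; rewrite -(subnK ij); elim: (_ - _)%N => // k IHk f.
by rewrite addSn => /(wt_S oU)/IHk.
Qed.

Lemma wt_weights_sum i U (I : Type) (s : seq I) (P : pred I) (F : I -> M -> R) :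
  mopen S U -> (forall j, P j -> W i U (F j)) -> W i U (\sum_(j <- s | P j) F j).
Proof.
move=> oU FP; elim/big_ind: _ => //; first exact: wt_0.
by move=> *; exact: wt_D.
Qed.

Lemma wt_weights_prod U (I : Type) (s : seq I) (k : I -> nat) (F : I -> M -> R) :
  mopen S U -> (forall j, W (k j) U (F j)) ->
  W (\sum_(j <- s) k j)%N U (\prod_(j <- s) F j).
Proof.
move=> oU FP; elim: s => [|j s IHs]; first by rewrite !big_nil; exact: wt_1.
by rewrite !big_cons; exact: wt_M.
Qed.

Lemma wt_weights_exp k U f m : mopen S U -> W k U f -> W (m * k)%N U (f ^+ m).
Proof.
move=> oU fU; elim: m => [|m IHm]; first exact: wt_1.
by rewrite mulSn exprS; exact: wt_M.
Qed.

Lemma wt_coord c w a : weighted_coordinates W c w -> W (w a) (dom c) (fun x => c x 0 a).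
Proof.
move=> [Sc _ ->]; exists 1%N, (fun _ b => (b == a) : nat), (fun _ => cst 1); split=> //.
- move=> _; rewrite (bigD1 a)//= eqxx mul1n; exact: leq_addr.
- by move=> _; exact: smooth_cst.
- move=> x cx; rewrite big_ord1 mul1r (bigD1 a)//= eqxx expr1 big1 ?mulr1// => b ba.
  by rewrite (negbTE ba) expr0.
Qed.

Lemma wt_local i U f : mopen S U ->
  (forall x, U x -> exists V, [/\ mopen S V, V x & W i V f]) -> W i U f.
Proof.
move=> oU H; apply: wt_glue => // x Ux; have [V [oV Vx fV]] := H x Ux.
have oUV : mopen S (U `&` V) by exact: mopenI.
exists (U `&` V); split; [exact: oUV|by split|by move=> y []|].
by apply: (wt_restr oV oUV _ fV) => y [].
Qed.

Lemma wt_eq0 i U f : mopen S U -> (forall x, U x -> f x = 0) -> W i U f.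
Proof. by move=> oU f0; apply: (wt_congr oU) (wt_0 W i oU) => x Ux; rewrite f0. Qed.

(** Extension by zero: the values of [f] off [V] are arbitrary, but [psi] annihilates them on [Z],
    and the pieces over [V] and [Z] are glued by the sheaf property. *)
Lemma wt_cutoff i U V Z psi f : mopen S U -> mopen S V -> mopen S Z ->
  (forall y, V y \/ Z y) -> (forall y, Z y -> psi y = 0) ->
  smooth S setT psi -> W i V f -> W i U (psi * f).
Proof.
move=> oU oV oZ VZ psi0 psis fV; apply: wt_local => // x Ux.
have [Vx|Zx] := VZ x.
  exists V; split=> //; apply: wt_ideal => //.
  exact: smooth_sub psis.
exists Z; split=> //; apply: wt_eq0 => // y Zy.
by rewrite fctE psi0// mul0r.
Qed.

(** The bridge from germs to global sections, which are all that a point of the weighted normal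
    bundle can evaluate. *)
Lemma wt_germ_extend i V x f : mopen S V -> V x -> W i V f ->
  exists (psi : M -> R) V', [/\ mopen S V', V' x, V' `<=` V &
    forall y, V' y -> (psi * f) y = f y] /\
    (forall U, mopen S U -> W i U (psi * f)).
Proof.
move=> oV Vx fV; have [psi [psis [[V' [oV' V'x V'V psi1]] [Z [oZ VZ psi0]]]]] := smooth_bump oV Vx.
exists psi, V'; split; first by split=> // y V'y; rewrite fctE psi1// mul1r.
by move=> U oU; exact: wt_cutoff oU oV oZ VZ psi0 psis fV.
Qed.

(* The functionals on germs at x induced by the points of the weighted normal *)
(* bundle over x.                                                             *)
Record germ_point (x : M) (phi : nat -> (M -> R) -> R) : Prop := GermPoint {
  gp_ext : forall i U f g, mopen S U -> U x -> W i U f ->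
    (forall y, U y -> f y = g y) -> phi i f = phi i g ;
  gp_D : forall i U f g, mopen S U -> U x -> W i U f -> W i U g ->
    phi i (f + g) = phi i f + phi i g ;
  gp_M : forall i j U f g, mopen S U -> U x -> W i U f -> W j U g ->
    phi (i + j)%N (f * g) = phi i f * phi j g ;
  gp_0 : forall U f, mopen S U -> U x -> W 0 U f -> phi 0%N f = f x ;
  gp_S : forall i U f, mopen S U -> U x -> W i.+1 U f -> phi i f = 0 }.

Section GermPointTheory.
Context (x : M) (phi : nat -> (M -> R) -> R) (gp : germ_point x phi).
Context (U : set M) (oU : mopen S U) (Ux : U x).

Lemma gp_Z i a f : W i U f -> phi i (a *: f) = a * phi i f.
Proof.
move=> fU; have aU : W 0 U (cst a) by rewrite wt_smooth//; exact: smooth_cst.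
rewrite -[X in X * _](gp_0 gp oU Ux aU).
by rewrite -(gp_M gp oU Ux aU fU).
Qed.

Lemma gp_sum i (I : Type) (s : seq I) (P : pred I) (F : I -> M -> R) :
  (forall j, P j -> W i U (F j)) ->
  phi i (\sum_(j <- s | P j) F j) = \sum_(j <- s | P j) phi i (F j).
Proof.
move=> FP; suff [_ ->] : W i U (\sum_(j <- s | P j) F j) /\
  phi i (\sum_(j <- s | P j) F j) = \sum_(j <- s | P j) phi i (F j) by [].
elim/big_rec2: _ => [|j a f Pj [fU fa]].
  by split; [exact: wt_0|apply: (gp_S gp oU Ux); exact: wt_0].
split; first by apply: wt_D => //; exact: FP.
by rewrite (gp_D gp oU Ux) ?fa//; exact: FP.
Qed.

Lemma gp_exp k f m : W k U f -> phi (m * k)%N (f ^+ m) = phi k f ^+ m.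
Proof.
move=> fU; elim: m => [|m IHm].
  by rewrite mul0n !expr0 (gp_0 gp oU Ux)//; exact: wt_1.
rewrite mulSn !exprS (gp_M gp oU Ux) ?IHm//; exact: wt_weights_exp.
Qed.

Lemma gp_prod (I : Type) (s : seq I) (k : I -> nat) (F : I -> M -> R) :
  (forall j, W (k j) U (F j)) ->
  phi (\sum_(j <- s) k j)%N (\prod_(j <- s) F j) = \prod_(j <- s) phi (k j) (F j).
Proof.
move=> FP; elim: s => [|j s IHs].
  by rewrite !big_nil (gp_0 gp oU Ux)//; exact: wt_1.
rewrite !big_cons (gp_M gp oU Ux) ?IHs//; exact: wt_weights_prod.
Qed.

Lemma gp_functional : gr_functional (wt_filtration W oU) phi.
Proof.
split.
- by move=> i f g; exact: (gp_D gp oU Ux).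
- by move=> i a f; exact: gp_Z.
- by move=> i j f g; exact: (gp_M gp oU Ux).
- by rewrite (gp_0 gp oU Ux)//; exact: wt_1.
- by move=> i f; exact: (gp_S gp oU Ux).
Qed.

End GermPointTheory.

Definition monomial_sum c m (s : 'I_m -> 'I_n -> nat) (g : 'I_m -> M -> R) y :=
  \sum_(j < m) g j y * \prod_(a < n) c y 0 a ^+ s j a.

(** The local model describes sections over the whole of [dom c] only, so [f] is cut off to such a
    section and the expression is then restricted to where nothing was changed. *)
Lemma wt_local_form c w i V x f : weighted_coordinates W c w -> dom c x ->
  mopen S V -> V x -> W i V f ->
  exists V' m (s : 'I_m -> 'I_n -> nat) (g : 'I_m -> M -> R),
    [/\ mopen S V', V' x, V' `<=` V, V' `<=` dom c &
        [/\ forall j, (i <= \sum_(a < n) s j a * w a)%N,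
            forall j, smooth S (dom c) (g j) &
            forall y, V' y -> f y = monomial_sum c s g y]].
Proof.
move=> cw cx oV Vx fV; have [Sc _ cW] := cw.
have [psi [V' [[oV' V'x V'V psif] psifW]]] := wt_germ_extend oV Vx fV.
have oc := mopen_dom Sc.
have := psifW _ oc; rewrite cW => -[m [s [g [si gs E]]]].
exists (V' `&` dom c), m, s, g.
split; [exact: mopenI|by split|by move=> y [/V'V]|by move=> y []|].
by split=> // y [V'y cy]; rewrite -psif// E.
Qed.

(** Terms of weight above [i] are killed by [gp_S]; a term of weight exactly [i] factors by
    multiplicativity, its coefficient having degree 0 and hence being evaluated at [x]. So a
    functional is determined by its values on the coordinates. *)
Lemma gp_monomial_sum c w i V m (s : 'I_m -> 'I_n -> nat) (g : 'I_m -> M -> R) x phi f :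
  weighted_coordinates W c w -> mopen S V -> V x -> V `<=` dom c ->
  (forall j, (i <= \sum_(a < n) s j a * w a)%N) -> (forall j, smooth S V (g j)) ->
  (forall y, V y -> f y = monomial_sum c s g y) -> germ_point x phi ->
  phi i f = \sum_(j < m | (\sum_(a < n) s j a * w a == i)%N)
    g j x * \prod_(a < n) phi (w a) (fun y => c y 0 a) ^+ s j a.
Proof.
move=> cw oV Vx Vc si gs fE gp; have [Sc _ _] := cw.
have cV a : W (w a) V (fun y => c y 0 a).
  by apply: (wt_restr (mopen_dom Sc) oV Vc); exact: wt_coord.
pose P j := \prod_(a < n) (fun y => c y 0 a) ^+ s j a.
have gV j : W 0 V (g j) by rewrite wt_smooth.
have PV j : W (\sum_(a < n) s j a * w a)%N V (P j).
  by apply: wt_weights_prod => // a; exact: wt_weights_exp.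
have tV j : W (\sum_(a < n) s j a * w a)%N V (g j * P j) by exact: (wt_M oV (gV j) (PV j)).
have tVi j : W i V (g j * P j) by exact: (wt_le oV (si j) (tV j)).
have fsum y : V y -> (\sum_(j < m) g j * P j) y = f y.
  move=> Vy; rewrite fE// fct_sumE; apply: eq_bigr => j _.
  by rewrite fctE /P fct_prodE; congr (_ * _); apply: eq_bigr => a _; rewrite exprfctE.
have sV : W i V (\sum_(j < m) g j * P j) by apply: wt_weights_sum => // j _; exact: tVi.
rewrite -(gp_ext gp oV Vx sV fsum) (gp_sum gp oV Vx) => [|j _]; last exact: tVi.
rewrite [RHS]big_mkcond; apply: eq_bigr => j _.
case: eqP => [ji|/eqP ji]; last first.
  apply: (gp_S gp oV Vx); apply: (wt_le oV _ (tV j)).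
  by rewrite ltn_neqAle eq_sym ji si.
rewrite -{1}ji (gp_M gp oV Vx (gV j) (PV j)) (gp_0 gp oV Vx (gV j)); congr (_ * _).
rewrite (gp_prod gp oV Vx); last by move=> a; exact: wt_weights_exp.
by apply: eq_bigr => a _; exact: (gp_exp gp oV Vx).
Qed.

Lemma germ_point_eq c w x phi phi' : weighted_coordinates W c w -> dom c x ->
  germ_point x phi -> germ_point x phi' ->
  (forall a, phi (w a) (fun y => c y 0 a) = phi' (w a) (fun y => c y 0 a)) ->
  forall i V f, mopen S V -> V x -> W i V f -> phi i f = phi' i f.
Proof.
move=> cw cx gp gp' E i V f oV Vx fV.
have [V' [m [s [g [oV' V'x V'V V'c [si gs fE]]]]]] := wt_local_form cw cx oV Vx fV.
have gs' j : smooth S V' (g j) by exact: smooth_sub (gs j).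
rewrite (gp_monomial_sum cw oV' V'x V'c si gs' fE gp).
rewrite (gp_monomial_sum cw oV' V'x V'c si gs' fE gp').
by apply: eq_bigr => j _; congr (_ * _); apply: eq_bigr => a _; rewrite E.
Qed.

Section HomGerm.
Context (U : set M) (oU : mopen S U) (v : nu_on W oU) (x : M).
Local Notation F := (wt_filtration W oU).

Definition hom_over : Prop :=
  U x /\ forall f, smooth S U f -> v (gr_class _ 0 f) = f x.

Hypothesis vx : hom_over.

(** For a bump function [psi] at [x] supported in [V], the product psi (g - f) vanishes on [U],
    while [v] evaluates it to psi(x) = 1 times the value of g - f. *)
Lemma hom_germ i f g V : W i U f -> W i U g -> mopen S V -> V x ->
  (forall y, V y -> f y = g y) -> v (gr_class F i f) = v (gr_class F i g).
Proof.
move=> fU gU oV Vx fg; have [Ux vE] := vx.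
have [psi [psis [[V' [oV' V'x V'V psi1]] [Z [oZ VZ psi0]]]]] := smooth_bump oV Vx.
have psiU : W 0 U psi by rewrite wt_smooth//; exact: smooth_sub psis.
pose h := g + (-1) *: f.
have hU : W i U h by apply: wt_D => //; exact: wt_Z.
have /eqP : v (gr_class F (0 + i)%N (psi * h)) = 0.
  rewrite gr_class_eq0 ?rmorph0//; apply: wt_eq0 => // y Uy; rewrite fctE.
  have [Vy|Zy] := VZ y; last by rewrite psi0// mul0r.
  by rewrite /h !fctE /= fg// scaleN1r subrr mulr0.
rewrite (gr_classM (F := F) psiU hU) rmorphM vE; last exact: smooth_sub psis.
rewrite psi1// mul1r /h (gr_classD (F := F)) ?(gr_classZ (F := F))//; last exact: wt_Z.
by rewrite rmorphD hom_scale mulN1r subr_eq0 => /eqP.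
Qed.

Definition hom_germ_rep i f (g : M -> R) : Prop :=
  W i U g /\ exists V, [/\ mopen S V, V x & forall y, V y -> f y = g y].

(** [v] sees only sections over [U], so the germ of [f] at [x] is replaced by a section over [U]
    with the same germ; all choices give the same value. The default 0 occurs only for germs without
    such a section. *)
Definition germ_ev i f : R :=
  xget 0 [set t | exists2 g, hom_germ_rep i f g & v (gr_class F i g) = t].

Lemma germ_ev_eq i f g : hom_germ_rep i f g -> germ_ev i f = v (gr_class F i g).
Proof.
move=> fg; rewrite /germ_ev; case: xgetP => [t _ [g' fg' <-]|]; last first.
  by move=> /(_ (v (gr_class F i g)))[]; exists g.
have [gU [V [oV Vx fgV]]] := fg; have [gU' [V' [oV' Vx' fgV']]] := fg'.
apply: (hom_germ gU' gU (mopenI oV oV')) => // y [Vy V'y].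
by rewrite -fgV// -fgV'.
Qed.

Lemma germ_evE i f : W i U f -> germ_ev i f = v (gr_class F i f).
Proof.
by move=> fU; apply: germ_ev_eq; split=> //; exists U; split=> //; exact: vx.1.
Qed.

Lemma hom_germ_repP i f V : mopen S V -> V x -> W i V f ->
  exists g, hom_germ_rep i f g.
Proof.
move=> oV Vx fV.
have [psi [V' [[oV' V'x V'V psif] psifW]]] := wt_germ_extend oV Vx fV.
by exists (psi * f); split; [exact: psifW|exists V'; split=> // y V'y; rewrite psif].
Qed.

Lemma germ_ev_point : germ_point x germ_ev.
Proof.
split.
- move=> i V f g oV Vx fV fg; have [h fh] := hom_germ_repP oV Vx fV.
  rewrite (germ_ev_eq fh); symmetry; apply: germ_ev_eq.
  have [hU [V' [oV' V'x fhV']]] := fh; split=> //; exists (V `&` V').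
  by split=> //; [exact: mopenI|move=> y [Vy V'y]; rewrite -fg// fhV'].
- move=> i V f g oV Vx fV gV.
  have [f' ff'] := hom_germ_repP oV Vx fV; have [g' gg'] := hom_germ_repP oV Vx gV.
  rewrite (germ_ev_eq ff') (germ_ev_eq gg').
  have [fU [V1 [oV1 V1x fV1]]] := ff'; have [gU [V2 [oV2 V2x gV2]]] := gg'.
  rewrite -rmorphD -(gr_classD (F := F))//; apply: germ_ev_eq.
  split; first exact: wt_D.
  exists (V1 `&` V2); split=> //; first exact: mopenI.
  by move=> y [V1y V2y]; rewrite !fctE fV1// gV2.
- move=> i j V f g oV Vx fV gV.
  have [f' ff'] := hom_germ_repP oV Vx fV; have [g' gg'] := hom_germ_repP oV Vx gV.
  rewrite (germ_ev_eq ff') (germ_ev_eq gg').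
  have [fU [V1 [oV1 V1x fV1]]] := ff'; have [gU [V2 [oV2 V2x gV2]]] := gg'.
  rewrite -rmorphM -(gr_classM (F := F))//; apply: germ_ev_eq.
  split; first exact: wt_M.
  exists (V1 `&` V2); split=> //; first exact: mopenI.
  by move=> y [V1y V2y]; rewrite !fctE fV1// gV2.
- move=> V f oV Vx fV; have [f' ff'] := hom_germ_repP oV Vx fV.
  have [fU [V1 [oV1 V1x fV1]]] := ff'.
  by rewrite (germ_ev_eq ff') vx.2 ?fV1// -(wt_smooth W oU).
- move=> i V f oV Vx fV; have [f' ff'] := hom_germ_repP oV Vx fV.
  have [fU [V1 [oV1 V1x fV1]]] := ff'.
  have ffi : hom_germ_rep i f f' by split; [exact: wt_S|exists V1].
  by rewrite (germ_ev_eq ffi) gr_class_eq0 ?rmorph0.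
Qed.

End HomGerm.

End WeightedGerms.

(** * Weighted dilations and homogeneous approximations *)

Section Dilation.
Context (R : realType) (n : nat) (w : 'I_n -> nat).

(** As [0 ^+ 0 = 1], the map [dil w 0] keeps the coordinates of weight 0 and annihilates the others:
    it is the bundle projection in weighted coordinates. *)
Definition dil (t : R) (z : 'rV[R]_n) : 'rV[R]_n := \row_a (t ^+ w a * z 0 a).

Lemma dilM s t z : dil s (dil t z) = dil (s * t) z.
Proof. by apply/rowP => a; rewrite !mxE exprMn mulrA. Qed.

Lemma dil_continuous z (t : R) : {for t, continuous (fun s => dil s z)}.
Proof.
apply: continuous_row => a; rewrite (_ : (fun s => _) = (fun s : R => s ^+ w a * z 0 a)).
  apply: (@cvgM _ _ (nbhs t) _ (fun s : R => s ^+ w a) (cst (z 0 a))); last exact: cvg_cst.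
  exact: exprn_continuous.
by apply/funext => s; rewrite mxE.
Qed.

Lemma Csmooth_dil t a : Csmooth setT (fun z => dil t z 0 a).
Proof.
rewrite (_ : (fun z => _) = cst (t ^+ w a) * (fun z : 'rV[R]_n => z 0 a)).
  by apply: CsmoothM openT _ _; [exact: Csmooth_cst|exact: Csmooth_coord].
by apply/funext => z; rewrite mxE.
Qed.

Lemma dil_open t (O : set 'rV[R]_n) : open O -> open [set z | O (dil t z)].
Proof.
move=> oO; rewrite -[mkset _]setTI; apply: open_preimage_on => //; first exact: openT.
by move=> z _; apply: (Csmooth_row_continuous (Csmooth_dil t)).
Qed.

End Dilation.

Section LimitEvaluation.
Context (R : realType) (M : Type) (n r : nat) (S : manifold R M n).
Context (W : weighting S r).
Implicit Types (U V : set M) (f g : M -> R) (c : pchart R M n) (w : 'I_n -> nat).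

(* The i-th homogeneous approximation of f at the point with coordinates z. *)
Definition lim_ev c w (z : 'rV[R]_n) (i : nat) (f : M -> R) : R :=
  lim ((fun t : R => t ^- i * along c f (dil w t z)) @ 0^').

Lemma near_dil_image c w z x V : charts S c -> mopen S V -> V x -> V `<=` dom c ->
  c x = dil w 0 z -> \forall t \near 0^', exists2 y, V y & c y = dil w t z.
Proof.
move=> Sc oV Vx Vc xz.
have oc : open (c @` V) by exact: mopen_image Sc oV Vc.
have N : nbhs (dil w 0 z) (c @` V) by apply: open_nbhs_nbhs; split=> //; exists x.
have : nbhs (0 : R) (fun t => (c @` V) (dil w t z)) by exact: dil_continuous N.
by move=> H; apply: cvg_within H.
Qed.

(** A monomial of weight e contributes t^(e - i) times its value at [z], so only e = i survives; the
    coefficients tend to their values at [x], since [dil w t z] tends to [c x]. *)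
Lemma lim_ev_cvg c w z i x V m (s : 'I_m -> 'I_n -> nat) (g : 'I_m -> M -> R) f :
  charts S c -> c x = dil w 0 z -> mopen S V -> V x -> V `<=` dom c ->
  (forall j, (i <= \sum_(a < n) s j a * w a)%N) -> (forall j, smooth S V (g j)) ->
  (forall y, V y -> f y = monomial_sum c s g y) ->
  (fun t : R => t ^- i * along c f (dil w t z)) @ 0^' -->
  \sum_(j < m | (\sum_(a < n) s j a * w a == i)%N)
    g j x * \prod_(a < n) z 0 a ^+ s j a.
Proof.
move=> Sc xz oV Vx Vc si gs fE.
have cch := charts_chart Sc; have oc := mopen_image Sc oV Vc.
have /choice[G GP] : forall j, exists G : 'rV[R]_n -> R,
    Csmooth (c @` V) G /\ forall y, V y -> g j y = G (c y).
  by move=> j; have /(smooth_in_subP _ Vc)[G ? ?] := gs j c Sc; exists G.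
pose e j := (\sum_(a < n) s j a * w a)%N.
pose P j := \prod_(a < n) z 0 a ^+ s j a.
pose B t := \sum_(j < m) G j (dil w t z) * (t ^+ (e j - i)%N * P j).
have Bcvg : B @ 0^' --> \sum_(j < m) G j (c x) * (0 ^+ (e j - i)%N * P j).
  apply: cvg_big => [|j _]; first exact: add_continuous.
  apply: cvgM.
    apply: cvg_within_filter; rewrite xz.
    apply: (@continuous_comp _ _ _ (fun t : R => dil w t z) (G j)).
      exact: dil_continuous.
    rewrite -xz; apply: (Csmooth_continuous (GP j).1); by exists x.
  apply: cvg_within_filter; apply: cvgM; [exact: exprn_continuous|exact: cvg_cst].
have -> : \sum_(j < m | (\sum_(a < n) s j a * w a == i)%N)
    g j x * \prod_(a < n) z 0 a ^+ s j a =
    \sum_(j < m) G j (c x) * (0 ^+ (e j - i)%N * P j).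
  rewrite big_mkcond; apply: eq_bigr => j _; rewrite expr0n subn_eq0 -(GP j).2//.
  by rewrite eqn_leq si andbT; case: leqP => _; rewrite ?mul1r// mul0r mulr0.
have E : \forall t \near 0^', B t = t ^- i * along c f (dil w t z).
  near=> t.
  have [y Vy cy] : exists2 y, V y & c y = dil w t z.
    by near: t; exact: near_dil_image Sc oV Vx Vc xz.
  have t0 : t != 0 by near: t; exact: nbhs_dnbhs_neq.
  rewrite -cy (alongE _ cch (Vc _ Vy)) fE// /monomial_sum mulr_sumr cy.
  apply: eq_bigr => j _; rewrite (GP j).2// cy [RHS]mulrCA; congr (_ * _).
  have -> : \prod_(a < n) dil w t z 0 a ^+ s j a = t ^+ e j * P j.
    rewrite /e expr_sum -big_split /=; apply: eq_bigr => a _.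
    by rewrite mxE exprMn -exprM mulnC.
  rewrite mulrA; congr (_ * _); rewrite expfB_cond; first exact: mulrC.
  by rewrite (negbTE t0) add0n; exact: si.
apply: cvg_trans Bcvg; apply: near_eq_cvg; exact: E.
Unshelve. all: by end_near. Qed.

Lemma lim_ev_monomial_sum c w z i x V m (s : 'I_m -> 'I_n -> nat) (g : 'I_m -> M -> R) f :
  charts S c -> c x = dil w 0 z -> mopen S V -> V x -> V `<=` dom c ->
  (forall j, (i <= \sum_(a < n) s j a * w a)%N) -> (forall j, smooth S V (g j)) ->
  (forall y, V y -> f y = monomial_sum c s g y) ->
  lim_ev c w z i f = \sum_(j < m | (\sum_(a < n) s j a * w a == i)%N)
    g j x * \prod_(a < n) z 0 a ^+ s j a.
Proof.
by move=> Sc xz oV Vx Vc si gs fE; apply/cvg_lim => //; exact: (lim_ev_cvg Sc xz oV).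
Qed.

Lemma lim_ev_is_cvg c w z i x V f : weighted_coordinates W c w -> dom c x ->
  c x = dil w 0 z -> mopen S V -> V x -> W i V f ->
  (fun t : R => t ^- i * along c f (dil w t z)) @ 0^' --> lim_ev c w z i f.
Proof.
move=> cw cx xz oV Vx fV; have [Sc _ _] := cw.
have [V' [m [s [g [oV' V'x V'V V'c [si gs fE]]]]]] := wt_local_form cw cx oV Vx fV.
have gs' j : smooth S V' (g j) by exact: smooth_sub (gs j).
rewrite (lim_ev_monomial_sum Sc xz oV' V'x V'c si gs' fE).
exact: (lim_ev_cvg Sc xz oV' V'x V'c si gs' fE).
Qed.

(** Additivity and multiplicativity pass to the limit along the curve [dil w t z]; the other axioms
    are read off from the monomial form. *)
Lemma lim_ev_point c w z x : weighted_coordinates W c w -> dom c x ->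
  c x = dil w 0 z -> germ_point W x (lim_ev c w z).
Proof.
move=> cw cx xz; have [Sc _ _] := cw; have cch := charts_chart Sc.
have Nc := near_dil_image Sc (mopen_dom Sc) cx (@subset_refl _ _) xz.
split.
- move=> i V f g oV Vx fV fg.
  have [V' [m [s [h [oV' V'x V'V V'c [si hs fE]]]]]] := wt_local_form cw cx oV Vx fV.
  have hs' j : smooth S V' (h j) by exact: smooth_sub (hs j).
  rewrite (lim_ev_monomial_sum Sc xz oV' V'x V'c si hs' fE).
  symmetry; apply: (lim_ev_monomial_sum Sc xz oV' V'x V'c si hs') => y V'y.
  by rewrite -fg ?fE//; exact: V'V.
- move=> i V f g oV Vx fV gV; apply/cvg_lim => //.
  have fc := lim_ev_is_cvg cw cx xz oV Vx fV; have gc := lim_ev_is_cvg cw cx xz oV Vx gV.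
  apply: cvg_trans (cvgD fc gc); apply: near_eq_cvg; near=> t.
  have [y cy yt] : exists2 y, dom c y & c y = dil w t z by near: t; exact: Nc.
  change (t ^- i * along c f (dil w t z) + t ^- i * along c g (dil w t z) =
    t ^- i * along c (f + g) (dil w t z)).
  by rewrite -yt !alongE// mulrDr.
- move=> i j V f g oV Vx fV gV; apply/cvg_lim => //.
  have fc := lim_ev_is_cvg cw cx xz oV Vx fV; have gc := lim_ev_is_cvg cw cx xz oV Vx gV.
  apply: cvg_trans (cvgM fc gc); apply: near_eq_cvg; near=> t.
  have [y cy yt] : exists2 y, dom c y & c y = dil w t z by near: t; exact: Nc.
  change ((t ^- i * along c f (dil w t z)) * (t ^- j * along c g (dil w t z)) =
    t ^- (i + j) * along c (f * g) (dil w t z)).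
  by rewrite -yt !alongE// exprD invfM mulrACA.
- move=> V f oV Vx fV.
  have oVc : mopen S (V `&` dom c) by apply: mopenI => //; exact: mopen_dom.
  have Vcc : V `&` dom c `<=` dom c by move=> y [].
  have fs (j : 'I_1) : smooth S (V `&` dom c) f.
    by apply: (@smooth_sub _ _ _ _ V); [move=> y []|rewrite -(wt_smooth W oV)].
  have := @lim_ev_monomial_sum c w z 0 x (V `&` dom c) 1 (fun _ _ => 0%N) (fun _ => f) f
    Sc xz oVc (conj Vx cx) Vcc (fun _ => leq0n _) fs.
  rewrite big_mkcond big_ord1 big1 ?eqxx; last by move=> a _; rewrite mul0n.
  rewrite big1 ?mulr1; last by move=> a _; rewrite expr0.
  by apply=> y _; rewrite /monomial_sum big_ord1 big1 ?mulr1// => a _; rewrite expr0.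
- move=> i V f oV Vx fV.
  have [V' [m [s [h [oV' V'x V'V V'c [si hs fE]]]]]] := wt_local_form cw cx oV Vx fV.
  have hs' j : smooth S V' (h j) by exact: smooth_sub (hs j).
  rewrite (lim_ev_monomial_sum Sc xz oV' V'x V'c (fun j => ltnW (si j)) hs' fE).
  by rewrite big_pred0// => j; apply: gtn_eqF; exact: si.
Unshelve. all: by end_near. Qed.

Lemma lim_ev_coord c w z x a : weighted_coordinates W c w -> dom c x ->
  c x = dil w 0 z -> lim_ev c w z (w a) (fun y => c y 0 a) = z 0 a.
Proof.
move=> cw cx xz; have [Sc _ _] := cw.
pose s (_ : 'I_1) b := (b == a) : nat.
have sw j : (\sum_(b < n) s j b * w b = w a)%N.
  rewrite (bigD1 a)//= /s eqxx mul1n big1 ?addn0// => b ba.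
  by rewrite (negbTE ba) mul0n.
have sz (y : 'rV[R]_n) j : \prod_(b < n) y 0 b ^+ s j b = y 0 a.
  rewrite (bigD1 a)//= /s eqxx expr1 big1 ?mulr1// => b ba.
  by rewrite (negbTE ba) expr0.
have ws j : (w a <= \sum_(b < n) s j b * w b)%N by rewrite sw.
have gs (j : 'I_1) : smooth S (dom c) (cst 1) by exact: smooth_cst.
rewrite (lim_ev_monomial_sum Sc xz (mopen_dom Sc) cx (@subset_refl _ _) ws gs).
  by rewrite big_mkcond big_ord1 sw eqxx mul1r sz.
by move=> y cy; rewrite /monomial_sum big_ord1 sz mul1r.
Qed.

(** Locally this is a polynomial in [z] whose coefficients are smooth functions of [dil w 0 z]. *)
Lemma lim_ev_smooth c w i V f : weighted_coordinates W c w -> mopen S V ->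
  V `<=` dom c -> W i V f ->
  Csmooth [set z | (c @` V) (dil w 0 z)] (fun z => lim_ev c w z i f).
Proof.
move=> cw oV Vc fV; have [Sc _ _] := cw.
apply: Csmooth_local => z0 [x Vx xz0].
have [V' [m [s [g [oV' V'x V'V V'c [si gs fE]]]]]] := wt_local_form cw (Vc _ Vx) oV Vx fV.
have gs' j : smooth S V' (g j) by exact: smooth_sub (gs j).
have oc := mopen_image Sc oV' V'c.
have /choice[G GP] : forall j, exists G : 'rV[R]_n -> R,
    Csmooth (c @` V') G /\ forall y, V' y -> g j y = G (c y).
  by move=> j; have /(smooth_in_subP _ V'c)[G ? ?] := gs' j c Sc; exists G.
exists [set z | (c @` V') (dil w 0 z)]; first by exists x.
have oO := @dil_open _ _ w 0 _ oc.
apply: (@Csmooth_ext _ _ _ (\sum_(j < m | (\sum_(a < n) s j a * w a == i)%N)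
    (G j \o dil w 0) * \prod_(a < n) (fun z : 'rV[R]_n => z 0 a) ^+ s j a)) => //.
  move=> z [y V'y yz].
  rewrite (lim_ev_monomial_sum Sc yz oV' V'y V'c si gs' fE) fct_sumE.
  apply: eq_bigr => j _; rewrite fctE fct_prodE /= -yz (GP j).2//; congr (_ * _).
  by apply: eq_bigr => a _; rewrite exprfctE.
apply: Csmooth_sum => // j _; apply: CsmoothM => //.
  apply: (Csmooth_comp oO oc) (GP j).1 => // a.
  by apply: Csmooth_sub (@Csmooth_dil _ _ w 0 a).
by apply: Csmooth_prod => // a _; apply: CsmoothX => //; exact: Csmooth_coord.
Qed.

Section Submanifold.
Context (N : set M) (hN : weighted_pair W N).

Lemma wt1_vanish U f x : mopen S U -> W 1 U f -> U x -> N x -> f x = 0.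
Proof. by move=> oU; rewrite (hN.2 _ oU) => -[_ H]; exact: H. Qed.

(** Off N there is a bump function equal to 1 at [x] and vanishing on N. It has weight 1, so its
    value in degree 0 would be both 0 and 1. *)
Lemma germ_point_N x phi : germ_point W x phi -> N x.
Proof.
move=> gp; apply: contrapT => Nx.
have oN : mopen S (~` N) by exact: closed_openC hN.1.1.
have [psi [psis [[V [oV Vx VN psi1]] [Z [oZ NZ psi0]]]]] := smooth_bump oN Nx.
have psi1W : W 1 setT psi.
  rewrite (hN.2 _ (@mopenT R M n S)); split=> // y _ Ny; apply: psi0.
  by have [] := NZ y.
have psi0W : W 0 setT psi by rewrite wt_smooth//; exact: (@mopenT R M n S).
have := gp_0 gp (@mopenT R M n S) I psi0W; rewrite (gp_S gp (@mopenT R M n S) I psi1W) psi1//.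
by move=> /eqP; rewrite eq_sym oner_eq0.
Qed.

Lemma weighted_coord_N c w x a : weighted_coordinates W c w -> dom c x -> N x ->
  (0 < w a)%N -> c x 0 a = 0.
Proof.
move=> cw cx Nx wa; have [Sc _ _] := cw; have oc := mopen_dom Sc.
exact: (wt1_vanish oc (wt_le oc wa (wt_coord a cw)) cx Nx).
Qed.

Lemma weighted_coord_dil0 c w x : weighted_coordinates W c w -> dom c x -> N x ->
  dil w 0 (c x) = c x.
Proof.
move=> cw cx Nx; apply/rowP => a; rewrite mxE expr0n.
case: (posnP (w a)) => wa; first by rewrite mul1r.
by rewrite mul0r (weighted_coord_N cw).
Qed.

(** Both functionals agree on the coordinates, hence everywhere. The fiber over [x] is thus
    parametrized by the [z] with [dil w 0 z = c x]: in weight 0 the functional evaluates at [x], and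
    in positive weight both sides of this equation vanish because [x] lies on N. *)
Lemma germ_point_coord c w x phi : weighted_coordinates W c w -> dom c x ->
  germ_point W x phi ->
  let z := \row_a phi (w a) (fun y => c y 0 a) in
  c x = dil w 0 z /\
  forall i V f, mopen S V -> V x -> W i V f -> phi i f = lim_ev c w z i f.
Proof.
move=> cw cx gp z; have [Sc _ _] := cw; have oc := mopen_dom Sc.
have xz : c x = dil w 0 z.
  apply/rowP => a; rewrite !mxE expr0n; case: (posnP (w a)) => wa.
    rewrite wa mul1r (gp_0 gp oc cx)//.
    by have := wt_coord a cw; rewrite wa.
  by rewrite mul0r (weighted_coord_N cw)//; exact: germ_point_N gp.
split=> //; apply: (germ_point_eq cw cx gp (lim_ev_point cw cx xz)) => a.
by rewrite (lim_ev_coord a cw cx xz) mxE.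
Qed.

End Submanifold.
End LimitEvaluation.

(** * Characters of smooth functions are point evaluations *)

Section PointEvaluation.
Context (R : realType) (M : Type) (n r : nat) (S : manifold R M n).
Context (W : weighting S r) (U : set M) (oU : mopen S U) (v : nu_on W oU).
Local Notation F := (wt_filtration W oU).
Implicit Types f g : M -> R.

Let chi f := v (gr_class F 0 f).

Let W0 f : smooth S U f -> W 0 U f.
Proof. by rewrite wt_smooth. Qed.

Let chiD f g : smooth S U f -> smooth S U g -> chi (f + g) = chi f + chi g.
Proof. by move=> /W0 fU /W0 gU; rewrite /chi (gr_classD (F := F))// rmorphD. Qed.

Let chiM f g : smooth S U f -> smooth S U g -> chi (f * g) = chi f * chi g.
Proof.
by move=> /W0 fU /W0 gU; rewrite /chi -rmorphM -(gr_classM (F := F)).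
Qed.

Let chi_eq f g : smooth S U f -> (forall x, U x -> f x = g x) -> chi f = chi g.
Proof.
move=> /W0 fU fg; have gU : W 0 U g by apply: (wt_congr oU fg).
congr (v _); apply/(gr_class_eq (F := F)) => //; apply: wt_eq0 => // x Ux.
by rewrite !fctE fg// subrr.
Qed.

Let chi_cst (a : R) : chi (cst a) = a.
Proof.
have -> : cst a = a *: (1 : M -> R) by apply/funext => x; exact/esym/mulr1.
rewrite /chi (gr_classZ (F := F)) ?hom_scale; last exact: wt_1.
by rewrite (gr_class1 F) rmorph1 mulr1.
Qed.

(* Otherwise f - chi f would be invertible on U. *)
Let chi_image f : smooth S U f -> exists2 x, U x & f x = chi f.
Proof.
move=> fU; apply: contrapT => H.
pose g := f + cst (- chi f).
have gU : smooth S U g by apply: smoothD => //; exact: smooth_cst.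
have g0 x : U x -> g x != 0.
  move=> Ux; apply/eqP => gx; apply: H; exists x => //.
  by move/eqP: gx; rewrite /g fctE /= subr_eq0 => /eqP.
have hU := smoothV oU g0 gU.
have : chi (g * (fun x => (g x)^-1)) = chi (cst 1).
  by apply: chi_eq => [|x Ux]; [exact: smoothM|rewrite fctE divff// g0].
rewrite chiM// /g chiD ?chi_cst ?subrr ?mul0r; [|by []|exact: smooth_cst].
by move/eqP; rewrite eq_sym oner_eq0.
Qed.

(** With h = f - chi(f), the function h^2 / (1 + h^2) lies in the kernel of [chi], is positive where
    h is not 0, and has the uniform bound 1 on which the convergence argument rests. *)
Let chi_separating : (forall x, U x -> exists2 f, smooth S U f & chi f <> f x) ->
  forall x, exists f, U x ->
    [/\ smooth S U f, chi f = 0, forall y, U y -> 0 <= f y <= 1 & 0 < f x].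
Proof.
move=> H x; have [Ux|Ux] := pselect (U x); last by exists 0.
have [f fU fx] := H x Ux.
pose h := f + cst (- chi f); pose p := h * h; pose q := fun y => (cst 1 + p) y.
have hU : smooth S U h by apply: smoothD => //; exact: smooth_cst.
have pU : smooth S U p by exact: smoothM.
have p0 y : 0 <= p y by rewrite /p fctE -expr2 sqr_ge0.
have qU : smooth S U q by apply: smoothD => //; exact: smooth_cst.
have q0 y : 0 < q y by rewrite /q fctE /= ltr_wpDr.
have q'U : smooth S U (fun y => (q y)^-1).
  by apply: smoothV => // y _; rewrite gt_eqF.
exists (p * (fun y => (q y)^-1)) => _; split.
- exact: smoothM.
- rewrite chiM// (_ : chi p = 0) ?mul0r// /p chiM//.
  by rewrite /h chiD ?chi_cst ?subrr ?mul0r//; exact: smooth_cst.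
- move=> y _; rewrite fctE divr_ge0//= ?(ltW (q0 y))// ler_pdivrMr// mul1r.
  by rewrite /q fctE /= lerDr.
- rewrite fctE divr_gt0// lt_neqAle p0 andbT eq_sym /p fctE mulf_neq0//;
    by rewrite /h fctE /= subr_eq0; apply/eqP => E; exact: fx.
Qed.

Lemma sum_half_powers (K L : nat) (a : nat -> R) : (forall k, 0 <= a k <= 1) ->
  0 <= \sum_(K <= k < L) 2^-1 ^+ k * a k <= 2 * 2^-1 ^+ K.
Proof.
move=> a01; have h0 k : 0 <= 2^-1 ^+ k :> R by rewrite exprn_ge0.
apply/andP; split.
  by apply: sumr_ge0 => k _; have /andP[ak _] := a01 k; exact: mulr_ge0.
suff : \sum_(K <= k < L) 2^-1 ^+ k * a k + 2 * 2^-1 ^+ (maxn K L) <= 2 * 2^-1 ^+ K.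
  by apply: le_trans; rewrite lerDl mulr_ge0.
have [KL|LK] := leqP K L; last by rewrite big_geq ?add0r// ltnW.
elim: L KL => [|L IHL].
  by rewrite leqn0 => /eqP ->; rewrite big_geq// add0r.
rewrite leq_eqVlt => /predU1P[->|KL]; first by rewrite big_geq// add0r.
rewrite big_nat_recr//=; apply: le_trans (IHL KL).
rewrite -addrA lerD2l exprS.
have /andP[_ aL] := a01 L; have hL := h0 L.
have : 2^-1 ^+ L * a L <= 2^-1 ^+ L by rewrite ler_piMr.
by lra.
Qed.

(** If [v] lies over no point, countably many functions with values in [0, 1], all in the kernel of
    [chi], have no common zero. Their sum [G] with factors 2^-k, made locally finite, is smooth and
    positive on [U]. Yet chi(G) = 0: continuity of [chi] is replaced by [chi_image], applied to the
    tails of the sum, which are uniformly small. So [G] would take the value 0. *)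
Lemma hom_over_exists : @second_countable (mtop S) -> exists x, hom_over v x.
Proof.
move=> Ssc; apply: contrapT => Hno.
have H x : U x -> exists2 f, smooth S U f & chi f <> f x.
  move=> Ux; apply: contrapT => H; apply: Hno; exists x; split=> // f fU.
  by apply: contrapT => fx; apply: H; exists f.
have /choice[f fP] := chi_separating H.
have [|e [eU eP]] := @lindelof _ _ _ _ U (fun x => U `&` [set y | f x y != 0]) Ssc.
  move=> x Ux; have [fs _ _ fx] := fP x Ux.
  by split; [exact: smooth_neq0_open|split=> //=; rewrite gt_eqF].
pose F k := if e k is Some y then f y else 0.
have FP k : [/\ smooth S U (F k), chi (F k) = 0 & forall y, U y -> 0 <= F k y <= 1].
  rewrite /F; case E : (e k) => [y|]; first by have [] := fP y (eU _ _ E).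
  split; [exact: smooth_cst|exact: (chi_cst 0)|move=> y _].
  by rewrite lexx ler01.
have F0 k x : U x -> 0 <= F k x by have [_ _ H1] := FP k; move=> /H1/andP[].
have Fs k : smooth S U (F k) by have [] := FP k.
have [|q [qs q01 qpos qlf]] := @locally_finite_refinement _ _ _ S U F oU Fs F0.
  move=> x Ux; have [k [y [ek [_ fyx]]]] := eP x Ux; exists k.
  rewrite lt_neqAle F0// andbT eq_sym; by rewrite /F ek.
pose h k := cst (2^-1 ^+ k) * (F k * q k).
have hs k : smooth S U (h k).
  by apply: smoothM => //; [exact: smooth_cst|exact: smoothM].
have chih k : chi (h k) = 0.
  have [_ F0' _] := FP k.
  rewrite /h chiM ?(chiM (Fs k)) ?F0' ?mul0r ?mulr0//; first exact: smooth_cst.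
  exact: smoothM.
have hlf : locally_finite S U h.
  move=> x /qlf[V [oV Vx VU [K KV]]]; exists V; split=> //; exists K => k y Kk Vy.
  by rewrite /h fctE KV// mulr0.
have [G GE] := locally_finite_sum hlf.
have Gx x : U x -> exists L, forall K, (L <= K)%N -> G x = \sum_(k < K) h k x.
  move=> Ux; have [V [oV Vx VU [L LV]]] := hlf x Ux; exists L => K LK.
  by apply: GE => // k Kk; apply: LV => //; exact: leq_trans Kk.
have Gs : smooth S U G.
  apply: smooth_local => x Ux; have [V [oV Vx VU [K KV]]] := hlf x Ux.
  apply: (@smooth_smooth_at _ _ _ _ V) => //.
  apply: (@smooth_ext _ _ _ _ _ (\sum_(k < K) h k)).
    move=> y Vy; rewrite fct_sumE (GE y K)//; first exact: VU.
    by move=> k Kk; exact: KV.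
  by apply: smooth_sum => // k _; exact: smooth_sub (hs k).
have a01 x k : U x -> 0 <= (F k * q k) x <= 1.
  move=> Ux; have [_ _ /(_ x Ux)/andP[f0 f1]] := FP k; have /andP[q0 q1] := q01 k x.
  by rewrite fctE mulr_ge0//= mulr_ile1.
(* Every term lies in the kernel, so [chi] does not notice the removal of a partial sum, and chi(G)
   is a value of each tail. *)
have chiG K : chi G = chi (G + cst (-1) * \sum_(k < K) h k).
  have sK : smooth S U (\sum_(k < K) h k) by apply: smooth_sum => // k _; exact: hs.
  rewrite chiD ?chiM//; try exact: smooth_cst; last by apply: smoothM => //; exact: smooth_cst.
  suff -> : chi (\sum_(k < K) h k) = 0 by rewrite mulr0 addr0.
  elim: K {sK} => [|K IHK]; first by rewrite big_ord0; exact: (chi_cst 0).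
  rewrite big_ord_recr /= chiD; [by rewrite IHK chih addr0| |exact: hs].
  by apply: smooth_sum => // k _; exact: hs.
have chiGb K : 0 <= chi G <= 2 * 2^-1 ^+ K.
  have sK : smooth S U (G + cst (-1) * \sum_(k < K) h k).
    apply: smoothD => //; apply: smoothM => //; first exact: smooth_cst.
    by apply: smooth_sum => // k _; exact: hs.
  rewrite (chiG K); have [x Ux <-] := chi_image sK.
  have [L LP] := Gx x Ux.
  have -> : (G + cst (-1) * \sum_(k < K) h k) x =
      \sum_(K <= k < maxn K L) 2^-1 ^+ k * (F k * q k) x.
    rewrite !fctE /= fct_sumE (LP (maxn K L)) ?leq_maxr// mulN1r.
    rewrite -!(big_mkord xpredT (fun k => h k x)).
    by rewrite (big_cat_nat (n := K)) ?leq_maxl//= addrAC subrr add0r.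
  by apply: sum_half_powers => k; exact: a01.
have chiG0 : chi G = 0.
  apply/eqP; rewrite eq_le (proj1 (andP (chiGb 0%N))) andbT leNgt; apply/negP => G0.
  pose K := (Num.truncn (2 / chi G)).+1.
  have /andP[_] := chiGb K; apply/negP; rewrite -ltNge.
  have : 2 / chi G < K%:R by exact: truncnS_gt.
  rewrite ltr_pdivrMr// => H1.
  have H2 : K%:R <= 2 ^+ K :> R by rewrite -natrX ler_nat ltnW// ltn_expl.
  rewrite exprVn ltr_pdivrMr ?exprn_gt0//; apply: lt_le_trans H1 _.
  by rewrite mulrC ler_wpM2l// ltW.
have [x Ux] := chi_image Gs; rewrite chiG0.
have [L LP] := Gx x Ux; have [k kpos] := qpos x Ux.
have kK : (k < maxn k.+1 L)%N by rewrite leq_max leqnn.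
rewrite (LP (maxn k.+1 L)) ?leq_maxr// (bigD1 (Ordinal kK))//=; apply/eqP.
rewrite gt_eqF// ltr_wpDr//.
  apply: sumr_ge0 => j _; rewrite /h fctE mulr_ge0//= ?exprn_ge0//.
  by have /andP[] := a01 x j Ux.
by rewrite /h !fctE mulr_gt0//= exprn_gt0.
Qed.

End PointEvaluation.

(** * The weighted normal bundle *)

Section NormalBundle.
Context (R : realType) (M : Type) (n r : nat) (S : manifold R M n).
Context (W : weighting S r) (N : set M) (hN : weighted_pair W N).
Implicit Types (U V : set M) (f g : M -> R) (c : pchart R M n) (w : 'I_n -> nat).
Implicit Types (u : nu W).
Local Notation oT := (@mopenT R M n S).
Local Notation FT := (wt_filtration W oT).

Lemma hom_over_inj (U : set M) (oU : mopen S U) (v : nu_on W oU) x y :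
  hom_over v x -> hom_over v y -> x = y.
Proof.
move=> [Ux vx] [Uy vy]; apply: contrapT => nxy.
have xy : (x : mtop S) != y by apply/eqP.
have := @mfd_hausdorff _ _ _ S; rewrite open_hausdorff => /(_ x y xy).
move=> [[A B] [/=]]; rewrite !inE => Ax By [oA oB AB].
have [psi [psis [[V [oV Vx VA psi1]] [Z [oZ AZ psi0]]]]] := smooth_bump oA Ax.
have Zy : Z y.
  have [Ay|//] := AZ y.
  have : (A `&` B) y by [].
  by rewrite AB.
have psiU : smooth S U psi by exact: smooth_sub psis.
have := vx _ psiU; rewrite vy// (psi1 x Vx) (psi0 y Zy) => /eqP.
by rewrite eq_sym oner_eq0.
Qed.

Definition base u : M := proj1_sig (cid (hom_over_exists u (mfd_second_countable S))).

Lemma base_over u : hom_over u (base u).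
Proof. exact: (proj2_sig (cid (hom_over_exists u (mfd_second_countable S)))). Qed.

Lemma nu_overP u x : nu_over u x <-> x = base u.
Proof.
split=> [ux|->]; last by have [] := base_over u.
by apply: (hom_over_inj (v := u)); [|exact: base_over].
Qed.

Definition germ u := germ_ev u (base u).

Lemma germ_pointP u : germ_point W (base u) (germ u).
Proof. exact: (germ_ev_point (base_over u)). Qed.

Lemma germE u i f : W i setT f -> germ u i f = u (gr_class FT i f).
Proof. exact: (germ_evE (base_over u)). Qed.

Lemma base_N u : N (base u).
Proof. exact: (germ_point_N hN (germ_pointP u)). Qed.

Lemma hom_of_germ_point x phi (U : set M) (oU : mopen S U) : U x ->
  germ_point W x phi -> exists v : nu_on W oU, hom_over v x /\
    forall i f, W i U f -> v (gr_class (wt_filtration W oU) i f) = phi i f.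
Proof.
move=> Ux gp; have [v vE] := hom_of_functional (gp_functional gp oU Ux).
exists v; split=> //; split=> // f fU.
have f0 : W 0 U f by rewrite wt_smooth.
by rewrite (vE 0%N f f0) (gp_0 gp oU Ux f0).
Qed.

(** Global sections already realize all germs, so agreement on them determines both the base point
    and the action on germs at it. *)
Lemma germ_of_hom u x phi : germ_point W x phi ->
  (forall i f, W i setT f -> u (gr_class FT i f) = phi i f) ->
  base u = x /\ forall i V f, mopen S V -> V x -> W i V f -> germ u i f = phi i f.
Proof.
move=> gp uE; have bx : base u = x.
  symmetry; apply/nu_overP => f fs; have f0 : W 0 setT f by rewrite wt_smooth//; exact: oT.
  by rewrite (uE 0%N f f0) (gp_0 gp oT I f0).
split=> // i V f oV Vx fV.
have [psi [V' [[oV' V'x V'V psif] psifW]]] := wt_germ_extend oV Vx fV.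
have fT := psifW _ oT.
have fV' : W i V' (psi * f) by exact: psifW.
rewrite -(gp_ext gp oV' V'x fV' psif) -uE// -germE//.
have gpu := germ_pointP u; rewrite bx in gpu.
by rewrite -(gp_ext gpu oV' V'x fV' psif).
Qed.

Lemma nu_of_germ_point x phi : germ_point W x phi -> exists u, base u = x /\
  forall i V f, mopen S V -> V x -> W i V f -> germ u i f = phi i f.
Proof.
move=> gp; have [u [_ uE]] := hom_of_germ_point oT I gp.
by exists u; exact: germ_of_hom.
Qed.

Lemma nu_germ_ext u u' : base u = base u' ->
  (forall i f, W i setT f -> germ u i f = germ u' i f) -> u = u'.
Proof.
by move=> _ E; apply: hom_alg_ext => i f fW; rewrite -!germE// E.
Qed.

(** These are the functions (x_a)^[w_a]; as x_a is a section over [dom c] only, the value at [u] is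
    taken on germs at the base point. *)
Definition nu_coord c w u : 'rV[R]_n := \row_a germ u (w a) (fun y => c y 0 a).

Definition nu_chart c w : pchart R (nu W) n :=
  PChart [set u | dom c (base u)] (nu_coord c w).

Section WeightedChart.
Context (c : pchart R M n) (w : 'I_n -> nat) (cw : weighted_coordinates W c w).

Let Sc : charts S c. Proof. by case: cw. Qed.

Lemma nu_coord_base u : dom c (base u) -> c (base u) = dil w 0 (nu_coord c w u).
Proof. by move=> cu; have [] := germ_point_coord hN cw cu (germ_pointP u). Qed.

Lemma germ_lim_ev u i V f : dom c (base u) -> mopen S V -> V (base u) -> W i V f ->
  germ u i f = lim_ev c w (nu_coord c w u) i f.
Proof. by move=> cu; have [_] := germ_point_coord hN cw cu (germ_pointP u); apply. Qed.

Lemma nu_chart_inj u u' : dom c (base u) -> dom c (base u') ->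
  nu_coord c w u = nu_coord c w u' -> u = u'.
Proof.
move=> cu cu' E; have [cI _] := charts_chart Sc.
have bE : base u = base u' by apply: cI => //; rewrite !nu_coord_base// E.
apply: nu_germ_ext => // i f fW.
by rewrite (germ_lim_ev cu oT I fW) (germ_lim_ev cu' oT I fW) E.
Qed.

(** [lim_ev c w z] is a germ functional at [x]; in particular a point of the chart whose coordinates
    of positive weight vanish belongs to N. *)
Lemma nu_of_coord x z : dom c x -> c x = dil w 0 z ->
  exists2 u, base u = x & nu_coord c w u = z.
Proof.
move=> cx xz; have [u [bx uE]] := nu_of_germ_point (lim_ev_point cw cx xz).
exists u => //; apply/rowP => a; rewrite mxE.
by rewrite (uE _ _ _ (mopen_dom Sc) cx (wt_coord a cw)) (lim_ev_coord a cw cx xz).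
Qed.

(** The image is described through the projection [dil w 0] alone, which makes it both open and
    stable under all dilations. *)
Lemma nu_chart_image V : V `<=` dom c ->
  nu_chart c w @` [set u | V (base u)] = [set z | (c @` V) (dil w 0 z)].
Proof.
move=> Vc; apply/seteqP; split=> [_ [u /= Vu <-]|z [x Vx xz]].
  by exists (base u) => //; rewrite nu_coord_base//; exact: Vc.
by have [u ux <-] := nu_of_coord (Vc _ Vx) xz; exists u => //=; rewrite ux.
Qed.

Lemma nu_chart_image_open V : mopen S V -> V `<=` dom c ->
  open (nu_chart c w @` [set u | V (base u)]).
Proof.
by move=> oV Vc; rewrite nu_chart_image//; apply: dil_open; exact: mopen_image Sc oV Vc.
Qed.

Lemma nu_chart_is_chart : is_chart (nu_chart c w).
Proof.
split; first exact: nu_chart_inj.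
by apply: nu_chart_image_open => //; exact: mopen_dom.
Qed.

Lemma germ_smooth_in V i f : mopen S V -> V `<=` dom c -> W i V f ->
  smooth_in (nu_chart c w) [set u | V (base u)] (fun u => germ u i f).
Proof.
move=> oV Vc fV; apply/smooth_in_subP; first by move=> u /Vc.
exists (fun z => lim_ev c w z i f); first by rewrite nu_chart_image//; exact: (lim_ev_smooth cw oV Vc fV).
by move=> u Vu; apply: (@germ_lim_ev _ _ V) => //; exact: Vc.
Qed.

End WeightedChart.

Lemma nu_charts_compatible c w c' w' u :
  weighted_coordinates W c w -> weighted_coordinates W c' w' ->
  dom c (base u) -> dom c' (base u) -> compatible_at (nu_chart c w) (nu_chart c' w') u.
Proof.
move=> cw cw' cu cu'; pose V := dom c `&` dom c'.
have [Sc _ _] := cw; have [Sc' _ _] := cw'.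
have oV : mopen S V by exact: (mopenI (mopen_dom Sc) (mopen_dom Sc')).
have Vc : V `<=` dom c by move=> x [].
have Vc' : V `<=` dom c' by move=> x [].
exists [set u | V (base u)]; split.
  split; [by split|by move=> v /Vc|by move=> v /Vc'| |].
    exact: nu_chart_image_open.
  exact: nu_chart_image_open.
split=> a.
  have := germ_smooth_in cw oV Vc (wt_restr (mopen_dom Sc') oV Vc' (wt_coord a cw')).
  by congr (smooth_in _ _ _); apply/funext => v; rewrite mxE.
have := germ_smooth_in cw' oV Vc' (wt_restr (mopen_dom Sc) oV Vc (wt_coord a cw)).
by congr (smooth_in _ _ _); apply/funext => v; rewrite mxE.
Qed.

Lemma weighted_chart_at x : exists c w, weighted_coordinates W c w /\ dom c x.
Proof.
have [c [w [Sc cx ws cW]]] := wt_model W x.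
by exists c, w; split.
Qed.

Lemma homog_smooth (E : smooth_structure R (nu W) n) k f :
  (forall c w, weighted_coordinates W c w -> charts E (nu_chart c w)) ->
  W k setT f -> smooth E setT (fun u => u (gr_class FT k f)).
Proof.
move=> Ec fW; apply: smooth_local => u _; have [c [w [cw cu]]] := weighted_chart_at (base u).
have [Sc _ _] := cw; have oc := mopen_dom Sc.
exists (nu_chart c w), [set v | dom c (base v)]; split=> //; first exact: Ec.
  by apply: (mopen_dom (Ec _ _ cw)).
have := germ_smooth_in cw oc (@subset_refl _ _) (wt_restr oT oc (@subsetT _ _) fW).
by congr (smooth_in _ _ _); apply/funext => v; rewrite germE.
Qed.

(** Hausdorff because the classes of global sections are smooth functions that separate the points;
    second countable because countably many weighted charts cover [M]. *)
Lemma nu_manifold_exists : exists E : manifold R (nu W) n,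
  forall c w, weighted_coordinates W c w -> charts E (nu_chart c w).
Proof.
pose A := [set d | exists c w, weighted_coordinates W c w /\ d = nu_chart c w].
have [|u|d d' u|E EA] := @atlas_smooth_structure R (nu W) n A.
- by move=> d [c [w [cw ->]]]; exact: nu_chart_is_chart.
- have [c [w [cw cu]]] := weighted_chart_at (base u).
  by exists (nu_chart c w) => //=; exists c, w.
- move=> [c [w [cw ->]]] [c' [w' [cw' ->]]]; exact: nu_charts_compatible.
have Ec c w : weighted_coordinates W c w -> charts E (nu_chart c w).
  by move=> cw; apply: EA; exists c, w.
have Eh : hausdorff_space (mtop E).
  apply: hausdorff_smooth_separation => u u' uu'.
  apply: contrapT => H; apply: uu'; apply: hom_alg_ext => i f fW.
  apply: contrapT => uf; apply: H.
  by exists (fun u => u (gr_class FT i f)) => //; exact: homog_smooth.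
have /choice[q qP] : forall x, exists q : pchart R M n * ('I_n -> nat),
    weighted_coordinates W q.1 q.2 /\ dom q.1 x.
  by move=> x; have [c [w [cw cx]]] := weighted_chart_at x; exists (c, w).
have [|e [_ eP]] := @lindelof _ _ _ _ setT (fun x => dom (q x).1) (mfd_second_countable S).
  by move=> x _; have [[Sc _ _] cx] := qP x; split=> //; exact: mopen_dom.
have Esc : @second_countable (mtop E).
  apply: (@second_countable_charts _ _ _ E
    (fun k => if e k is Some y then Some (nu_chart (q y).1 (q y).2) else None)).
    move=> k d; case: (e k) => // y [<-]; apply: Ec; exact: (qP y).1.
  move=> u; have [k [y [ek cy]]] := eP (base u) I.
  by exists k, (nu_chart (q y).1 (q y).2); rewrite ek.
by exists (Manifold Eh Esc).
Qed.

Lemma kappa_class t u i f : W i setT f ->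
  kappa W t u (gr_class FT i f) = t ^+ i * u (gr_class FT i f).
Proof.
move=> fW; rewrite -hom_scale -(gr_classZ (F := FT))//.
change (u (gr_dil (fun j => @subset_refl _ (fil FT j)) t (gr_class FT i f)) =
  u (gr_class FT i (t ^+ i *: f))); congr (u _).
have tfW : W i setT (t ^+ i *: f) by exact: (wt_Z _ oT fW).
rewrite (gr_classE (F := FT) fW) (gr_classE (F := FT) tfW) gr_dilE; congr gr_pi; apply: rees_ext => j /=; rewrite /unit_seq.
by case: eqP => [->//|_]; rewrite scaler0.
Qed.

Lemma base_kappa t u : base (kappa W t u) = base u.
Proof.
symmetry; apply/nu_overP => f fs; have f0 : W 0 setT f by rewrite wt_smooth//; exact: oT.
by rewrite kappa_class// expr0 mul1r (base_over u).2.
Qed.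

Lemma germ_kappa t u i V f : mopen S V -> V (base u) -> W i V f ->
  germ (kappa W t u) i f = t ^+ i * germ u i f.
Proof.
move=> oV Vu fV; have [psi [V' [[oV' V'x V'V psif] psifW]]] := wt_germ_extend oV Vu fV.
have fT := psifW _ oT; have fV' : W i V' (psi * f) by exact: psifW.
have V'k : V' (base (kappa W t u)) by rewrite base_kappa.
rewrite -(gp_ext (germ_pointP u) oV' V'x fV' psif).
by rewrite -(gp_ext (germ_pointP _) oV' V'k fV' psif) !germE// kappa_class.
Qed.

Lemma nu_coord_kappa c w t u : weighted_coordinates W c w -> dom c (base u) ->
  nu_coord c w (kappa W t u) = dil w t (nu_coord c w u).
Proof.
move=> cw cu; have [Sc _ _] := cw; apply/rowP => a; rewrite !mxE.
by rewrite (germ_kappa t (mopen_dom Sc) cu (wt_coord a cw)).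
Qed.

Lemma kappa1 u : kappa W 1 u = u.
Proof. by apply: hom_alg_ext => i f fW; rewrite kappa_class// expr1n mul1r. Qed.

Lemma kappaM s t u : kappa W (s * t) u = kappa W s (kappa W t u).
Proof.
by apply: hom_alg_ext => i f fW; rewrite !kappa_class// exprMn mulrA.
Qed.

Definition to_N x (Nx : N x) : N := SigSub (mem_set Nx).

Definition nu_proj u : N := to_N (base_N u).

Lemma nu_projE u : val (nu_proj u) = base u.
Proof. by []. Qed.

(** Multiplicative because i + j = 0 only for i = j = 0, and compatible with the filtration in
    degree 0 because functions of weight 1 vanish on N. *)
Lemma zero_germ_point x : N x ->
  germ_point W x (fun i f => if i is 0%N then f x else 0).
Proof.
move=> Nx; split.
- by case=> // U f g _ Ux _ fg; exact: fg.
- by case=> // i U f g *; rewrite addr0.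
- by case=> [|i] [|j] U f g *; rewrite ?mul0r ?mulr0.
- by [].
- by case=> // U f oU Ux fU; exact: (wt1_vanish hN oU fU Ux Nx).
Qed.

Lemma zero_section_exists (x : N) : exists u, base u = val x /\
  forall i V f, mopen S V -> V (val x) -> W i V f ->
    germ u i f = if i is 0%N then f (val x) else 0.
Proof. by apply: nu_of_germ_point; apply: zero_germ_point; exact: set_valP. Qed.

Definition zero_section (x : N) : nu W := proj1_sig (cid (zero_section_exists x)).

Lemma base_zero_section x : base (zero_section x) = val x.
Proof. exact: (proj2_sig (cid (zero_section_exists x))).1. Qed.

Lemma germ_zero_section x i V f : mopen S V -> V (val x) -> W i V f ->
  germ (zero_section x) i f = if i is 0%N then f (val x) else 0.
Proof. exact: (proj2_sig (cid (zero_section_exists x))).2. Qed.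

Lemma zero_section_proj u : zero_section (nu_proj u) = kappa W 0 u.
Proof.
apply: nu_germ_ext => [|i f fW]; first by rewrite base_zero_section base_kappa.
rewrite (germ_zero_section oT I fW) (germ_kappa 0 oT I fW).
case: i fW => [|i] fW; last by rewrite expr0n mul0r.
by rewrite mul1r (gp_0 (germ_pointP u) oT I fW).
Qed.

Lemma zero_sectionK : cancel zero_section nu_proj.
Proof. by move=> x; apply: val_inj; rewrite nu_projE base_zero_section. Qed.

Lemma nu_coord_zero_section c w x : weighted_coordinates W c w -> dom c (val x) ->
  nu_coord c w (zero_section x) = c (val x).
Proof.
move=> cw cx; have [Sc _ _] := cw; apply/rowP => a; rewrite mxE.
rewrite (germ_zero_section (mopen_dom Sc) cx (wt_coord a cw)).
case E : (w a) => [//|k]; rewrite (weighted_coord_N hN cw) ?E//.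
exact: set_valP.
Qed.

Section Structure.
Context (E : manifold R (nu W) n).
Hypothesis EW : forall c w, weighted_coordinates W c w -> charts E (nu_chart c w).

Lemma dil_joint_smooth w a :
  Csmooth setT (fun v : 'rV[R]_(1 + n) => dil w (v 0 (lshift n 0)) (rsubmx v) 0 a).
Proof.
rewrite (_ : (fun v => _) = (fun v : 'rV[R]_(1 + n) => v 0 (lshift n 0)) ^+ w a *
    (fun v : 'rV[R]_(1 + n) => v 0 (rshift 1 a))).
  by apply: CsmoothM openT _ _; [apply: CsmoothX openT _|]; exact: Csmooth_coord.
by apply/funext => v; rewrite fctE exprfctE !mxE.
Qed.

Lemma row_mx_image_open (O : set 'rV[R]_n) : open O ->
  open [set v : 'rV[R]_(1 + n) | O (rsubmx v)].
Proof.
move=> oO; pose p (v : 'rV[R]_(1 + n)) : 'rV[R]_n := rsubmx v.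
have pc v : {for v, continuous p}.
  apply: (@Csmooth_row_continuous _ _ _ setT) => // a.
  rewrite (_ : (fun v => _) = (fun v : 'rV[R]_(1 + n) => v 0 (rshift 1 a))).
    exact: Csmooth_coord.
  by apply/funext => u; rewrite mxE.
by have := open_preimage_on (@openT _) oO (fun v _ => pc v); rewrite setTI.
Qed.

Lemma nu_graded_bundle : graded_bundle E (kappa W).
Proof.
split; [exact: kappa1|by move=> s t u; exact: kappaM|move=> [t0 u0]].
have [c [w [cw cu]]] := weighted_chart_at (base u0).
have [Sc _ _] := cw.
exists (PChart (setT `*` dom (nu_chart c w))
  (fun z => row_mx (const_mx z.1) (nu_chart c w z.2))), (nu_chart c w),
  (setT `*` dom (nu_chart c w)), (fun (a : 'I_n) (v : 'rV[R]_(1 + n)) => dil w (v 0 (lshift n 0)) (rsubmx v) 0 a).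
split; [split=> //|split].
- by exists (PChart setT (fun t => const_mx t)), (nu_chart c w); split=> //; exact: EW.
- exact: EW.
- have -> : [set (row_mx (const_mx z.1) (nu_chart c w z.2) : 'rV[R]_(1 + n)) |
      z in setT `*` dom (nu_chart c w)] =
    [set v : 'rV[R]_(1 + n) | (nu_chart c w @` dom (nu_chart c w)) (rsubmx v)].
    apply/seteqP; split=> [_ [[t u] [_ du] <-]|v [u du uv]].
      by exists u => //; rewrite row_mxKr.
    exists (v 0 (lshift n 0), u) => //; move: uv => /= ->; rewrite -[RHS]hsubmxK; congr row_mx.
    by apply/rowP => i; rewrite !mxE ord1.
  apply: row_mx_image_open; exact: (nu_chart_is_chart cw).2.
- by move=> a; apply: Csmooth_sub (dil_joint_smooth w a).
- move=> [t u] [_ /= du]; rewrite base_kappa; split=> // a.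
  by rewrite /= (nu_coord_kappa t cw du) row_mxKr row_mxEl [const_mx _ _ _]mxE.
Qed.

Lemma nu_graded_bundle_over : graded_bundle_over E (kappa W) S nu_proj.
Proof.
split; first exact: nu_graded_bundle.
exists zero_section; split.
- move=> u; have [c [w [cw cu]]] := weighted_chart_at (base u).
  have [Sc _ _] := cw.
  exists (nu_chart c w), c, (dom (nu_chart c w)), (fun a z => dil w 0 z 0 a).
  split; [split=> //|split].
  + exact: EW.
  + exact: (nu_chart_is_chart cw).2.
  + by move=> a; apply: Csmooth_sub (@Csmooth_dil _ _ w 0 a).
  + by move=> v cv; split=> // a; rewrite -(nu_coord_base cw).
- move=> x; have [c [w [cw cx]]] := weighted_chart_at (val x).
  have [Sc _ _] := cw.
  exists c, (nu_chart c w), (dom c), (fun a z => z 0 a).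
  split; [split=> //|split].
  + exact: EW.
  + exact: (charts_chart Sc).2.
  + by move=> a; exact: Csmooth_coord.
  + move=> y cy /=; rewrite base_zero_section; split=> // a.
    by rewrite (nu_coord_zero_section cw).
- exact: zero_sectionK.
- exact: zero_section_proj.
Qed.

Lemma nu_chart_graded c w : weighted_coordinates W c w ->
  graded_coordinates E (kappa W) w (nu_chart c w).
Proof.
move=> cw; split; first exact: EW.
  exists (dom (nu_chart c w)); first exact: mopen_dom (EW cw).
  by apply/seteqP; split=> u /=; rewrite base_kappa.
by move=> a t u cu; rewrite /= (nu_coord_kappa t cw cu) mxE.
Qed.

End Structure.

Lemma nu_restrE U : nu_restr N U = [set u | U (base u)].
Proof.
apply/seteqP; split=> [u [x [Ux Nx /nu_overP E]]|u /= Uu]; first by rewrite /= -E.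
by exists (base u); split=> //; [exact: base_N|exact/nu_overP].
Qed.

Section Restriction.
Context (U : set M) (oU : mopen S U).
Local Notation FU := (wt_filtration W oU).

Lemma nu_incl_class (v : nu_on W oU) i f : W i setT f ->
  nu_incl W oU v (gr_class FT i f) = v (gr_class FU i f).
Proof.
move=> fW; have fU : W i U f by exact: (wt_restr oT oU (@subsetT _ _) fW).
rewrite /= (gr_classE (F := FT) fW) gr_dilE (gr_classE (F := FU) fU).
congr (v (gr_pi _)); apply: rees_ext => j /=.
by rewrite expr1n scale1r.
Qed.

Lemma nu_incl_base (v : nu_on W oU) x : hom_over v x -> base (nu_incl W oU v) = x.
Proof.
move=> [Ux vx]; symmetry; apply/nu_overP => f fs.
have f0 : W 0 setT f by rewrite wt_smooth//; exact: oT.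
by rewrite nu_incl_class// vx//; exact: (smooth_sub (@subsetT _ _) fs).
Qed.

Lemma nu_incl_germ (v : nu_on W oU) x i f : hom_over v x -> W i U f ->
  germ (nu_incl W oU v) i f = v (gr_class FU i f).
Proof.
move=> vx fU; have [Ux _] := vx.
have uE i' f' : W i' setT f' ->
    nu_incl W oU v (gr_class FT i' f') = germ_ev v x i' f'.
  by move=> fW; rewrite nu_incl_class// germ_evE//; exact: (wt_restr oT oU (@subsetT _ _) fW).
have [_ H] := germ_of_hom (germ_ev_point vx) uE.
by rewrite (H i U f oU Ux fU); exact: germ_evE.
Qed.

(** On either side a point over [x] is a germ functional at [x], and germs at a point of [U] do not
    distinguish sections over [U] from global ones. *)
Lemma nu_incl_bij : set_bij [set: nu_on W oU] (nu_restr N U) (nu_incl W oU).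
Proof.
rewrite nu_restrE; split.
- move=> v _ /=; have [x vx] := hom_over_exists v (mfd_second_countable S).
  by rewrite (nu_incl_base vx); exact: vx.1.
- move=> v v' _ _ E; apply: hom_alg_ext => i f fU.
  have [x vx] := hom_over_exists v (mfd_second_countable S).
  have [x' vx'] := hom_over_exists v' (mfd_second_countable S).
  by rewrite -(nu_incl_germ vx fU) -(nu_incl_germ vx' fU) E.
- move=> u /= Uu; have [v [vx vE]] := hom_of_germ_point oU Uu (germ_pointP u).
  exists v => //; apply: nu_germ_ext => [|i f fW]; first exact: nu_incl_base.
  have fU : W i U f by exact: (wt_restr oT oU (@subsetT _ _) fW).
  by rewrite (nu_incl_germ vx fU) vE.
Qed.

End Restriction.

End NormalBundle.

(** * Homogeneous functions *)

(* Differentiate H(t . z) = t^k H(z) m times with respect to t. *)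
Lemma homogeneous_derivatives (R : realType) (n k : nat) (w : 'I_n -> nat)
    (O : set 'rV[R]_n) (H : 'rV[R]_n -> R) :
  open O -> (forall t z, O z -> O (dil w t z)) -> Csmooth O H ->
  (forall t z, O z -> H (dil w t z) = t ^+ k * H z) ->
  forall m, exists (J : finType) (s : J -> 'I_n -> nat) (Q : J -> 'rV[R]_n -> R),
    [/\ forall j, Csmooth O (Q j),
        forall j, (m <= \sum_a s j a * w a)%N \/ forall z, O z -> Q j z = 0 &
        forall t z, O z -> (k ^_ m)%:R * t ^+ (k - m) * H z =
          \sum_j t ^+ ((\sum_a s j a * w a)%N - m) * Q j (dil w t z) *
            \prod_a z 0 a ^+ s j a].
Proof.
move=> oO Ot Hs Hk; elim=> [|m [J [s [Q [Qs e_m E]]]]].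
  exists 'I_1, (fun _ _ => 0%N), (fun _ => H); split=> // [j|t z Oz]; first by left.
  rewrite ffactn0 mul1r subn0 big_ord1 big1 ?subn0 => [|a _]; last by rewrite mul0n.
  by rewrite expr0 mul1r Hk// big1 ?mulr1// => a _; rewrite expr0.
pose e j := (\sum_a s j a * w a)%N.
(* The product rule splits term j: [None] differentiates the power of t, and [Some a] the
   coefficient in direction a, where the chain rule brings out w_a t^(w_a - 1) z_a and so raises the
   exponent of z_a by one. *)
pose s' (x : J * option 'I_n) b := (s x.1 b + (x.2 == Some b))%N.
pose Q' (x : J * option 'I_n) : 'rV[R]_n -> R :=
  if x.2 is Some a then cst (w a)%:R * 'D_(delta_mx 0 a) (Q x.1)
  else cst (e x.1 - m)%:R * Q x.1.
have eN j : (\sum_a s' (j, None) a * w a)%N = e j.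
  by apply: eq_bigr => a _; rewrite /s' addn0.
have eS j a : (\sum_b s' (j, Some a) b * w b)%N = (e j + w a)%N.
  rewrite /s' /=; under eq_bigr do rewrite mulnDl.
  rewrite big_split /=; congr addn; rewrite (bigD1 a)//= eqxx mul1n big1 ?addn0// => b ba.
  by rewrite (_ : (Some a == Some b) = false) ?mul0n//; apply/eqP => -[ab]; rewrite ab eqxx in ba.
have dQ0 j a : (forall z, O z -> Q j z = 0) -> forall z, O z -> 'D_(delta_mx 0 a) (Q j) z = 0.
  move=> Q0 z Oz; rewrite (eq_on_derive (V := O) (g := cst 0) _ oO Oz)//.
  by rewrite derive_cst.
exists (J * option 'I_n)%type, s', Q'; split.
- move=> [j [a|]]; apply: CsmoothM => //=; try exact: Csmooth_cst.
  exact: Csmooth_derive.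
(* The exponent of t is a truncated difference. The alternative of a vanishing coefficient records
   the terms that were differentiated away: those with factor e_j - m = 0 or w_a = 0. *)
- move=> [j [a|]]; rewrite ?eN ?eS /Q' /=.
    have [wa|wa] := posnP (w a); first by right=> z _; rewrite fctE /= wa mul0r.
    have [ej|Q0] := e_m j; first by left; rewrite -addn1; exact: leq_add.
    by right=> z Oz; rewrite fctE dQ0// mulr0.
  have [ej|Q0] := e_m j; last by right=> z Oz; rewrite fctE Q0// mulr0.
  have [mj|jm] := ltnP m (e j); first by left.
  by right=> z _; rewrite fctE /= (eqP jm) mul0r.
- move=> t z Oz.
  pose P j := \prod_a z 0 a ^+ s j a.
  pose T j (t : R) := t ^+ (e j - m) * Q j (dil w t z) * P j.
  have dE : (fun t : R => (k ^_ m)%:R * t ^+ (k - m) * H z) = (fun t => \sum_j T j t).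
    by apply/funext => t'; exact: E.
  have dL : is_derive t (1 : R) (fun t : R => (k ^_ m)%:R * t ^+ (k - m) * H z)
      ((k ^_ m.+1)%:R * t ^+ (k - m.+1) * H z).
    have dX : is_derive t (1 : R) (fun t : R => t ^+ (k - m)) ((k - m)%:R * t ^+ (k - m).-1).
      split; first exact: exprn_derivable.
      by rewrite exp_derive [_ *: 1]mulr1.
    rewrite (_ : (fun t : R => _) = (k ^_ m)%:R * H z *: (fun t : R => t ^+ (k - m))).
      apply: (is_derive_eq (is_deriveZ _ dX)).
      rewrite ffactnSr natrM subnS.
      change ((k ^_ m)%:R * H z * ((k - m)%:R * t ^+ (k - m).-1) =
        (k ^_ m)%:R * (k - m)%:R * t ^+ (k - m).-1 * H z).
      by ring.
    apply/funext => t'; change ((k ^_ m)%:R * t' ^+ (k - m) * H z = (k ^_ m)%:R * H z * t' ^+ (k - m)).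
    by ring.
  have dF a : is_derive t (1 : R) (fun t : R => dil w t z 0 a) ((w a)%:R * t ^+ (w a).-1 * z 0 a).
    rewrite (_ : (fun t : R => _) = z 0 a *: (fun t : R => t ^+ w a)); last first.
      by apply/funext => t'; rewrite mxE; exact: mulrC.
    have dX : is_derive t (1 : R) (fun t : R => t ^+ w a) ((w a)%:R * t ^+ (w a).-1).
      split; first exact: exprn_derivable.
      by rewrite exp_derive [_ *: 1]mulr1.
    by apply: (is_derive_eq (is_deriveZ _ dX)); exact: mulrC.
  have dT j : is_derive t (1 : R) (T j)
      (\sum_(o : option 'I_n) t ^+ ((\sum_a s' (j, o) a * w a)%N - m.+1) * Q' (j, o) (dil w t z) *
         \prod_a z 0 a ^+ s' (j, o) a).
    have dX : is_derive t (1 : R) (fun t : R => t ^+ (e j - m)) ((e j - m)%:R * t ^+ (e j - m).-1).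
      split; first exact: exprn_derivable.
      by rewrite exp_derive [_ *: 1]mulr1.
    have [dQ1 dQ2] := derive_comp_row (F := fun t : R => dil w t z) (x := t) (v := (1 : R))
      oO (Ot t z Oz) (Qs j 1%N) (fun a => @ex_derive _ _ _ _ _ _ _ (dF a)).
    have dQ : is_derive t (1 : R) (Q j \o (fun t : R => dil w t z))
        (\sum_(a < n) 'D_(delta_mx 0 a) (Q j) (dil w t z) * ((w a)%:R * t ^+ (w a).-1 * z 0 a)).
      split=> //; rewrite dQ2; apply: eq_bigr => a _; congr (_ * _).
      by have /@derive_val := dF a.
    rewrite (_ : T j = P j *: ((fun t : R => t ^+ (e j - m)) * (Q j \o (fun t : R => dil w t z)))); last first.
      by apply/funext => t'; rewrite /T; exact: mulrC.
    apply: (is_derive_eq (is_deriveZ _ (is_deriveM dX dQ))).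
    rewrite (bigD1 None)//= eN (_ : \prod_a _ = P j); last first.
      by apply: eq_bigr => a _; rewrite /s' addn0.
    rewrite (reindex_omap Some id) => [|[a|] //].
    set S1 := (\sum_(a < n) _); set S2 := (X in _ = _ + X).
    have -> : S2 = P j * t ^+ (e j - m) * S1.
      rewrite /S2 (eq_bigl predT) => [|a]; last by rewrite /= ?eqxx.
      rewrite /S1 mulr_sumr; apply: eq_bigr => a _.
      rewrite eS /Q' /=.
      have -> : (cst (w a)%:R * 'D_(delta_mx 0 a) (Q j)) (dil w t z) =
        (w a)%:R * 'D_(delta_mx 0 a) (Q j) (dil w t z) by [].
      have -> : \prod_b z 0 b ^+ s' (j, Some a) b = P j * z 0 a.
        rewrite /P /s' /=; under eq_bigr do rewrite exprD.
        rewrite big_split /=; congr (_ * _); rewrite (bigD1 a)//= eqxx expr1 big1 ?mulr1// => b ba.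
        by rewrite (_ : (Some a == Some b) = false) ?expr0//; apply/eqP => -[ab]; rewrite ab eqxx in ba.
      have [wa|wa] := posnP (w a); first by rewrite wa !mul0r !mulr0 mul0r.
      have [ej|Q0] := e_m j; last first.
        by rewrite (dQ0 j a Q0 _ (Ot t z Oz)) !(mulr0, mul0r).
      have -> : (e j + w a - m.+1 = (e j - m) + (w a).-1)%N by move: ej wa; rewrite -/(e j); lia.
      by rewrite exprD; ring.
    rewrite /Q' /= subnS.
    change (P j * (t ^+ (e j - m) * S1 + Q j (dil w t z) * ((e j - m)%:R * t ^+ (e j - m).-1)) =
      t ^+ (e j - m).-1 * ((e j - m)%:R * Q j (dil w t z)) * P j + P j * t ^+ (e j - m) * S1).
    by ring.
  have /@derive_val <- := dL; rewrite dE.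
  rewrite (_ : (fun t : R => _) = \sum_(i < #|J|) T (enum_val i)); last first.
    apply/funext => t'; rewrite fct_sumE.
    by rewrite (reindex_onto (@enum_val J J) enum_rank) //=;
      [under eq_bigl do rewrite enum_valK eqxx|move=> j _; rewrite enum_rankK].
  have dS : is_derive t (1 : R) (\sum_(i < #|J|) T (enum_val i)) _ :=
    is_derive_sum (fun i => dT (enum_val i)).
  have /@derive_val -> := dS.
  rewrite -(pair_bigA _ (fun j o => t ^+ ((\sum_a s' (j, o) a * w a)%N - m.+1) *
     Q' (j, o) (dil w t z) * \prod_a z 0 a ^+ s' (j, o) a)) /=.
  symmetry; rewrite (reindex_onto (@enum_val J J) enum_rank) //=;
    [by under eq_bigl do rewrite enum_valK eqxx|by move=> j _; rewrite enum_rankK].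
Qed.

(** At t = 0 the k-th derivative is k! H(z) on one side; on the other, terms of weight above k carry
    a positive power of t, and those of weight below k have coefficient 0. *)
Lemma homogeneous_polynomial (R : realType) (n k : nat) (w : 'I_n -> nat)
    (O : set 'rV[R]_n) (H : 'rV[R]_n -> R) :
  open O -> (forall t z, O z -> O (dil w t z)) -> Csmooth O H ->
  (forall t z, O z -> H (dil w t z) = t ^+ k * H z) ->
  exists m (s : 'I_m -> 'I_n -> nat) (Q : 'I_m -> 'rV[R]_n -> R),
    [/\ forall j, Csmooth O (Q j), forall j, (\sum_a s j a * w a = k)%N &
        forall z, O z -> H z = \sum_j Q j (dil w 0 z) * \prod_a z 0 a ^+ s j a].
Proof.
move=> oO Ot Hs Hk.
have [J [s [Q [Qs e_k E]]]] := homogeneous_derivatives oO Ot Hs Hk k.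
pose e j := (\sum_a s j a * w a)%N; pose A := [set j | e j == k]%SET.
exists #|A|, (fun i => s (enum_val i)), (fun i => cst (k`!%:R)^-1 * Q (enum_val i)); split.
- by move=> j; apply: CsmoothM => //; exact: Csmooth_cst.
- by move=> i; have := enum_valP i; rewrite inE => /eqP.
move=> z Oz; have := E 0 z Oz; rewrite subnn expr0 mulr1 ffactnn => Ez.
have k0 : k`!%:R != 0 :> R by rewrite pnatr_eq0 -lt0n fact_gt0.
apply: (mulfI k0); rewrite Ez mulr_sumr.
rewrite -(big_enum_val (A := mem A) (fun j => k`!%:R * ((cst (k`!%:R)^-1 * Q j) (dil w 0 z) *
  \prod_a z 0 a ^+ s j a))) [RHS]big_mkcond; apply: eq_bigr => j _.
rewrite inE -/(e j) expr0n fctE /= mulrA mulVKf// subn_eq0.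
have [->|ne] := eqVneq (e j) k; first by rewrite leqnn mul1r.
have [kj|Q0] := e_k j; last by rewrite Q0 ?mulr0 ?mul0r//; exact: Ot.
by rewrite leq_eqVlt (negbTE ne) ltnNge kj mul0r mul0r.
Qed.

(** * Homogeneous functions of degree k as elements of gr_k *)

Section PolynomialFunctions.
Context (R : realType) (M : Type) (n r : nat) (S : manifold R M n).
Context (W : weighting S r) (N : set M) (hN : weighted_pair W N).
Implicit Types (U V : set M) (f g : M -> R) (c : pchart R M n) (w : 'I_n -> nat).
Implicit Types (u : nu W).
Local Notation oT := (@mopenT R M n S).
Local Notation FT := (wt_filtration W oT).

Lemma smooth_wt0 U f : mopen S U -> smooth S U f <-> W 0 U f.
Proof. by move=> oU; rewrite wt_smooth. Qed.

Lemma wt_vanish U f : mopen S U -> smooth S U f ->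
  (forall x, U x -> N x -> f x = 0) -> W 1 U f.
Proof. by move=> oU fU f0; rewrite (hN.2 _ oU). Qed.

Lemma wt_monomial c w U (sigma : 'I_n -> nat) : weighted_coordinates W c w ->
  mopen S U -> U `<=` dom c ->
  W (\sum_a sigma a * w a)%N U (\prod_a (fun x => c x 0 a) ^+ sigma a).
Proof.
move=> cw oU Uc; have [Sc _ _] := cw.
apply: wt_weights_prod => // a; apply: wt_weights_exp => //.
by apply: (wt_restr (mopen_dom Sc) oU Uc); exact: wt_coord.
Qed.

(* On each fiber the homogeneous approximation of f is a polynomial in the     *)
(* coordinates of positive weight; if it vanishes, then its coefficients       *)
(* vanish on N, and so have weight at least 1.                                *)
Lemma germ_zero_wt i f : W i setT f -> (forall u, germ u i f = 0) -> W i.+1 setT f.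
Proof.
move=> fT f0; apply: wt_local => [|x _]; first exact: oT.
have [c [w [cw cx]]] := weighted_chart_at W x.
have [V [m [s [g [oV Vx _ Vc [si gs fE]]]]]] := wt_local_form cw cx oT I fT.
exists V; split=> //.
have [Sc _ _] := cw.
have gV j : smooth S V (g j) by exact: smooth_sub (gs j).
pose e j := (\sum_a s j a * w a)%N.
(* The coordinates of weight 0 are absorbed into the coefficients [G j]; [t j] retains the exponents
   of positive weight. *)
pose t j a := if w a == 0%N then 0%N else s j a.
pose z0 j : M -> R := \prod_(a | w a == 0%N) (fun y => c y 0 a) ^+ s j a.
pose G j : M -> R := if e j == i then g j * z0 j else cst 0.
have cV a : smooth S V (fun y => c y 0 a).
  by apply: smooth_sub Vc _; exact: smooth_coord.
have z0V j : smooth S V (z0 j).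
  apply: smooth_prod => // a _; elim: (s j a) => [|k IHk]; first exact: smooth_cst.
  by rewrite exprS; exact: smoothM.
have GV j : smooth S V (G j).
  by rewrite /G; case: ifP => _; [exact: smoothM|exact: smooth_cst].
have split_prod j (q : 'I_n -> R) : \prod_a q a ^+ s j a =
    (\prod_(a | w a == 0%N) q a ^+ s j a) * \prod_a q a ^+ t j a.
  rewrite (bigID (fun a => w a == 0%N)) /=; congr (_ * _).
  by rewrite [LHS]big_mkcond; apply: eq_bigr => a _; rewrite /t; case: (w a == 0%N).
have coef0 y sigma : V y -> N y -> \sum_(j < m | [forall a, t j a == sigma a]) G j y = 0.
  move=> Vy Ny; apply: monomials_free => zeta.
  (* Over a point [y] of N the coordinates of weight 0 are those of [y], and the others are free;
     this freedom is what [monomials_free] requires. *)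
  pose z := \row_a (if w a == 0%N then c y 0 a else zeta 0 a).
  have yz : c y = dil w 0 z.
    rewrite -(weighted_coord_dil0 hN cw (Vc _ Vy) Ny); apply/rowP => b; rewrite !mxE expr0n.
    by case: eqP => _; rewrite ?mul1r ?mul0r.
  have [u uy uz] := nu_of_coord cw (Vc _ Vy) yz.
  have := f0 u; rewrite (germ_lim_ev hN cw _ oT I fT) ?uy; last exact: Vc.
  rewrite uz (lim_ev_monomial_sum Sc yz oV Vy Vc si gV fE) => E0.
  rewrite -[RHS]E0 [RHS]big_mkcond; apply: eq_bigr => k _.
  rewrite /G -/(e k); case: eqP => _; last by rewrite /= mul0r.
  rewrite fctE /z0 fct_prodE split_prod -mulrA; congr (_ * (_ * _)).
    by apply: eq_bigr => b wb; rewrite exprfctE mxE wb.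
  by apply: eq_bigr => b _; rewrite mxE /t; case: ifP.
(* A bound for all exponents, so that terms with the same monomial can be collected over a finite
   type: only the collected coefficients vanish on N. *)
pose K := (\sum_j \sum_a t j a)%N.
have tK j a : (t j a < K.+1)%N by rewrite ltnS /K (bigD1 j)//= (bigD1 a)//= -!addnA leq_addr.
pose p j : {ffun 'I_n -> 'I_K.+1} := [ffun a => inord (t j a)].
pose Mono (sigma : 'I_n -> nat) : M -> R := \prod_a (fun y => c y 0 a) ^+ sigma a.
pose val_ (sigma : {ffun 'I_n -> 'I_K.+1}) a : nat := sigma a.
have pE j sigma : (p j == sigma) = [forall a, t j a == val_ sigma a].
  apply/eqP/forallP => [<- b|H]; first by rewrite /val_ /p ffunE inordK.
  by apply/ffunP => a; apply: ord_inj; rewrite /p ffunE inordK//; exact/eqP/H.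
have tw j : (\sum_a t j a * w a = e j)%N.
  by apply: eq_bigr => a _; rewrite /t; case: eqP => // ->; rewrite !muln0.
have gterm j y : (g j * Mono (s j)) y = g j y * \prod_a c y 0 a ^+ s j a.
  by rewrite fctE /Mono fct_prodE; congr (_ * _); apply: eq_bigr => a _; rewrite exprfctE.
(* [F1] consists of terms of weight above [i]. In [F2] each collected coefficient has weight 1 and
   its monomial weight [i], which adds up to [i.+1]. *)
pose F1 : M -> R := \sum_(j < m | e j != i) g j * Mono (s j).
pose F2 : M -> R := \sum_(sigma | (\sum_a val_ sigma a * w a == i)%N)
  (\sum_(j < m | p j == sigma) G j) * Mono (val_ sigma).
have fF y : V y -> (F1 + F2) y = f y.
  move=> Vy; rewrite fE// /monomial_sum (bigID (fun j => e j != i)) /=; congr (_ + _).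
    by rewrite /F1 fct_sumE; apply: eq_bigr => j _; exact: gterm.
  rewrite /F2 fct_sumE (partition_big p (fun sigma => (\sum_a val_ sigma a * w a == i)%N)) /=.
    apply: eq_bigr => sigma _; rewrite fctE fct_sumE mulr_suml.
    rewrite (bigID (fun j => e j == i)) /= [X in _ + X]big1 ?addr0 => [|j /andP[_ ji]]; last first.
      by rewrite /G (negbTE ji) /= mul0r.
    rewrite (eq_bigl (fun j => ~~ (e j != i) && (p j == sigma))); last first.
      by move=> j; rewrite negbK andbC.
    apply: eq_bigr => j /andP[]; rewrite negbK => ji; rewrite pE => /forallP js.
    rewrite /G ji fctE /z0 /Mono !fct_prodE split_prod -mulrA; congr (_ * (_ * _)).
      by apply: eq_bigr => a _; rewrite exprfctE.
    by apply: eq_bigr => a _; rewrite exprfctE (eqP (js a)).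
  move=> j; rewrite negbK => /eqP <-; rewrite -(tw j); apply/eqP; apply: eq_bigr => a _.
  by rewrite /val_ /p ffunE inordK.
apply: (wt_congr oV fF); apply: wt_D => //.
  apply: wt_weights_sum => // j ji; apply: (wt_le oV (j := e j)).
    by rewrite ltn_neqAle eq_sym ji si.
  by apply: wt_ideal => //; exact: wt_monomial.
apply: wt_weights_sum => // sigma /eqP si'.
rewrite -add1n -si'; apply: wt_M => //; last exact: wt_monomial.
apply: wt_vanish => // [|y Vy Ny]; first by apply: smooth_sum => // j _; exact: GV.
rewrite fct_sumE -[RHS](coef0 y (val_ sigma) Vy Ny).
by apply: eq_bigl => j; exact: pE.
Qed.

(** Evaluation at [kappa W t u] multiplies the part of degree j by t^j, so the total is a polynomial
    in t that vanishes identically, and each degree vanishes separately. *)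
Lemma gr_eval_inj (a : gr FT) : (forall u : nu W, u a = 0) -> a = 0.
Proof.
have [m [f [Ff ->]]] := gr_decomp a => H.
have cf (u : nu W) i : (i < m)%N -> u (gr_class FT i (f i)) = 0.
  move=> im; pose p := \poly_(j < m) u (gr_class FT j (f j)).
  have pT t : p.[t] = 0.
    rewrite /p horner_poly -[RHS](H (kappa W t u)) rmorph_sum; apply: eq_bigr => j _.
    by rewrite (kappa_class t u (Ff j)) mulrC.
  have p0 : p = 0.
    apply/eqP; apply: contraT => pn0.
    have := @max_poly_roots _ p [seq j%:R | j <- iota 0 (size p)] pn0.
    rewrite size_map size_iota ltnn; apply.
      by apply/allP => _ /mapP[j _ ->]; rewrite /root pT.
    by rewrite map_inj_uniq ?iota_uniq// => j k /eqP; rewrite eqr_nat => /eqP.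
  by have := congr1 (fun q : {poly R} => q`_i) p0; rewrite coef_poly im coef0.
apply: big1 => i _; apply: gr_class_eq0; apply: germ_zero_wt; first exact: Ff.
by move=> u; rewrite germE; [exact: cf|exact: Ff].
Qed.

Section Structure.
Context (E : manifold R (nu W) n).
Hypothesis EW : forall c w, weighted_coordinates W c w -> charts E (nu_chart W c w).

Lemma gr_deg_homog k (a : gr FT) : gr_deg k a -> homog E (kappa W) k (@gr_eval R M FT a).
Proof.
move=> [f fW <-]; split; first exact: (homog_smooth hN EW fW).
by move=> t u; exact: kappa_class.
Qed.

(** The coefficients of the polynomial are functions on the base; extended to [M] as constant along
    the projection y |-> [dil w 0 (c y)], they turn the polynomial into a section of weight [k].
    Away from N the section 0 serves, since no point lies above. *)
Lemma homog_local k h x : homog E (kappa W) k h -> exists V f,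
  [/\ mopen S V, V x, W k V f & forall u, V (base u) -> h u = germ u k f].
Proof.
move=> [hs hk]; have [Nx|nNx] := pselect (N x); last first.
  have oN : mopen S (~` N) by exact: closed_openC hN.1.1.
  exists (~` N), 0; split=> //; first exact: wt_0.
  by move=> u; have := base_N hN u.
have [c [w [cw cx]]] := weighted_chart_at W x; have [Sc _ _] := cw.
pose O := [set z | (c @` dom c) (dil w 0 z)].
have oO : open O by apply: dil_open; exact: (charts_chart Sc).2.
have imE : nu_chart W c w @` dom (nu_chart W c w) = O by exact: (nu_chart_image hN cw).
have [H HO hH] : exists2 H, Csmooth O H & forall u, dom c (base u) -> h u = H (nu_coord c w u).
  have := hs _ (EW cw); move=> /(smooth_in_sub (@subsetT _ (dom (nu_chart W c w)))).
  by move=> /(smooth_in_subP _ (@subset_refl _ _)); rewrite imE.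
have Odil t z : O z -> O (dil w t z) by rewrite /O /= dilM mul0r.
have HO' z : O z -> exists2 u : nu W, dom c (base u) & nu_coord c w u = z.
  by rewrite -imE => -[u cu <-]; exists u.
have Hhom t z : O z -> H (dil w t z) = t ^+ k * H z.
  move=> /HO'[u cu <-]; rewrite -hH// -(nu_coord_kappa t cw cu) -hk hH//.
  by rewrite /= base_kappa.
have [m [s [Q [Qs sk HQ]]]] := homogeneous_polynomial oO Odil HO Hhom.
have oOd : open [set z | O (dil w 0 z)] by exact: dil_open.
(* The points whose projection stays in the image of the chart, so that the coefficients can be
   evaluated there. *)
pose V := dom c `&` [set y | O (c y)].
have Vc : V `<=` dom c by move=> y [].
have oV : mopen S V.
  apply: (mopen_in_chart Sc Vc); rewrite (_ : _ @` _ = c @` dom c `&` O).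
    by apply: openI => //; exact: (charts_chart Sc).2.
  apply/seteqP; split=> [_ [y [cy Oy] <-]|_ [[y cy <-] Oy]]; last by exists y.
  by split=> //; exists y.
have Vx : V x by split=> //; exists x => //; rewrite (weighted_coord_dil0 hN cw).
pose g j y := Q j (dil w 0 (c y)).
have gV j : smooth S V (g j).
  apply: smooth_local => y Vy; exists c, V; split=> //.
  apply/(smooth_in_subP _ Vc); exists (Q j \o dil w 0) => //.
  apply: (@Csmooth_comp _ _ _ _ O) => //; first exact: mopen_image Sc oV Vc.
    by move=> _ [y' [cy' Oy'] <-]; exact: Odil.
  by move=> a; apply: Csmooth_sub (@Csmooth_dil _ _ w 0 a).
pose f := \sum_(j < m) g j * \prod_a (fun y => c y 0 a) ^+ s j a.
have fV : W k V f.
  apply: wt_weights_sum => // j _; rewrite -(sk j); apply: wt_ideal => //.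
  exact: wt_monomial.
have fE y : V y -> f y = monomial_sum c s g y.
  move=> _; rewrite /f fct_sumE; apply: eq_bigr => j _; rewrite fctE fct_prodE.
  by congr (_ * _); apply: eq_bigr => a _; rewrite exprfctE.
exists V, f; split=> // u Vu; have cu := Vc _ Vu.
rewrite (germ_lim_ev hN cw cu oV Vu fV) hH//.
have ks j : (k <= \sum_a s j a * w a)%N by rewrite sk.
rewrite (lim_ev_monomial_sum Sc (nu_coord_base hN cw cu) oV Vu Vc ks gV fE).
rewrite HQ; last by rewrite -imE; exists u.
rewrite [RHS]big_mkcond; apply: eq_bigr => j _; rewrite sk eqxx /g.
by rewrite (nu_coord_base hN cw cu) dilM mul0r.
Qed.

Lemma homog_global k h : homog E (kappa W) k h ->
  exists2 f, W k setT f & forall u, h u = germ u k f.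
Proof.
move=> hh.
have /choice[D DP] : forall x, exists D : set M * (M -> R) * (M -> R) * set M,
    [/\ mopen S D.1.1.1, D.1.1.1 x, W k D.1.1.1 D.1.1.2 &
        forall u, D.1.1.1 (base u) -> h u = germ u k D.1.1.2] /\
    [/\ smooth S setT D.1.2, D.1.2 x = 1, mopen S D.2, forall y, D.1.1.1 y \/ D.2 y &
        forall y, D.2 y -> D.1.2 y = 0].
  move=> x; have [V [f [oV Vx fV hf]]] := homog_local x hh.
  have [psi [psis [[V' [oV' V'x V'V psi1]] [Z [oZ VZ psi0]]]]] := smooth_bump oV Vx.
  by exists (V, f, psi, Z); split; split=> //=; exact: psi1.
pose psi x := (D x).1.2.
have psis x : smooth S setT (psi x) by have [_ []] := DP x.
have [|e [_ eP]] := @lindelof _ _ _ _ setT (fun x => setT `&` [set y | psi x y != 0])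
    (mfd_second_countable S).
  move=> x _; split; first by apply: smooth_neq0_open; [exact: oT|exact: psis].
  by split=> //=; rewrite /psi; have [_ [_ -> _ _ _]] := DP x; rewrite oner_eq0.
(* Squares make the weights nonnegative, so that their sum [G] is positive and can be divided by. *)
pose F j := if e j is Some y then psi y * psi y else 0.
have Fs j : smooth S setT (F j).
  rewrite /F; case: (e j) => [y|]; last exact: smooth_cst.
  by apply: smoothM; [exact: oT|exact: psis|exact: psis].
have F0 j x : setT x -> 0 <= F j x.
  by move=> _; rewrite /F; case: (e j) => [y|]; rewrite ?fctE -?expr2 ?sqr_ge0.
have [|q [qs q01 qpos qlf]] := @locally_finite_refinement _ _ _ S setT F oT Fs F0.
  move=> x _; have [j [y [ej [_ yx]]]] := eP x I; exists j.
  by rewrite /F ej fctE -expr2 lt_neqAle eq_sym sqrf_eq0 yx sqr_ge0.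
pose H j := F j * q j.
have Hs j : smooth S setT (H j) by apply: smoothM; [exact: oT|exact: Fs|exact: qs].
have H0 j x : 0 <= H j x.
  by rewrite /H fctE mulr_ge0//; [exact: F0|have /andP[] := q01 j x].
have [G GE] := locally_finite_sum qlf.
have Gloc x : exists V K, [/\ mopen S V, V x,
    (forall j y, (K <= j)%N -> V y -> H j y = 0) & forall y, V y -> G y = \sum_(j < K) H j y].
  have [V [oV Vx _ [K KV]]] := qlf x I; exists V, K; split=> // y Vy.
  by apply: GE => // j Kj; exact: KV.
have Gs : smooth S setT G.
  apply: smooth_local => x _; have [V [K [oV Vx _ GV]]] := Gloc x.
  apply: (@smooth_smooth_at _ _ _ _ V) => //.
  apply: (@smooth_ext _ _ _ _ _ (\sum_(j < K) H j)).
    by move=> y Vy; rewrite fct_sumE GV.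
  by apply: smooth_sum => // j _; exact: smooth_sub (@subsetT _ _) (Hs j).
have Gpos x : 0 < G x.
  have [j jpos] := qpos x I; have [V [K [_ Vx KV GV]]] := Gloc x.
  have jK : (j < K)%N.
    by rewrite ltnNge; apply/negP => Kj; move: jpos; rewrite -[_ * _]/(H j x) KV// ltxx.
  rewrite GV// (bigD1 (Ordinal jK))//= ltr_wpDr// sumr_ge0// => i _; exact: H0.
have Gi : smooth S setT (fun x => (G x)^-1).
  by apply: smoothV => // [|x _]; [exact: oT|rewrite gt_eqF].
pose P j := H j * (fun x => (G x)^-1).
have Ps j : smooth S setT (P j) by apply: smoothM; [exact: oT|exact: Hs|exact: Gi].
pose T j := P j * (if e j is Some y then (D y).1.1.2 else 0).
have PZ j y x : e j = Some y -> (D y).2 x -> P j x = 0.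
  move=> ej Zx; have [_ [_ _ _ _ psi0]] := DP y.
  by rewrite /P /H /F ej !fctE /psi psi0// !mul0r.
have TW j : W k setT (T j).
  rewrite /T; case ej : (e j) => [y|].
    have [[oV _ fV _] [_ _ oZ VZ _]] := DP y.
    exact: (wt_cutoff oT oV oZ VZ (fun x => PZ j y x ej) (Ps j) fV).
  by rewrite mulr0; apply: wt_0; exact: oT.
(* A factor of degree 0 acts by its value at the base point, so each term contributes its share of
   the same number [h u]. *)
have Tg j u : germ u k (T j) = P j (base u) * h u.
  have gu := germ_pointP u; rewrite /T; case ej : (e j) => [y|]; last first.
    rewrite mulr0 (gp_S gu oT I); last by apply: wt_0; exact: oT.
    by rewrite /P /H /F ej !fctE !mul0r.
  have [[oV _ fV hf] [_ _ oZ VZ _]] := DP y; have [Vu|Zu] := VZ (base u).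
    have P0 : W 0 (D y).1.1.1 (P j).
      by apply/smooth_wt0 => //; exact: smooth_sub (@subsetT _ _) (Ps j).
    rewrite -[X in germ u X]add0n (gp_M gu oV Vu P0 fV) (gp_0 gu oV Vu P0).
    by rewrite hf.
  rewrite (PZ j y _ ej Zu) mul0r; apply: (gp_S gu oZ Zu); apply: wt_eq0 => // x Zx.
  by rewrite fctE (PZ j y x ej Zx) mul0r.
have Tlf : locally_finite S setT T.
  move=> x _; have [V [K [oV Vx KV _]]] := Gloc x; exists V; split=> //.
  by exists K => j y Kj Vy; rewrite /T /P !fctE KV// !mul0r.
have [f fE] := locally_finite_sum Tlf.
have floc x : exists V K, [/\ mopen S V, V x, G x = \sum_(j < K) H j x &
    forall y, V y -> (\sum_(j < K) T j) y = f y].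
  have [V [K [oV Vx KV GV]]] := Gloc x; exists V, K; split=> //; first exact: GV.
  move=> y Vy; rewrite fct_sumE (fE y K)// => j Kj.
  by rewrite /T /P !fctE KV// !mul0r.
have TsW K V : mopen S V -> W k V (\sum_(j < K) T j).
  by move=> oV; apply: wt_weights_sum => // j _; exact: (wt_restr oT oV (@subsetT _ _) (TW j)).
exists f.
  apply: wt_local => [|x _]; first exact: oT.
  have [V [K [oV Vx _ fV]]] := floc x; exists V; split=> //.
  exact: (wt_congr oV fV (TsW K V oV)).
move=> u; have [V [K [oV Vu GK fV]]] := floc (base u).
have gu := germ_pointP u.
rewrite -(gp_ext gu oV Vu (TsW K V oV) fV) (gp_sum gu oV Vu); last first.
  by move=> j _; exact: (wt_restr oT oV (@subsetT _ _) (TW j)).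
under eq_bigr do rewrite Tg.
rewrite -mulr_suml.
have -> : \sum_(j < K) P j (base u) = 1; last by rewrite mul1r.
rewrite /P; under eq_bigr do rewrite fctE.
by rewrite -mulr_suml -GK divff// gt_eqF.
Qed.

Lemma homogE k : (@gr_eval R M FT) @` gr_deg k = homog E (kappa W) k.
Proof.
apply/seteqP; split=> [_ [a ak <-]|h hh]; first exact: gr_deg_homog.
have [f fW hf] := homog_global hh.
exists (gr_class FT k f); first by exists f.
by apply/funext => u; rewrite hf germE.
Qed.

Lemma Cpol_bij : set_bij [set: gr FT] (Cpol E (kappa W)) (@gr_eval R M FT).
Proof.
split.
- move=> a _; have [m [f [Ff ->]]] := gr_decomp a.
  exists m, (fun k => @gr_eval R M FT (gr_class FT k (f k))).
  split=> [k|]; first by apply: gr_deg_homog; exists (f k).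
  by rewrite raddf_sum.
- move=> a b _ _ ab; apply/eqP; rewrite -subr_eq0; apply/eqP; apply: gr_eval_inj => u.
  by rewrite rmorphB; have := congr1 (fun F => F u) ab; rewrite /gr_eval => ->; rewrite subrr.
- move=> h [m [H [Hk ->]]].
  have /choice[a aP] : forall k, exists a, gr_deg k a /\ @gr_eval R M FT a = H k.
    by move=> k; have := Hk k; rewrite -homogE => -[a ak aH]; exists a.
  exists (\sum_(k < m) a k) => //; rewrite raddf_sum; apply: eq_bigr => k _.
  exact: (aP k).2.
Qed.

End Structure.
End PolynomialFunctions.

(** * Uniqueness *)

Section ConsRow.
Context (R : realType) (n : nat).

Lemma ord_consP (a : 'I_(1 + n)) : a = lshift n 0 \/ exists b, a = rshift 1 b.
Proof.
by case: (splitP a) => b ab; [left|right; exists b]; apply: ord_inj; rewrite ab ?ord1.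
Qed.

Definition cons_row (t : R) (z : 'rV[R]_n) : 'rV[R]_(1 + n) := row_mx (const_mx t) z.

Lemma cons_rowl t z : cons_row t z 0 (lshift n 0) = t.
Proof. by rewrite row_mxEl mxE. Qed.

Lemma cons_rowr t z a : cons_row t z 0 (rshift 1 a) = z 0 a.
Proof. by rewrite row_mxEr. Qed.

Lemma cons_row_inj t t' z z' : cons_row t z = cons_row t' z' -> t = t' /\ z = z'.
Proof.
move=> E; split; first by rewrite -(cons_rowl t z) E cons_rowl.
by apply/rowP => a; rewrite -(cons_rowr t z) E cons_rowr.
Qed.

Lemma Csmooth_cons_row t V a : Csmooth V (fun z => cons_row t z 0 a).
Proof.
have [{a}->|[b {a}->]] := ord_consP a.
  rewrite (_ : (fun z => _) = cst t); first exact: Csmooth_cst.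
  by apply/funext => z; rewrite cons_rowl.
rewrite (_ : (fun z => _) = (fun z : 'rV[R]_n => z 0 b)); first exact: Csmooth_coord.
by apply/funext => z; rewrite cons_rowr.
Qed.

Lemma cons_row_open t (O : set 'rV[R]_(1 + n)) : open O -> open [set z | O (cons_row t z)].
Proof.
move=> oO.
have cc z : {for z, continuous (cons_row t)}.
  by apply: (Csmooth_row_continuous (V := setT)) => // a; exact: Csmooth_cons_row.
by have := open_preimage_on (@openT _) oO (fun z _ => cc z); rewrite setTI.
Qed.

Lemma cons_row_continuous z s (t : R) :
  {for t, continuous (fun t : R => cons_row (t * s) z)}.
Proof.
apply: continuous_row => a; have [{a}->|[b {a}->]] := ord_consP a.
  rewrite (_ : (fun t : R => _) = (fun t : R => t * s)).
    apply: (@cvgM _ _ (nbhs t) _ (fun t : R => t) (cst s)); [exact: cvg_id|exact: cvg_cst].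
  by apply/funext => t'; rewrite cons_rowl.
rewrite (_ : (fun t : R => _) = cst (z 0 b)); first exact: cst_continuous.
by apply/funext => t'; rewrite cons_rowr.
Qed.

Lemma cons_row_open_t z s (O : set 'rV[R]_(1 + n)) : open O ->
  open [set t : R | O (cons_row (t * s) z)].
Proof.
move=> oO; have := open_preimage_on (@openT _) oO (fun t _ => @cons_row_continuous z s t).
by rewrite setTI.
Qed.

Lemma is_derive_cons_row_t (O : set 'rV[R]_(1 + n)) g z s t : open O ->
  O (cons_row (t * s) z) -> Csmooth O g ->
  is_derive t (1 : R) (fun t => g (cons_row (t * s) z))
    (s * 'D_(delta_mx 0 (lshift n 0)) g (cons_row (t * s) z)).
Proof.
move=> oO Ot gO.
pose F (t : R) := cons_row (t * s) z.
have dl : is_derive t (1 : R) (fun t => F t 0 (lshift n 0)) s.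
  rewrite (_ : (fun t => _) = s *: (id : R -> R)).
    by apply: (is_derive_eq (is_deriveZ s (is_derive_id t (1 : R)))); exact: mulr1.
  by apply/funext => t'; rewrite /F cons_rowl; exact: mulrC.
have dr a : is_derive t (1 : R) (fun t => F t 0 (rshift 1 a)) 0.
  rewrite (_ : (fun t => _) = cst (z 0 a)); first exact: is_derive_cst.
  by apply/funext => t'; rewrite /F cons_rowr.
have dF a : derivable (fun t => F t 0 a) t (1 : R).
  by have [{a}->|[b {a}->]] := ord_consP a; [have [] := dl|have [] := dr b].
have [d1 d2] := @derive_comp_row R (1 + n) R O g F t 1 oO Ot (gO 1%N) dF.
split=> //; rewrite d2 big_split_ord /= big_ord1 [X in _ + X]big1 ?addr0.
  by have /@derive_val -> := dl; rewrite mulrC.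
by move=> a _; have /@derive_val -> := dr a; rewrite mulr0.
Qed.

Lemma derive_cons_row (O : set 'rV[R]_(1 + n)) g t z (a : 'I_n) : open O ->
  O (cons_row t z) -> Csmooth O g ->
  'D_(delta_mx 0 a) (fun z => g (cons_row t z)) z =
  'D_(delta_mx 0 (rshift 1 a)) g (cons_row t z).
Proof.
move=> oO Oz gO.
have dF b : derivable (fun z => cons_row t z 0 b) z (delta_mx 0 a).
  have H := @Csmooth_derivable _ _ setT _ a z (@Csmooth_cons_row t setT b) I.
  exact: H.
have [_ ->] := @derive_comp_row R (1 + n) _ O g (cons_row t) z (delta_mx 0 a) oO Oz (gO 1%N) dF.
rewrite big_split_ord /= big_ord1.
rewrite [X in X + _](_ : _ = 0) ?add0r; last first.
  rewrite (_ : (fun z => _) = cst t) ?derive_cst ?mulr0//.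
  by apply/funext => z'; rewrite cons_rowl.
have dc b : 'D_(delta_mx 0 a) (fun z => cons_row t z 0 (rshift 1 b)) z = (b == a)%:R.
  rewrite (_ : (fun z => _) = (fun z : 'rV[R]_n => z 0 b)); last first.
    by apply/funext => z'; rewrite cons_rowr.
  rewrite -(derive_row b (@derivable_id _ _ z _)) derive_id mxE eqxx.
  by [].
rewrite (bigD1 a)//= dc eqxx mulr1 big1 ?addr0// => b ba.
by rewrite dc (negbTE ba) mulr0.
Qed.

Fixpoint derive_t (i : nat) (g : 'rV[R]_(1 + n) -> R) : 'rV[R]_(1 + n) -> R :=
  if i is i'.+1 then 'D_(delta_mx 0 (lshift n 0)) (derive_t i' g) else g.

Lemma Csmooth_derive_t i (O : set 'rV[R]_(1 + n)) g : Csmooth O g -> Csmooth O (derive_t i g).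
Proof. by move=> gO; elim: i => //= i IHi; exact: Csmooth_derive. Qed.

(** Each differentiation yields one factor [s]; this is why the i-th jet of the action is
    homogeneous of degree i. *)
Lemma derive1n_cons_row (O : set 'rV[R]_(1 + n)) g z s (T : set R) (phi : R -> R) :
  open O -> Csmooth O g -> open T ->
  (forall t, T t -> O (cons_row (t * s) z) /\ phi t = g (cons_row (t * s) z)) ->
  forall i t, T t -> (derive1n i phi) t = s ^+ i * derive_t i g (cons_row (t * s) z).
Proof.
move=> oO gO oT H; elim=> [|i IHi] t Tt.
  by rewrite derive1n0 expr0 mul1r; exact: (H t Tt).2.
have [Ot _] := H t Tt.
have dg := is_derive_cons_row_t oO Ot (Csmooth_derive_t i gO).
rewrite derive1nS derive1E.
have E : \forall t' \near t, (derive1n i phi) t' = s ^+ i * derive_t i g (cons_row (t' * s) z).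
  by near=> t'; apply: IHi; near: t'; exact: open_nbhs_nbhs.
rewrite (near_eq_derive (1 : R) E).
have dZ : is_derive t (1 : R) (s ^+ i *: (fun t' : R => derive_t i g (cons_row (t' * s) z)))
   (s ^+ i *: (s * 'D_(delta_mx 0 (lshift n 0)) (derive_t i g) (cons_row (t * s) z))).
  exact: is_deriveZ.
have /@derive_val := dZ; rewrite exprSr -mulrA; apply: etrans.
by congr ('D_(1 : R) _ t); apply/funext.
Unshelve. all: by end_near. Qed.

End ConsRow.

Section Jacobian.
Context (R : realType) (n : nat).
Implicit Types (V : set 'rV[R]_n) (F G : 'rV[R]_n -> 'rV[R]_n).

Lemma jacobian_comp V U F G x : open V -> V x -> open U -> U (F x) ->
  (forall a, Csmooth V (fun v => F v 0 a)) -> (forall a, Csmooth U (fun v => G v 0 a)) ->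
  jacobian_mx (G \o F) x = jacobian_mx F x *m jacobian_mx G (F x).
Proof.
move=> oV Vx oU UF FV GU; apply/matrixP => i a; rewrite !mxE.
have dF b := @Csmooth_derivable _ _ V _ i x (FV b) Vx.
have [_ E] := @derive_comp_row R n _ U (fun v => G v 0 a) F x (delta_mx 0 i) oU UF (GU a 1%N) dF.
rewrite [LHS]E; apply: eq_bigr => b _; rewrite !mxE; exact: mulrC.
Qed.

Lemma jacobian_ext V F G x : open V -> V x -> (forall v, V v -> F v = G v) ->
  jacobian_mx F x = jacobian_mx G x.
Proof.
move=> oV Vx FG; apply/matrixP => i a; rewrite !mxE.
by apply: (eq_on_derive _ oV Vx) => v /FG ->.
Qed.

Lemma jacobian_id x : jacobian_mx (id : 'rV[R]_n -> 'rV[R]_n) x = 1%:M.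
Proof.
apply/matrixP => i a; rewrite !mxE.
by rewrite -(derive_row a (@derivable_id _ _ x _)) derive_id mxE eqxx eq_sym.
Qed.

(* Contracting by B = A(1/2) shrinks xi at most geometrically, as C inverts B, *)
(* while flatness makes xi B^k decay faster than any geometric sequence.       *)
Lemma flat_orbit_eq0 (xi : 'rV[R]_n) (B C : 'M[R]_n) : B *m C = 1%:M ->
  (forall N, exists (K : R) k0, forall k, (k0 <= k)%N ->
    `|iter k (mulmx^~ B) xi| <= K * (2^-1 ^+ k) ^+ N) -> xi = 0.
Proof.
move=> BC decay; have [L L0 LC] := mulmx_bounded C.
have back k (v : 'rV[R]_n) : iter k (mulmx^~ C) (iter k (mulmx^~ B) v) = v.
  elim: k v => // k IHk v.
  by rewrite iterSr [X in _ X]/= -mulmxA BC mulmx1 IHk.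
have bound k (v : 'rV[R]_n) : `|iter k (mulmx^~ C) v| <= L ^+ k * `|v|.
  elim: k => [|k IHk]; first by rewrite mul1r.
  rewrite iterS exprS -mulrA; apply: (le_trans (LC _)).
  by rewrite ler_wpM2l// ltW.
(* Undoing k steps costs at most L^k, so decay at the rate 2^(-N k) with 2^N >= 2 L leaves a factor
   2^-k. *)
pose N := (Num.truncn (2 * L)).+1.
have LN : 2 * L <= 2 ^+ N.
  apply: (@le_trans _ _ N%:R); first exact/ltW/truncnS_gt.
  by rewrite -natrX ler_nat ltnW// ltn_expl.
have [K [k0 KP]] := decay N.
have xib k : (k0 <= k)%N -> `|xi| <= K * 2^-1 ^+ k.
  move=> kk; rewrite -{1}(back k xi); apply: le_trans (bound _ _) _.
  have {}KP := KP k kk.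
  apply: le_trans (ler_wpM2l (exprn_ge0 k (ltW L0)) KP) _.
  have K0 : 0 <= K.
    have p0 : 0 < (2^-1 ^+ k) ^+ N :> R by rewrite !exprn_gt0.
    by rewrite -(pmulr_lge0 _ p0); exact: le_trans (normr_ge0 _) KP.
  rewrite mulrCA ler_wpM2l// -exprM mulnC exprM -exprMn lerXn2r ?nnegrE//.
    by rewrite mulr_ge0 ?(ltW L0)// exprn_ge0.
  rewrite exprVn ler_pdivrMr ?exprn_gt0//; move: LN; set p := 2 ^+ N; lra.
apply/eqP; rewrite -normr_le0 leNgt; apply/negP => x0.
have K0 : 0 < K.
  by have := lt_le_trans x0 (xib k0 (leqnn _)); rewrite pmulr_lgt0// exprn_gt0.
pose k := maxn k0 (Num.truncn (K / `|xi|)).+1.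
have := xib k (leq_maxl _ _); apply/negP; rewrite -ltNge.
have : K / `|xi| < k%:R.
  by apply: lt_le_trans (truncnS_gt _) _; rewrite ler_nat leq_maxr.
rewrite ltr_pdivrMr// => H1; rewrite exprVn ltr_pdivrMr ?exprn_gt0//.
apply: lt_le_trans H1 _; rewrite mulrC ler_wpM2l ?(ltW x0)//.
by rewrite -natrX ler_nat ltnW// ltn_expl.
Qed.

End Jacobian.

Lemma cons_row_domain (R : realType) (X : Type) (n : nat) (e : pchart R X n) t
    (P : set 'rV[R]_(1 + n)) : is_chart e -> open P ->
  open (e @` [set u | dom e u /\ P (cons_row t (e u))]).
Proof.
move=> [_ oe] oP.
rewrite (_ : _ @` _ = e @` dom e `&` [set z | P (cons_row t z)]).
  by apply: openI; [exact: oe|exact: cons_row_open].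
apply/seteqP; split=> [_ [u [eu Pu] <-]|_ [[u eu <-] Pu]]; last by exists u.
by split=> //; exists u.
Qed.

(** * Smooth actions of the multiplicative monoid in charts *)

Section Actions.
Context (R : realType) (X : Type) (n : nat) (E : manifold R X n) (kap : R -> X -> X).
Hypothesis GB : graded_bundle E kap.

Lemma action_chart0 t0 u0 : exists e d (O : set 'rV[R]_(1 + n))
    (G : 'rV[R]_(1 + n) -> 'rV[R]_n),
  [/\ charts E e, charts E d, open O, dom e u0 & O (cons_row t0 (e u0))] /\
  (forall a, Csmooth O (fun v => G v 0 a)) /\
  forall t u, dom e u -> O (cons_row t (e u)) ->
    dom d (kap t u) /\ d (kap t u) = G (cons_row t (e u)).
Proof.
have [c [d [V [G [[cA Ed Vc oV Vt] [GV GE]]]]]] := gb_smooth GB (t0, u0).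
have [l [e [lA Ee cE]]] := cA.
have {}cE : c = PChart (setT `*` dom e) (fun z => cons_row z.1 (e z.2)).
  by rewrite cE lA.
rewrite {}cE /= in Vc oV GV GE; have [eI _] := charts_chart Ee.
exists e, d, [set cons_row z.1 (e z.2) | z in V], (fun v => \row_a G a v).
split.
  by split=> //; [have [_] := Vc _ Vt|exists (t0, u0)].
split=> [a|t u eu [[t' u'] Vtu /= /cons_row_inj[tt /eI uu]]].
  by rewrite (_ : (fun v => _) = G a)//; apply/funext => v; rewrite mxE.
have {}uu : u' = u by apply: uu => //; have [] := Vc _ Vtu.
rewrite tt uu in Vtu; have [du duG] := GE _ Vtu; split=> //.
by apply/rowP => a; rewrite mxE -duG.
Qed.

(** The smoothness of the action supplies charts of its own choice; transition maps at source and
    target replace them by prescribed ones, as is necessary for jets taken in one fixed chart. *)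
Lemma action_chart e d t0 u0 : charts E e -> charts E d -> dom e u0 ->
  dom d (kap t0 u0) -> exists (O : set 'rV[R]_(1 + n)) (G : 'rV[R]_(1 + n) -> 'rV[R]_n),
  [/\ open O, O (cons_row t0 (e u0)), forall a, Csmooth O (fun v => G v 0 a) &
  forall t u, dom e u -> O (cons_row t (e u)) ->
    dom d (kap t u) /\ d (kap t u) = G (cons_row t (e u))].
Proof.
move=> Ee Ed eu0 du0.
have [e' [d' [P' [G' [[Ee' Ed' oP e'u0 Pu0] [G's G'E]]]]]] := action_chart0 t0 u0.
have [Ve [[Veu Vee Vee' oVe _] [ee' _]]] := charts_compatible_at Ee Ee' eu0 e'u0.
have [d'u0 d'E] := G'E _ _ e'u0 Pu0.
have [Vd [[Vdu Vdd' Vdd oVd' _] [dd' _]]] := charts_compatible_at Ed' Ed d'u0 du0.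
have [L Ls eL] := smooth_in_rowP Vee ee'; have [K Ks dK] := smooth_in_rowP Vdd' dd'.
pose O1 := [set v : 'rV[R]_(1 + n) | (e @` Ve) (rsubmx v)].
pose Q (v : 'rV[R]_(1 + n)) := cons_row (v 0 (lshift n 0)) (L (rsubmx v)).
have oO1 : open O1 by exact: row_mx_image_open.
have Qs a : Csmooth O1 (fun v => Q v 0 a).
  have [{a}->|[b {a}->]] := ord_consP a.
    rewrite (_ : (fun v => _) = (fun v : 'rV[R]_(1 + n) => v 0 (lshift n 0))).
      exact: Csmooth_coord.
    by apply/funext => v; rewrite /Q cons_rowl.
  rewrite (_ : (fun v => _) = (fun z => L z 0 b) \o (fun v : 'rV[R]_(1 + n) => rsubmx v)).
    apply: (Csmooth_comp oO1 oVe _ _ (Ls b)) => // i.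
    rewrite (_ : (fun v => _) = (fun v : 'rV[R]_(1 + n) => v 0 (rshift 1 i))).
      exact: Csmooth_coord.
    by apply/funext => v; rewrite mxE.
  by apply/funext => v; rewrite /Q cons_rowr.
pose O2 := O1 `&` Q @^-1` P'.
have oO2 : open O2.
  have cQ v : O1 v -> {for v, continuous Q} by exact: (Csmooth_row_continuous Qs).
  exact: open_preimage_on oO1 oP cQ.
have GQs a : Csmooth O2 (fun v => G' (Q v) 0 a).
  apply: (@Csmooth_comp _ _ _ O2 P' Q (fun v => G' v 0 a)) => //; first by move=> v [].
  by move=> b; apply: Csmooth_sub (Qs b) => v [].
pose O := O2 `&` (G' \o Q) @^-1` (d' @` Vd).
have oO : open O.
  have cGQ v : O2 v -> {for v, continuous (G' \o Q)} by
    exact: (Csmooth_row_continuous (F := G' \o Q) GQs).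
  exact: open_preimage_on oO2 oVd' cGQ.
have Qe t u : Ve u -> Q (cons_row t (e u)) = cons_row t (e' u).
  by move=> Vu; rewrite /Q cons_rowl row_mxKr eL.
exists O, (fun v => K (G' (Q v))); split=> //.
- split; [split|] => /=.
  + by rewrite /O1 /= row_mxKr; exists u0.
  + by rewrite /= Qe.
  + by rewrite /= Qe//; exists (kap t0 u0).
- move=> a; apply: (@Csmooth_comp _ _ _ O (d' @` Vd) (G' \o Q) (fun v => K v 0 a)) => //.
    by move=> v [].
  by move=> b; apply: Csmooth_sub (GQs b) => v [].
move=> t u eu [[Hu Pu] du].
have Vu : Ve u.
  move: Hu; rewrite /O1 /= row_mxKr => -[u' Vu' /(charts_chart Ee).1 uu].
  by rewrite -uu//; exact: Vee.
have e'u := Vee' _ Vu; rewrite /= Qe// in Pu du; have [d'u duE] := G'E _ _ e'u Pu.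
have Vdk : Vd (kap t u).
  have [v Vv] := du; rewrite -duE => /(charts_chart Ed').1 vk.
  by rewrite -vk//; exact: Vdd'.
by split; [exact: Vdd|rewrite Qe// -duE; exact: dK].
Qed.

Lemma action_smooth t : smooth_map (charts E) (charts E) id (kap t).
Proof.
move=> u0; have [e [d [P [G [[Ee Ed oP eu0 Pu0] [Gs GE]]]]]] := action_chart0 t u0.
pose V := [set u | dom e u /\ P (cons_row t (e u))].
have oV : open (e @` V) by exact: cons_row_domain (charts_chart Ee) oP.
exists e, d, V, (fun a z => G (cons_row t z) 0 a).
split; first by split=> // u [].
split=> [a|u [eu Pu]]; last by have [du ->] := GE t u eu Pu.
apply: (@Csmooth_comp _ _ _ (e @` V) P (cons_row t) (fun v => G v 0 a)) => //.
- by move=> _ [u [eu Pu] <-].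
- by move=> b; exact: Csmooth_cons_row.
Qed.

(** Continuity of t |-> [kap t u] at 0 yields an invertible dilation that brings [u] into a chart
    around its projection. *)
Lemma near0_action_dom b u : charts E b -> dom b (kap 0 u) ->
  exists2 t : R, t != 0 & dom b (kap t u).
Proof.
move=> Eb bu; have [e Ee eu] := charts_cover E u.
have [P [G [oP Pu Gs GE]]] := action_chart Ee Eb eu bu.
have : nbhs (0 : R) [set t : R | P (cons_row (t * 1) (e u))].
  apply: open_nbhs_nbhs; split; first exact: cons_row_open_t.
  by rewrite /= mulr1.
move=> /nbhs_ballP[r /= r0 rP]; exists (r / 2); first by rewrite gt_eqF// divr_gt0.
have := rP (r / 2); rewrite /= mulr1 => /(_ _)H; apply: (GE _ _ eu _).1; apply: H.
by rewrite /ball /= sub0r normrN gtr0_norm ?divr_gt0// ltr_pdivrMr// ltr_pMr// ltr1n.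
Qed.

End Actions.

Lemma derive_t_swap (R : realType) (n : nat) (O : set 'rV[R]_(1 + n)) g i (a : 'I_n) v :
  open O -> O v -> Csmooth O g ->
  derive_t i ('D_(delta_mx 0 (rshift 1 a)) g) v = 'D_(delta_mx 0 (rshift 1 a)) (derive_t i g) v.
Proof.
move=> oO Ov gO; elim: i v Ov => // i IHi v Ov /=.
rewrite (eq_on_derive _ oO Ov IHi).
exact: derive_swap oO Ov (Csmooth_derive_t i gO 2%N).
Qed.

(** * Jets of the action at t = 0 *)

Section Jets.
Context (R : realType) (X : Type) (n : nat) (E : manifold R X n) (kap : R -> X -> X).
Hypothesis GB : graded_bundle E kap.
Implicit Types (d e : pchart R X n).

(** Up to a factorial, the i-th Taylor coefficient at t = 0 of the curve [kap t u] in the chart [d].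
    It makes sense as soon as [kap 0 u] lies in [dom d], wherever [u] itself is, and is the standard
    way to extract homogeneous functions from an arbitrary chart. *)
Definition jet d (i : nat) (b : 'I_n) (u : X) : R :=
  derive1n i (fun t => d (kap t u) 0 b) 0.

Lemma action_jet e d u0 : charts E e -> charts E d -> dom e u0 -> dom d (kap 0 u0) ->
  exists (P : set 'rV[R]_(1 + n)) (G : 'rV[R]_(1 + n) -> 'rV[R]_n),
  [/\ open P, P (cons_row 0 (e u0)), forall a, Csmooth P (fun v => G v 0 a) &
   forall t u, dom e u -> P (cons_row t (e u)) ->
     dom d (kap t u) /\ d (kap t u) = G (cons_row t (e u))] /\
  forall i b s u, dom e u -> P (cons_row 0 (e u)) ->
    jet d i b (kap s u) = s ^+ i * derive_t i (fun v => G v 0 b) (cons_row 0 (e u)).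
Proof.
move=> Ee Ed eu0 du0; have [P [G [oP Pu0 Gs GE]]] := action_chart GB Ee Ed eu0 du0.
exists P, G; split=> // i b s u eu Pu.
pose T := [set t : R | P (cons_row (t * s) (e u))].
have oT : open T by exact: cons_row_open_t.
have H t : T t -> P (cons_row (t * s) (e u)) /\
    d (kap t (kap s u)) 0 b = G (cons_row (t * s) (e u)) 0 b.
  by move=> Pt; split=> //; rewrite -(gb_mul GB) (GE _ _ eu Pt).2.
have T0 : T 0 by rewrite /T /= mul0r.
by rewrite /jet (derive1n_cons_row oP (Gs b) oT H)// mul0r.
Qed.

(** The jet has degree i because [kap t (kap s u)] is [kap (t * s) u], but it is meaningful only
    over a part of the base. Since [rho] is constant along orbits, the cutoff preserves the
    degree. *)
Lemma jet_homog d rho (U Z : set X) i b : charts E d -> mopen E Z ->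
  (forall u, U u \/ Z u) -> (forall u, Z u -> rho u = 0) -> smooth E setT rho ->
  (forall t u, rho (kap t u) = rho u) -> (forall u, U u -> dom d (kap 0 u)) ->
  homog E kap i (fun u => rho u * jet d i b u).
Proof.
move=> Ed oZ UZ Z0 rhos rhok Ud; split; last first.
  move=> t u; rewrite rhok; have [Uu|Zu] := UZ u; last by rewrite Z0// !mul0r mulr0.
  have [e Ee eu] := charts_cover E u.
  have [P [G [[oP Pu _ _] jE]]] := action_jet Ee Ed eu (Ud u Uu).
  have := jE i b 1 u eu Pu; rewrite (gb_one GB) expr1n mul1r => ->.
  by rewrite jE// mulrCA.
apply: smooth_local => u _; have [e Ee eu] := charts_cover E u.
have [Uu|Zu] := UZ u; last first.
  exists e, (Z `&` dom e); split; [exact: Ee| |by []|by move=> v []|].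
    by apply: mopenI => //; exact: mopen_dom.
  exists (cst 0); first exact: Csmooth_cst.
  by move=> v [Zv _] _; rewrite Z0// mul0r.
have [P [G [[oP Pu Gs _] jE]]] := action_jet Ee Ed eu (Ud u Uu).
pose V := [set v | dom e v /\ P (cons_row 0 (e v))].
have Ve : V `<=` dom e by move=> v [].
have oV : open (e @` V) by exact: cons_row_domain (charts_chart Ee) oP.
exists e, V; split; [exact: Ee|exact: mopen_in_chart Ee Ve oV|by []|by []|].
have [g gV rg] := (smooth_in_subP _ Ve).1 (smooth_in_sub (@subsetT _ V) (rhos e Ee)).
apply/(smooth_in_subP _ Ve).
exists (fun z => g z * derive_t i (fun v => G v 0 b) (cons_row 0 z)).
  have H : Csmooth (e @` V) (derive_t i (fun v => G v 0 b) \o cons_row 0).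
    apply: (Csmooth_comp oV oP _ _ (Csmooth_derive_t i (Gs b))).
      by move=> _ [v [_ Pv] <-].
    by move=> a; exact: Csmooth_cons_row.
  exact: CsmoothM oV gV H.
move=> v [ev Pv]; rewrite rg//; congr (_ * _).
by have := jE i b 1 v ev Pv; rewrite (gb_one GB) expr1n mul1r.
Qed.

Section FixedPoint.
Context (d : pchart R X n) (m : X).
Hypotheses (Ed : charts E d) (dm : dom d m) (mE : forall t, kap t m = m).

Definition chart_inv z : X := xget (m : mtop E) [set u : mtop E | dom d u /\ d u = z].

Lemma chart_invK u : dom d u -> chart_inv (d u) = u.
Proof.
move=> du; have [|dx dE] := @xgetPex _ (m : mtop E) [set u' : mtop E | dom d u' /\ d u' = d u].
  by exists u.
exact: ((charts_chart Ed).1 _ _ dx du dE).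
Qed.

Definition action_rep t z : 'rV[R]_n := d (kap t (chart_inv z)).

Lemma action_rep_fixed t : action_rep t (d m) = d m.
Proof. by rewrite /action_rep chart_invK// mE. Qed.

Lemma action_rep_smooth t : exists D : set 'rV[R]_n,
  [/\ open D, D (d m), D `<=` d @` dom d,
    forall a, Csmooth D (fun z => action_rep t z 0 a) &
    forall u, dom d u -> D (d u) -> dom d (kap t u)].
Proof.
have dtm : dom d (kap t m) by rewrite mE.
have [P [G [oP Pm Gs GE]]] := action_chart GB Ed Ed dm dtm.
pose V := [set u | dom d u /\ P (cons_row t (d u))].
have oV : open (d @` V) by exact: cons_row_domain (charts_chart Ed) oP.
exists (d @` V); split=> //; first by exists m.
- by apply: image_subset => u [].
- move=> a; apply: (@Csmooth_ext _ _ _ (fun z => G (cons_row t z) 0 a)) => //.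
    by move=> _ [u [du Pu] <-]; rewrite /action_rep chart_invK// (GE t u du Pu).2.
  apply: (@Csmooth_comp _ _ _ (d @` V) P (cons_row t) (fun v => G v 0 a)) => //.
    by move=> _ [u [_ Pu] <-].
  by move=> c; exact: Csmooth_cons_row.
- move=> u du [u' [du' Pu']] /((charts_chart Ed).1 _ _ du' du) <-.
  exact: (GE t u' du' Pu').1.
Qed.

Definition action_jacobian t : 'M[R]_n := jacobian_mx (action_rep t) (d m).

Lemma action_jacobianM s t :
  action_jacobian (s * t) = action_jacobian t *m action_jacobian s.
Proof.
have [D [oD Dm Dd Ds DE]] := action_rep_smooth t.
have [D' [oD' Dm' Dd' Ds' DE']] := action_rep_smooth s.
pose V := D `&` action_rep t @^-1` D'.
have oV : open V.
  have ct v : D v -> {for v, continuous (action_rep t)} by exact: (Csmooth_row_continuous Ds).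
  exact: open_preimage_on oD oD' ct.
have Vm : V (d m) by split=> //=; rewrite action_rep_fixed.
have Vs a : Csmooth V (fun z => action_rep t z 0 a) by apply: Csmooth_sub (Ds a) => z [].
have Dm2 : D' (action_rep t (d m)) by rewrite action_rep_fixed.
have := jacobian_comp oV Vm oD' Dm2 Vs Ds'; rewrite action_rep_fixed => <-.
apply: (jacobian_ext oV Vm) => z [Dz D'z].
have [u du uz] := Dd _ Dz; rewrite -uz in Dz D'z *.
move: D'z; rewrite /= /action_rep chart_invK// => D'z.
by rewrite chart_invK ?(gb_mul GB)//; exact: DE.
Qed.

Lemma action_jacobian1 : action_jacobian 1 = 1%:M.
Proof.
have oD := (charts_chart Ed).2; have Dm : (d @` dom d) (d m) by exists m.
rewrite -(jacobian_id (d m)); apply: (jacobian_ext oD Dm) => _ [u du <-].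
by rewrite /action_rep chart_invK// (gb_one GB).
Qed.

(* If xi kills the differential of F, it kills the z-derivatives at d(m) of all *)
(* t-jets of the action at t = 0, so xi (d kappa_t) is flat at t = 0.          *)
Lemma graded_jacobian_unit (Omega : set 'rV[R]_n) (F : 'rV[R]_n -> 'rV[R]_n) :
  open Omega -> Omega (d m) -> (forall a, Csmooth Omega (fun z => F z 0 a)) ->
  (forall i b, exists (D Q : set 'rV[R]_n) (P : 'rV[R]_n -> R),
    [/\ open D, D (d m), open Q & Csmooth Q P] /\
    forall u, dom d u -> D (d u) -> Q (F (d u)) /\ jet d i b u = P (F (d u))) ->
  jacobian_mx F (d m) \in unitmx.
Proof.
move=> oOm Om Fs FP; set J := jacobian_mx F (d m).
suff inj (xi : 'rV[R]_n) : xi *m J = 0 -> xi = 0.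
  rewrite -row_free_unit -kermx_eq0; apply/eqP/row_matrixP => i; rewrite row0.
  by apply: inj; rewrite -row_mul mulmx_ker row0.
move=> xiJ; apply: (@flat_orbit_eq0 _ _ xi (action_jacobian 2^-1) (action_jacobian 2)).
  by rewrite -action_jacobianM divff// action_jacobian1.
move=> N0.
have iterE k : iter k (mulmx^~ (action_jacobian 2^-1)) xi = xi *m action_jacobian (2^-1 ^+ k).
  elim: k => [|k IHk]; first by rewrite action_jacobian1 mulmx1.
  by rewrite iterS IHk -mulmxA -action_jacobianM exprS.
have dm0 : dom d (kap 0 m) by rewrite mE.
have [P [G [[oP Pm Gs GE] jE]]] := action_jet Ed Ed dm dm0.
pose g b i a := derive_t i ('D_(delta_mx 0 (rshift 1 a)) (fun v => G v 0 b)).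
have gs b i a : Csmooth P (g b i a) by apply: Csmooth_derive_t; exact: Csmooth_derive.
(* The i-th t-derivative of the b-th component of xi (d kappa_t); the factor [* 1] fits the scaled
   form of [is_derive_cons_row_t]. *)
pose phi b i (t : R) := \sum_(a < n) xi 0 a * g b i a (cons_row (t * 1) (d m)).
have phiE b t : P (cons_row t (d m)) -> (xi *m action_jacobian t) 0 b = phi b 0%N t.
  move=> Pt; rewrite !mxE; apply: eq_bigr => a _; congr (_ * _); rewrite !mxE mulr1.
  pose V := [set u | dom d u /\ P (cons_row t (d u))].
  have oV : open (d @` V) by exact: cons_row_domain (charts_chart Ed) oP.
  have Vm : (d @` V) (d m) by exists m.
  rewrite -[RHS](derive_cons_row a oP Pt (Gs b)).
  apply: (eq_on_derive _ oV Vm) => _ [u [du Pu] <-].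
  by rewrite /action_rep chart_invK// (GE t u du Pu).2.
(* By symmetry of derivatives this is the derivative of the i-th jet in direction [xi]. Near [m] the
   jet is a smooth function of [F], so the derivative factors through xi J = 0. *)
have phi0 b i : phi b i 0 = 0.
  have [D [Q [p [[oD Dm oQ ps] jQ]]]] := FP i b.
  pose V := [set u | dom d u /\ P (cons_row 0 (d u))].
  have oV : open (d @` V) by exact: cons_row_domain (charts_chart Ed) oP.
  pose V' := Omega `&` D `&` d @` V.
  have oV' : open V' by do 2 apply: openI => //.
  have Vm : V' (d m) by split=> //; exists m.
  have Qm : Q (F (d m)) by exact: (jQ m dm Dm).1.
  have dF a c : derivable (fun z => F z 0 c) (d m) (delta_mx 0 a).
    by have H := @Csmooth_derivable _ _ Omega _ a (d m) (Fs c) Om; exact: H.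
  have E1 a : g b i a (cons_row (0 * 1) (d m)) =
      \sum_(c < n) 'D_(delta_mx 0 c) p (F (d m)) * J a c.
    rewrite mul0r /g (derive_t_swap i a oP Pm (Gs b)).
    rewrite -(derive_cons_row a oP Pm (Csmooth_derive_t i (Gs b))).
    have -> : 'D_(delta_mx 0 a) (fun z => derive_t i (fun v => G v 0 b) (cons_row 0 z)) (d m) =
        'D_(delta_mx 0 a) (p \o F) (d m).
      apply: (eq_on_derive _ oV' Vm) => z [[_ Dz] [u [du Pu] uz]].
      have Du : D (d u) by rewrite uz.
      rewrite -uz {z Dz uz}.
      rewrite /= -(jQ u du Du).2.
      by have := jE i b 1 u du Pu; rewrite (gb_one GB) expr1n mul1r.
    have [_ ->] := @derive_comp_row R n _ Q p F (d m) (delta_mx 0 a) oQ Qm (ps 1%N) (dF a).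
    by apply: eq_bigr => c _; rewrite mxE.
  rewrite /phi; under eq_bigr do rewrite E1 mulr_sumr.
  rewrite exchange_big big1// => c _.
  have := congr1 (fun v : 'rV[R]_n => v 0 c) xiJ; rewrite !mxE => E2.
  rewrite -[RHS](mulr0 ('D_(delta_mx 0 c) p (F (d m)))) -[in RHS]E2 mulr_sumr.
  by apply: eq_bigr => a _; rewrite mulrCA.
have dphi b i t : P (cons_row (t * 1) (d m)) -> is_derive t (1 : R) (phi b i) (phi b i.+1 t).
  move=> Pt; have dga a : is_derive t (1 : R)
      (xi 0 a *: (fun t => g b i a (cons_row (t * 1) (d m))))
      (xi 0 a *: (1 * g b i.+1 a (cons_row (t * 1) (d m)))).
    apply: is_deriveZ; exact: (is_derive_cons_row_t oP Pt (gs b i a)).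
  have sumE : \sum_(a < n) (xi 0 a *: (fun t => g b i a (cons_row (t * 1) (d m)))) = phi b i.
    by apply/funext => t'; rewrite fct_sumE.
  have := is_derive_sum dga; rewrite sumE => H; apply: (is_derive_eq H).
  by apply: eq_bigr => a _; rewrite mul1r.
have nearP : \forall t \near (0 : R), P (cons_row (t * 1) (d m)).
  by apply: open_nbhs_nbhs; split; [exact: cons_row_open_t|rewrite /= mul0r].
(* The N0-th derivative is continuous and vanishes at 0, so it is bounded by 1 near 0, which gives
   the constant 1 in the estimate. *)
have small b : \forall t \near (0 : R), `|(xi *m action_jacobian t) 0 b| <= `|t| ^+ N0.
  have P0 : P (cons_row (0 * 1) (d m)) by rewrite mul0r.
  have phic : {for (0 : R), continuous (phi b N0)}.
    by apply/differentiable_continuous/derivable1_diffP; have [] := dphi b N0 0 P0.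
  have phi1 : \forall t \near (0 : R), `|phi b N0 t| < 1.
    have phiN : \forall t \near (0 : R), `|phi b N0 0 - phi b N0 t| < 1.
      exact: (cvgrPdist_lt _ _).1 phic 1 ltr01.
    near=> t; rewrite -[phi b N0 t]opprK normrN -[- _]add0r -(phi0 b N0).
    by near: t; exact: phiN.
  have [/= del del0 delP] := (nbhs_ballP _ _).1 (filterI nearP phi1).
  apply/nbhs_ballP; exists del => // t; rewrite /ball /= sub0r normrN => td.
  have H t' : `|t'| < del -> P (cons_row (t' * 1) (d m)) /\ `|phi b N0 t'| < 1.
    by move=> td'; apply: delP; rewrite /ball /= sub0r normrN.
  have Pt : P (cons_row t (d m)) by have [] := H t td; rewrite mulr1.
  rewrite phiE// -[leRHS]mul1r.
  apply: (@flat_derivatives_bound R del 1 N0 (phi b)) => //.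
  - by move=> i t' /H[Pt' _]; exact: dphi.
  - by move=> t' /H[_ /ltW].
have allb : \forall t \near (0 : R), forall b, `|(xi *m action_jacobian t) 0 b| <= `|t| ^+ N0.
  by near=> t; move=> b; move: b; near: t; apply: filter_forall => b; exact: small.
have := @cvg_expr R 2^-1; rewrite ger0_norm ?invr_ge0// invf_lt1// ltr1n => /(_ isT) c2.
have [k0 _ k0P] := c2 _ allb.
exists 1, k0 => k kk; rewrite iterE mul1r; apply: row_norm_le; first by rewrite !exprn_ge0// invr_ge0.
have e0 : 0 <= 2^-1 ^+ k :> R by rewrite exprn_ge0// invr_ge0.
by move=> b; have := k0P k kk b; rewrite /= (ger0_norm e0).
Unshelve. all: by end_near. Qed.

End FixedPoint.
End Jets.

(** * Comparison of two graded bundle structures *)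

Section Uniqueness.
Context (R : realType) (M : Type) (n r : nat) (S : manifold R M n).
Context (W : weighting S r) (N : set M) (hN : weighted_pair W N).
Implicit Types (c : pchart R M n) (w : 'I_n -> nat) (u : nu W).
Local Notation oT := (@mopenT R M n S).
Local Notation FT := (wt_filtration W oT).

Context (E : manifold R (nu W) n).
Hypothesis EW : forall c w, weighted_coordinates W c w -> charts E (nu_chart W c w).
Context (E' : manifold R (nu W) n) (s : N -> nu W).
Hypothesis GB' : graded_bundle E' (kappa W).
Hypothesis homE : forall k, homog E' (kappa W) k = homog E (kappa W) k.
Hypothesis sb : smooth_map (charts E') (charts S) id (fun u => base u).
Hypothesis ss : smooth_map (charts S) (charts E') val s.
Hypothesis sK : forall x, base (s x) = val x.
Hypothesis sE : forall u, s (nu_proj hN u) = kappa W 0 u.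

Lemma base_preimage_open U : mopen S U -> mopen E' [set u | U (base u)].
Proof. exact: smooth_map_open sb. Qed.

(** Only global homogeneous functions are shared by the two structures, so the coordinate is cut off
    on [M] before its class is taken; over [V] nothing changes. *)
Lemma nu_coord_homog c w psi V Z a : weighted_coordinates W c w ->
  smooth S setT psi -> mopen S V -> (forall y, V y -> psi y = 1) ->
  mopen S Z -> (forall y, dom c y \/ Z y) -> (forall y, Z y -> psi y = 0) ->
  exists2 h, homog E' (kappa W) (w a) h &
    forall u, V (base u) -> nu_coord c w u 0 a = h u.
Proof.
move=> cw psis oV psi1 oZ cZ psi0; have [Sc _ _] := cw.
pose f := psi * (fun y => c y 0 a).
have fT : W (w a) setT f.
  exact: (wt_cutoff oT (mopen_dom Sc) oZ cZ psi0 psis (wt_coord a cw)).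
exists (fun u => u (gr_class FT (w a) f)).
  by rewrite homE; apply: (gr_deg_homog hN EW); exists f.
move=> u Vu; rewrite mxE -germE//; symmetry.
apply: (gp_ext (germ_pointP u) oV Vu (wt_restr oT oV (@subsetT _ V) fT)) => y Vy.
by rewrite /f fctE psi1// mul1r.
Qed.

Lemma common_chart_zero_section (x : N) :
  exists b, [/\ charts E b, charts E' b & dom b (s x)].
Proof.
have [c1 [d [V1 [G [[Sc1 E'd V1c oV1 V1x] [_ Gs]]]]]] := ss x.
have [c [w [cw cx]]] := weighted_chart_at W (val x); have [Sc _ _] := cw.
(* The section [s] maps [V1] into [dom d]; hence [kappa W 0 u] lies in [dom d] for every [u] over
   [U0], as the jets in [d] demand. *)
pose U0 := V1 `&` dom c.
have oU0 : mopen S U0.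
  by apply: mopenI; [exact: mopen_in_chart Sc1 V1c oV1|exact: mopen_dom].
have U0x : U0 (val x) by [].
have [psi [psis [[V [oV Vx VU psi1]] [Z [oZ UZ psi0]]]]] := smooth_bump oU0 U0x.
pose m := s x.
have dU u : U0 (base u) -> dom d (kappa W 0 u).
  by move=> [Vu _]; rewrite -sE; apply: (Gs _ _).1; rewrite nu_projE.
have bm : base m = val x := sK x.
have m0 : kappa W 0 m = m.
  by rewrite -sE; congr s; apply: val_inj; rewrite nu_projE.
have mE t : kappa W t m = m by rewrite -m0 -kappaM mulr0.
have dm : dom d m by rewrite -m0; apply: dU; rewrite bm.
pose B := [set u | V (base u)] `&` dom d.
have oB : mopen E' B by apply: mopenI; [exact: base_preimage_open|exact: mopen_dom].
have Bd : B `<=` dom d by move=> u [].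
have cZ y : dom c y \/ Z y by have [[_ ?]|] := UZ y; [left|right].
have FB a : smooth_in d B (fun u => nu_coord c w u 0 a).
  have [h [hs _] hE] := nu_coord_homog a cw psis oV psi1 oZ cZ psi0.
  apply/(smooth_in_subP _ Bd).
  have [g gB gE] := (smooth_in_subP _ Bd).1 (smooth_in_sub (@subsetT _ B) (hs d E'd)).
  by exists g => // u Bu; rewrite hE ?gE//; case: Bu.
have [F Fs FE] := smooth_in_rowP Bd FB.
pose Om := d @` B.
have oOm : open Om by exact: mopen_image E'd oB Bd.
have Bm : B m by split=> //; rewrite /= bm.
have Om_m : Om (d m) by exists m.
have Ju : jacobian_mx F (d m) \in unitmx.
  apply: (graded_jacobian_unit GB' E'd dm mE oOm Om_m Fs) => i b.
  (* The cut-off jet is a global homogeneous function on [E'], therefore one on [E], and so a smooth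
     function [p] of the coordinates y = F(d), the form required by [graded_jacobian_unit]. *)
  have jh : homog E' (kappa W) i (fun u => psi (base u) * jet (kappa W) d i b u).
    apply: (jet_homog (rho := fun u => psi (base u)) (U := [set u | U0 (base u)])
      (Z := [set u | Z (base u)]) GB' i b E'd) => //.
    - exact: base_preimage_open.
    - by move=> u; exact: UZ.
    - by move=> u; exact: psi0.
    - exact: (smooth_map_smooth sb oT psis).
    - by move=> t u; rewrite base_kappa.
  rewrite homE in jh; have [p ps pE] := jh.1 (nu_chart W c w) (EW cw).
  exists Om, (nu_chart W c w @` (setT `&` dom (nu_chart W c w))), p; split.
    split=> //; rewrite setTI; exact: (nu_chart_is_chart hN cw).2.
  move=> u du [u' Bu' /(charts_chart E'd).1 uu].
  have Bu : B u by rewrite -uu//; case: Bu'.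
  have cu : dom c (base u) by have [] := VU _ Bu.1.
  rewrite -FE//; split; first by exists u.
  by rewrite -(pE u I cu) psi1 ?mul1r//; case: Bu.
have [Z' [H [[oZ' Z'm Z'Om oFZ HK] Hs]]] := inverse_function oOm Om_m Fs Ju.
(* On [D] the map y is both a restriction of the chart of [E] and the composite of [d] with the
   local diffeomorphism [F]; hence it is a chart of both structures. *)
pose D := [set u | B u /\ Z' (d u)].
have dD : d @` D = Z'.
  apply/seteqP; split=> [_ [u [_ Zu] <-]//|z Zz].
  by have [u Bu uz] := Z'Om _ Zz; exists u => //; split=> //; rewrite uz.
have yD : nu_coord c w @` D = F @` Z'.
  rewrite -dD; apply/seteqP; split=> [_ [u [Bu Zu] <-]|_ [_ [u [Bu Zu] <-] <-]].
    by exists (d u); [exists u|rewrite FE].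
  by exists u => //; rewrite FE.
have HD u : D u -> d u = H (nu_coord c w u) by move=> [Bu Zu]; rewrite FE// HK.
pose b := PChart D (nu_coord c w).
have bch : is_chart b.
  split=> [u v Du Dv /= e|]; last by rewrite /= yD.
  by apply: (charts_chart E'd).1; [exact: Bd Du.1|exact: Bd Dv.1|rewrite !HD// e].
have Dc : D `<=` dom (nu_chart W c w) by move=> u [[Vu _] _]; have [] := VU _ Vu.
have oyD : open (nu_coord c w @` D) by rewrite yD.
have Dm : D m by split.
exists b; split=> //.
- apply: (charts_mem bch) => u Du; exists (nu_chart W c w); split; [exact: EW|exact: Dc|].
  exists D; split; first by split.
  by split=> a; apply/smooth_in_subP => //; exists (fun z => z 0 a) => //; exact: Csmooth_coord.
- apply: (charts_mem bch) => u Du; exists d; split; [exact: E'd|exact: Bd Du.1|].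
  have Dd : D `<=` dom d by move=> v [/Bd].
  exists D; split; first by split=> //; rewrite dD.
  split=> a; apply/smooth_in_subP => //.
    exists (fun z => H z 0 a); first by rewrite /= yD; exact: Hs.
    by move=> v Dv; rewrite HD.
  exists (fun z => F z 0 a); first by apply: Csmooth_sub (Fs a); rewrite dD.
  by move=> v [Bv _]; rewrite /= FE.
Qed.

Lemma weighted_bundle_unique : mfd E = mfd E'.
Proof.
apply: smooth_structure_eq => u.
have [b [Eb E'b]] := common_chart_zero_section (nu_proj hN u); rewrite sE => bu.
have [t t0 bt] := near0_action_dom GB' E'b bu.
have GB := nu_graded_bundle hN EW.
have K1 : cancel (kappa W t) (kappa W t^-1) by move=> v; rewrite -kappaM mulVf// kappa1.
have K2 : cancel (kappa W t^-1) (kappa W t) by move=> v; rewrite -kappaM divff// kappa1.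
exists (PChart (kappa W t @^-1` dom b) (b \o kappa W t)); split=> //.
- exact: (charts_pullback (action_smooth GB t) (action_smooth GB t^-1) K1 K2 Eb).
- exact: (charts_pullback (action_smooth GB' t) (action_smooth GB' t^-1) K1 K2 E'b).
Qed.

End Uniqueness.

Theorem theorem4p2 (R : realType) (M : Type) (n r : nat) (S : manifold R M n)
    (W : weighting S r) (N : set M) (hN : weighted_pair W N) :
  exists E : manifold R (nu W) n,
    (* (a) *)
    unique (is_weighted_normal_bundle N) E /\
    (* (b) *)
    forall (c : pchart R M n) (w : 'I_n -> nat)
        (hc : weighted_coordinates W c w),
      set_bij [set: nu_on W (weighted_dom_open hc)] (nu_restr N (dom c))
        (nu_incl W (weighted_dom_open hc)) /\
      exists y : pchart R (nu W) n,
        [/\ graded_coordinates E (kappa W) w y,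
            dom y = nu_restr N (dom c) &
            forall (v : nu_on W (weighted_dom_open hc)) (a : 'I_n),
              y (nu_incl W (weighted_dom_open hc) v) 0 a =
              v (gr_class _ (w a) (fun x => c x 0 a))].
Proof.
have [E EW] := nu_manifold_exists hN; exists E; split; first split.
- split; [exists (nu_proj hN); split=> [u|]|exact: (Cpol_bij hN EW)|exact: (homogE hN EW)].
    by apply/nu_overP; exact: nu_projE.
  exact: (nu_graded_bundle_over hN EW).
- move=> E' [[p [pE [GB' [s [sb ss sK sE]]]]] _ hE].
  (* The projection of the second structure is no additional datum: the point under [u] is unique,
     so [p] is the projection of the first. *)
  have pb u : val (p u) = base u by apply/nu_overP.
  have pN : p = nu_proj hN by apply/funext => u; apply: val_inj; rewrite pb nu_projE.
  have {}pb : (fun u => val (p u)) = (fun u => base u) by apply/funext.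
  rewrite pb in sb; rewrite pN in sE sK.
  apply: manifold_eq; apply: (weighted_bundle_unique EW GB' _ sb ss _ sE).
    by move=> k; rewrite -hE (homogE hN EW).
  by move=> x; rewrite -(nu_projE hN) sK.
move=> c w hc; split; first exact: (nu_incl_bij hN).
exists (nu_chart W c w); split; [exact: (nu_chart_graded EW hc)|by rewrite (nu_restrE hN)|].
move=> v a; have [x vx] := hom_over_exists v (mfd_second_countable S).
by rewrite /= mxE (nu_incl_germ vx)//; exact: wt_coord.
Qed.
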